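(* Let $\{X_t\}_{t\in\mathbb Z}$ be a strictly stationary sequence of random elements of $L^2([0,1],\mathbb R)$ with $\mathbb E\|X_0\|_2^2<\infty$, with autocovariance kernels $r_t$ and autocovariance operators $\mathscr R_t$. Suppose $p=2$ or $p=\infty$, and consider the conditions: I($p$): $\sum_{t\in\mathbb Z}\|r_t\|_p<\infty$; II: $\sum_{t\in\mathbb Z}|||\mathscr R_t|||_1<\infty$. (A) Under I($p$), for any $\omega\in\mathbb R$ the series $$f_\omega(\cdot,\cdot)=\frac1{2\pi}\sum_{t\in\mathbb Z}\exp(-\mathrm i\omega t)\,r_t(\cdot,\cdot)$$ converges in $\|\cdot\|_p$. The limit $f_\omega$ (the spectral density kernel at frequency $\omega$) is uniformly bounded (in $\|\cdot\|_p$, over $\omega\in\mathbb R$) and uniformly continuous in $\omega$ with respect to $\|\cdot\|_p$: given $\varepsilon>0$ there exists $\delta>0$ such that $|\omega_1-\omega_2|<\delta$ implies $\|f_{\omega_1}-f_{\omega_2}\|_p<\varepsilon$. The spectral density operator $\mathscr F_\omega$, i.e. the operator induced by $f_\omega$ through right integration, is self-adjoint and nonnegative definite for all $\omega\in\mathbb R$. Furthermore, the inversion formula $$\int_0^{2\pi} f_\alpha(\tau,\sigma)e^{\mathrm i t\alpha}\,d\alpha=r_t(\tau,\sigma)\qquad\forall t,\tau,\sigma$$ holds in $\|\cdot\|_p$. (B) Under only II, $$\mathscr F_\omega=\frac1{2\pi}\sum_{t\in\mathbb Z}e^{-\mathrm i\omega t}\mathscr R_t,$$ where the convergence holds in nuclear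 norm. In particular, the spectral density operators are nuclear, and $|||\mathscr F_\omega|||_1\le\frac1{2\pi}\sum_{t}|||\mathscr R_t|||_1<\infty$.
   Context: $\mu(\tau)=\mathbb E X_0(\tau)$ is the mean function. The autocovariance kernel at lag $t$ is $r_t(\tau,\sigma)=\mathbb E[(X_{t+s}(\tau)-\mu(\tau))(X_s(\sigma)-\mu(\sigma))]$, $\tau,\sigma\in[0,1]$ (independent of $s$); it is defined as an element of $L^2([0,1]^2)$, and also pointwise if $X_t$ is continuous in mean square. The autocovariance operator is $\mathscr R_t h(\tau)=\int_0^1 r_t(\tau,\sigma)h(\sigma)\,d\sigma$. For kernels on $[0,1]^2$, $\|\cdot\|_2$ is the $L^2([0,1]^2)$ norm and $\|g\|_\infty=\sup|g|$. $|||\cdot|||_1$ is the nuclear norm (Schatten 1-norm). The operator induced by a kernel $k$ through right integration is $h\mapsto\int_0^1k(\cdot,\sigma)h(\sigma)\,d\sigma$, on $L^2([0,1],\mathbb C)$. *)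

(* Defs.v *)
From HB Require Import structures.
From mathcomp Require Import all_boot all_order all_algebra.
From mathcomp Require Import all_classical all_reals all_analysis.
From mathcomp Require Import measurable_realfun complex.

Set Implicit Arguments.
Unset Strict Implicit.
Unset Printing Implicit Defensive.
Import Order.TTheory GRing.Theory Num.Theory.
Import numFieldNormedType.Exports.
Import ComplexField.

Local Open Scope classical_set_scope.
Local Open Scope ring_scope.
Local Open Scope complex_scope.

Lemma leb01_fin (R : realType) :
  ((@lebesgue_measure R) (`[0%R, 1%R] : set R) < +oo)%E.
Proof. by rewrite lebesgue_measure_itv /=; case: ifP => _; rewrite ?ltry. Qed.

(* Functions on [0, 1] and on [0, 1]^2 are represented by functions on R and on
   R * R; the measures below, and the supremum in [knorm], ignore their values
   outside [0, 1] and [0, 1]^2. *)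
Definition leb01 (R : realType) :
    {finite_measure set (measurableTypeR R) -> \bar R} :=
  @mfrestr _ (measurableTypeR R) R `[0%R, 1%R] lebesgue_measure
    (measurable_itv `[0%R, 1%R]) (leb01_fin R).

Definition leb01sq (R : realType) :
    {measure set (measurableTypeR R * measurableTypeR R) -> \bar R} :=
  (leb01 R \x leb01 R)%E.

Definition L2 (R : realType) : Type := LspaceType2 (leb01 R).

Definition L2fun (R : realType) (x : L2 R) : R -> R :=
  (x : LspaceType2 (leb01 R)).

Section L2_pointed.
Context {R : realType}.

Let cst0 : {mfun measurableTypeR R >-> measurableTypeR R} := cst (0 : R).

Let zero : {mfun_ (leb01 R), measurableTypeR R >-> measurableTypeR R} :=
  \pi_({mfun_ (leb01 R), measurableTypeR R >-> measurableTypeR R})%qT cst0.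

Let zero_fin : finite_norm (leb01 R) 2%:R%:E (zero : R -> R).
Proof.
have z0 : ae_eq (leb01 R) setT (zero : R -> R) (cst 0).
  have /eqmodP/asboolP : (repr zero =
    cst0 %[mod {mfun_ (leb01 R), measurableTypeR R >-> measurableTypeR R}])%qT.
    by rewrite reprK.
  exact.
rewrite /finite_norm unlock /= (@ae_eq_integral _ _ _ _ setT (cst 0%E)).
- by rewrite integral0 poweR0r// invr_neq0.
- by [].
- apply/measurable_EFinP; apply: (measurableT_comp (measurable_powR _)).
  by apply: measurableT_comp => //; exact: measurable_funPT.
- exact: measurable_cst.
- by apply: filterS z0 => x /(_ I) zx _ /=; rewrite zx normr0 powR0.
Qed.

HB.instance Definition _ := gen_eqMixin (L2 R).
HB.instance Definition _ := gen_choiceMixin (L2 R).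
#[local] HB.instance Definition _ :=
  isFinLebesgue.Build _ _ _ (leb01 R) _ (lee1n 2) zero zero_fin.
HB.instance Definition _ :=
  isPointed.Build (L2 R) (zero : LspaceType2 (leb01 R)).

End L2_pointed.

Section random_elements.
Context {R : realType}.

Definition L2norm (x : L2 R) : \bar R := 'N[leb01 R]_2%:E[EFin \o L2fun x]%E.

Definition L2dist (x y : L2 R) : \bar R :=
  'N[leb01 R]_2%:E[EFin \o (L2fun x \- L2fun y)%R]%E.

Definition L2open (U : set (L2 R)) : Prop :=
  forall x, U x ->
    exists2 e : R, 0 < e & forall y, (L2dist y x < e%:E)%E -> U y.

Definition L2borel := g_sigma_algebraType L2open.

Context {d : measure_display} {Om : measurableType d} {P : probability Om R}.

(* Equality of the joint laws on the product sigma-algebra of L^2^n. *)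
Definition strictly_stationary (X : int -> {RV P >-> L2borel}) : Prop :=
  forall (n : nat) (t : n.-tuple int) (s : int) (A : set (n.-tuple L2borel)),
    measurable A ->
    P [set w | A [tuple X (tnth t i + s) w | i < n]] =
    P [set w | A [tuple X (tnth t i) w | i < n]].

(* X w is only a class modulo a.e. equality: its value at tau is
   understood through a jointly measurable choice of representatives. *)
Definition measurable_version (X : Om -> L2 R) (Y : Om -> R -> R) : Prop :=
  measurable_fun [set: Om * measurableTypeR R] (fun x => Y x.1 x.2) /\
  forall w, ae_eq (leb01 R) setT (Y w) (L2fun (X w)).

Definition mean_fun (Y : int -> Om -> R -> R) (tau : R) : R :=
  fine 'E_P[fun w => Y 0 w tau].

(* The covariance between times t + s and s, taken at s = 0. *)
Definition autocov (Y : int -> Om -> R -> R) (t : int) (tau sigma : R) : R :=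
  fine 'E_P[fun w =>
    (Y t w tau - mean_fun Y tau) * (Y 0 w sigma - mean_fun Y sigma)].

(* The family r consists of arbitrary representatives of the classes r_t in
   L^2([0, 1]^2). If X is continuous in mean square, the pointwise defined
   covariances are among them. *)
Definition autocov_kernels (X : int -> {RV P >-> L2borel})
    (r : int -> R -> R -> R) : Prop :=
  (forall t, (fun x => r t x.1 x.2) \in Lfun (leb01sq R) 2%:E) /\
  exists2 Y : int -> Om -> R -> R,
    (forall t, measurable_version (X t) (Y t)) &
    forall t, ae_eq (leb01sq R) setT
      (fun x => r t x.1 x.2) (fun x => autocov Y t x.1 x.2).

End random_elements.

Section kernels_and_operators.
Context {R : realType}.
Local Notation C := R[i].
Implicit Types (k : R -> R -> C) (h g : R -> C) (A : (R -> C) -> R -> C).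

Definition expi (x : R) : C := cos x +i* sin x.

Definition cLfun2 (d : measure_display) (U : measurableType d)
    (mu : {measure set U -> \bar R}) (f : U -> C) : Prop :=
  (fun x => complex.Re (f x)) \in Lfun mu 2%:E /\
  (fun x => complex.Im (f x)) \in Lfun mu 2%:E.

Definition cint (d : measure_display) (U : measurableType d)
    (mu : {measure set U -> \bar R}) (D : set U) (f : U -> C) : C :=
  (\int[mu]_(x in D) complex.Re (f x))%R +i*
  (\int[mu]_(x in D) complex.Im (f x))%R.

Definition cnorm2 h : \bar R :=
  'N[leb01 R]_2%:E[EFin \o (fun x => Normc.normc (h x))]%E.

Definition cinner h g : C := cint (leb01 R) setT (fun x => h x * (g x)^*).

Definition ckernel (k : R -> R -> R) : R -> R -> C :=
  fun tau sigma => (k tau sigma)%:C.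

(* For p = +oo this is a true supremum, not an essential one. *)
Definition knorm (p : \bar R) k : \bar R :=
  if p == +oo%E then
    ereal_sup [set (Normc.normc (k x.1 x.2))%:E
              | x in `[0%R, 1%R] `*` `[0%R, 1%R]]
  else 'N[leb01sq R]_p[EFin \o (fun x => Normc.normc (k x.1 x.2))]%E.

Definition int_op k : (R -> C) -> R -> C :=
  fun h tau => cint (leb01 R) setT (fun sigma => k tau sigma * h sigma).

Definition self_adjoint A : Prop :=
  (forall h, cLfun2 (leb01 R) h -> cLfun2 (leb01 R) (A h)) /\
  forall h g, cLfun2 (leb01 R) h -> cLfun2 (leb01 R) g ->
    cinner (A h) g = cinner h (A g).

(* In the order of C, 0 <= z means that z is real and nonnegative. *)
Definition nonneg_definite A : Prop :=
  forall h, cLfun2 (leb01 R) h -> 0 <= cinner (A h) h.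

(* A h = sum_n <h, v_n> u_n for all h, with convergence in L^2. *)
Definition nuclear_representation A (u v : nat -> R -> C) : Prop :=
  (forall n, cLfun2 (leb01 R) (u n) /\ cLfun2 (leb01 R) (v n)) /\
  forall h, cLfun2 (leb01 R) h ->
    cnorm2 (fun x => A h x - \sum_(i < n) cinner h (v i) * u i x)
      @[n --> \oo] --> 0%E.

(* The infimum of sum_n |u_n| |v_n| over all nuclear representations, +oo if A is
   not nuclear; on a Hilbert space this is the sum of the singular values. *)
Definition nuclear_norm A : \bar R :=
  ereal_inf [set s | exists u v, nuclear_representation A u v /\
    s = (\sum_(0 <= n <oo) (cnorm2 (u n) * cnorm2 (v n)))%E].

Definition zsum (V : nmodType) (m n : nat) (F : int -> V) : V :=
  \sum_(k < (m + n).+1) F (k%:Z - m%:Z).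

Definition spectral_psum (r : int -> R -> R -> R) (omega : R) (m n : nat) :
    R -> R -> C :=
  fun tau sigma => ((2 * pi)^-1)%:C *
    zsum m n (fun t => expi (- (omega * t%:~R)) * ckernel (r t) tau sigma).

Definition spectral_op_psum (r : int -> R -> R -> R) (omega : R) (m n : nat) :
    (R -> C) -> R -> C :=
  fun h tau => ((2 * pi)^-1)%:C *
    zsum m n (fun t => expi (- (omega * t%:~R)) * int_op (ckernel (r t)) h tau).

(* f is the limit in knorm p of the sums over -m <= t <= n, as m and n tend to
   infinity independently. *)
Definition spectral_density_kernel (p : \bar R) (r : int -> R -> R -> R)
    (omega : R) (f : R -> R -> C) : Prop :=
  cLfun2 (leb01sq R) (fun x => f x.1 x.2) /\
  knorm p (fun tau sigma =>
      f tau sigma - spectral_psum r omega mn.1 mn.2 tau sigma)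
    @[mn --> (\oo, \oo)] --> 0%E.

Definition jointly_measurable (f : R -> R -> R -> C) : Prop :=
  measurable_fun
    [set: measurableTypeR R * (measurableTypeR R * measurableTypeR R)]
    (fun x => complex.Re (f x.1 x.2.1 x.2.2)) /\
  measurable_fun
    [set: measurableTypeR R * (measurableTypeR R * measurableTypeR R)]
    (fun x => complex.Im (f x.1 x.2.1 x.2.2)).

(* The first clause says that the integral in the second one, a total
   operation, is a genuine Lebesgue integral. *)
Definition inversion_formula (p : \bar R) (r : int -> R -> R -> R)
    (f : R -> R -> R -> C) : Prop :=
  {ae leb01sq R, forall x, (@lebesgue_measure R).-integrable `[0, 2 * pi]
     (fun alpha => (Normc.normc (f alpha x.1 x.2))%:E)} /\
  forall t : int, knorm p (fun tau sigma =>
    cint (@lebesgue_measure R) `[0, 2 * pi]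
      (fun alpha => f alpha tau sigma * expi (t%:~R * alpha))
    - ckernel (r t) tau sigma) = 0%E.

End kernels_and_operators.

(* Main.v *)
(* By Minkowski's inequality the spectral series converges absolutely almost
   everywhere (everywhere if p = oo), which gives a limit that is jointly measurable
   in the frequency and both arguments; boundedness and uniform continuity follow
   from the tail estimate, which does not depend on the frequency. The inversion
   formula is a termwise integration against exp(i t alpha), justified by a.e. uniform
   convergence in alpha. With zeta_t(h) the (centred) integral of X_t h, stationarity
   and Fubini give <R_t h, g> = E[zeta_s(h) conj(zeta_(t+s)(g))]; self-adjointness
   comes from the symmetry of this form, and nonnegativity from Fejer's argument,
   because the Cesaro means of the partial sums are second moments of
   sum_(t < N) exp(i omega t) zeta_t(h).
   For part B, the L^2 norm of a kernel is at most the nuclear norm of its operator,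
   so that II implies I(2), and the nuclear norm, an infimum over representations, is
   countably subadditive along pointwise convergent series of operators; this is
   applied to F_omega and to its differences with the partial sums. *)
From HB Require Import structures.
Require Import Defs.
From mathcomp Require Import all_boot all_order all_algebra.
From mathcomp Require Import all_classical all_reals all_analysis.
From mathcomp Require Import measurable_realfun complex.
From mathcomp Require Import ring lra zify.

Set Implicit Arguments.
Unset Strict Implicit.
Unset Printing Implicit Defensive.
Import Order.TTheory GRing.Theory Num.Theory.
Import numFieldNormedType.Exports.
Import ComplexField.

Local Open Scope classical_set_scope.
Local Open Scope ring_scope.
Local Open Scope complex_scope.

Local Arguments Normc.normc : simpl never.

(** * Complex-valued square integrable functions *)

(** The true supremum for p = oo and the joint measurability behind the inversion integral rule out
    limits taken in a quotient space. The limit is therefore built pointwise, and everything rests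
    on one inequality, valid at every point and frequency with [+oo] allowed: its distance to the
    sum over -m <= t <= n is at most a tail, starting at any N <= m, n, of a series free of the
    frequency. The conclusions concern any family [f] converging frequency by frequency, with ranks
    that may depend on the frequency; comparison with the constructed family restores uniformity.
    Kernel operators are linear in the kernel only almost everywhere, since [cint], a total
    operation, need not be additive at bad sections. Identities are therefore transferred to the
    sesquilinear form [qform], an integral over the square. An L^2 kernel is determined by this
    form, tested on rectangles; this links a nuclear representation to the kernel of its
    operator. *)

(* [filterS] with the [Filter] instance fixed: instance search fails on
   measures that reach [almost_everywhere] through different coercions. *)
Section almost_everywhere.
Context {d : measure_display} {T : measurableType d} {R : realType}.
Variable mu : {measure set T -> \bar R}.

Lemma aeS (P Q : T -> Prop) : {ae mu, forall x, P x} -> (forall x, P x -> Q x) ->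
  {ae mu, forall x, Q x}.
Proof. by move=> HP PQ; apply: filterS HP. Qed.

Lemma aeS2 (P P' Q : T -> Prop) : {ae mu, forall x, P x} -> {ae mu, forall x, P' x} ->
  (forall x, P x -> P' x -> Q x) -> {ae mu, forall x, Q x}.
Proof. by move=> HP HP' PQ; apply: filterS2 HP HP'. Qed.

Lemma aeS3 (P P' P'' Q : T -> Prop) : {ae mu, forall x, P x} ->
  {ae mu, forall x, P' x} -> {ae mu, forall x, P'' x} ->
  (forall x, P x -> P' x -> P'' x -> Q x) -> {ae mu, forall x, Q x}.
Proof. by move=> HP HP' HP'' PQ; apply: filterS3 HP HP' HP''. Qed.

End almost_everywhere.

Section complex_modulus.
Context {R : rcfType}.
Implicit Types z w : R[i].

Lemma normcE2 z : Normc.normc z = Num.sqrt (complex.Re z ^+ 2 + complex.Im z ^+ 2).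
Proof. by case: z. Qed.

Lemma normc_ge0 z : 0 <= Normc.normc z.
Proof. by rewrite normcE2 sqrtr_ge0. Qed.

Lemma sqr_normc2 z : Normc.normc z ^+ 2 = complex.Re z ^+ 2 + complex.Im z ^+ 2.
Proof. by rewrite normcE2 sqr_sqrtr// addr_ge0 ?sqr_ge0. Qed.

Lemma ReM z w : complex.Re (z * w) =
  complex.Re z * complex.Re w - complex.Im z * complex.Im w.
Proof. by case: z w => [a b] [c d]. Qed.

Lemma ImM z w : complex.Im (z * w) =
  complex.Re z * complex.Im w + complex.Im z * complex.Re w.
Proof. by case: z w => [a b] [c d]. Qed.

Lemma ReD z w : complex.Re (z + w) = complex.Re z + complex.Re w.
Proof. by case: z w => [a b] [c d]. Qed.

Lemma ImD z w : complex.Im (z + w) = complex.Im z + complex.Im w.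
Proof. by case: z w => [a b] [c d]. Qed.

Lemma ReN z : complex.Re (- z) = - complex.Re z.
Proof. by case: z. Qed.

Lemma ImN z : complex.Im (- z) = - complex.Im z.
Proof. by case: z. Qed.

Lemma Re_conjc z : complex.Re z^* = complex.Re z.
Proof. by case: z. Qed.

Lemma Im_conjc z : complex.Im z^* = - complex.Im z.
Proof. by case: z. Qed.

Definition cReE := (ReM, ImM, ReD, ImD, ReN, ImN, Re_conjc, Im_conjc).

Lemma Re_sum (I : Type) (s : seq I) (P : pred I) (F : I -> R[i]) :
  complex.Re (\sum_(i <- s | P i) F i) = \sum_(i <- s | P i) complex.Re (F i).
Proof. by elim/big_rec2: _ => //= i x y _ <-; rewrite ReD. Qed.

Lemma Im_sum (I : Type) (s : seq I) (P : pred I) (F : I -> R[i]) :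
  complex.Im (\sum_(i <- s | P i) F i) = \sum_(i <- s | P i) complex.Im (F i).
Proof. by elim/big_rec2: _ => //= i x y _ <-; rewrite ImD. Qed.

Lemma ler_Re_normc z : `|complex.Re z| <= Normc.normc z.
Proof.
rewrite -[leRHS]ger0_norm ?normc_ge0// -ler_sqr ?nnegrE// !real_normK ?num_real//.
by rewrite sqr_normc2 lerDl sqr_ge0.
Qed.

Lemma ler_Im_normc z : `|complex.Im z| <= Normc.normc z.
Proof.
rewrite -[leRHS]ger0_norm ?normc_ge0// -ler_sqr ?nnegrE// !real_normK ?num_real//.
by rewrite sqr_normc2 lerDr sqr_ge0.
Qed.

Lemma normc_le_ReIm z : Normc.normc z <= `|complex.Re z| + `|complex.Im z|.
Proof.
rewrite -ler_sqr ?nnegrE ?addr_ge0 ?normc_ge0// sqr_normc2.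
rewrite sqrrD !real_normK ?num_real// addrAC lerDl.
by rewrite mulrn_wge0// mulr_ge0.
Qed.

Lemma normc_real (x : R) : Normc.normc x%:C = `|x|.
Proof. by rewrite normcE2/= expr0n/= addr0 sqrtr_sqr. Qed.

Lemma normc_conjc z : Normc.normc z^* = Normc.normc z.
Proof. by rewrite !normcE2 !cReE sqrrN. Qed.

Lemma normc_sum (I : Type) (s : seq I) (P : pred I) (F : I -> R[i]) :
  Normc.normc (\sum_(i <- s | P i) F i) <= \sum_(i <- s | P i) Normc.normc (F i).
Proof.
elim/big_rec2: _ => [|i x y _ le_yx]; first by rewrite Normc.normc0.
by rewrite (le_trans (le_normcD _ _))// lerD2l.
Qed.

Lemma normcB z w : Normc.normc (z - w) = Normc.normc (w - z).
Proof. by rewrite -opprB normcN. Qed.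

Lemma normc_le0_eq z : Normc.normc z <= 0 -> z = 0.
Proof.
by move=> z0; apply: Normc.eq0_normc; apply/eqP; rewrite eq_le z0 normc_ge0.
Qed.

Lemma complexP z w :
  complex.Re z = complex.Re w -> complex.Im z = complex.Im w -> z = w.
Proof. by case: z w => [a b] [c d] /= -> ->. Qed.

End complex_modulus.

Section complex_L2.
Context {d : measure_display} {T : measurableType d} {R : realType}.
Variable mu : {measure set T -> \bar R}.
Implicit Types f g : T -> R[i].

Definition cmeas f :=
  measurable_fun [set: T] (fun x => complex.Re (f x)) /\
  measurable_fun [set: T] (fun x => complex.Im (f x)).

(** [cnorm2] and [knorm 2] are this norm on [0, 1] and on the square by conversion, so one theory
    serves functions and kernels. *)
Definition cN f : \bar R := 'N[mu]_2%:E[EFin \o (fun x => Normc.normc (f x))]%E.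

Lemma cmeas_normc f : cmeas f -> measurable_fun [set: T] (fun x => Normc.normc (f x)).
Proof.
move=> [mr mi]; under eq_fun do rewrite normcE2.
apply: measurableT_comp; first exact: (continuous_measurable_fun (@sqrt_continuous R)).
by apply: measurable_funD; exact: measurable_funX.
Qed.

Lemma cmeas_cst z : cmeas (fun=> z).
Proof. by split; exact: measurable_cst. Qed.

Lemma cmeasD f g : cmeas f -> cmeas g -> cmeas (fun x => f x + g x).
Proof.
move=> [fr fi] [gr gi]; split; under eq_fun do rewrite cReE;
  exact: measurable_funD.
Qed.

Lemma cmeasM f g : cmeas f -> cmeas g -> cmeas (fun x => f x * g x).
Proof.
move=> [fr fi] [gr gi]; split; under eq_fun do rewrite cReE.
  by apply: measurable_funB; exact: measurable_funM.
by apply: measurable_funD; exact: measurable_funM.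
Qed.

Lemma cmeasN f : cmeas f -> cmeas (fun x => - f x).
Proof.
by move=> [fr fi]; split; under eq_fun do rewrite cReE; exact: measurableT_comp.
Qed.

Lemma cmeasB f g : cmeas f -> cmeas g -> cmeas (fun x => f x - g x).
Proof. by move=> mf mg; apply: cmeasD => //; exact: cmeasN. Qed.

Lemma cmeas_conj f : cmeas f -> cmeas (fun x => (f x)^*).
Proof.
move=> [fr fi]; split; under eq_fun do rewrite cReE; first exact: fr.
exact: measurableT_comp.
Qed.

Lemma cmeas_sum (I : Type) (s : seq I) (F : I -> T -> R[i]) :
  (forall i, cmeas (F i)) -> cmeas (fun x => \sum_(i <- s) F i x).
Proof.
move=> mF; elim: s => [|i s IHs].
  by under eq_fun do rewrite big_nil; exact: cmeas_cst.
by under eq_fun do rewrite big_cons; exact: cmeasD.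
Qed.

Lemma cmeas_real (f : T -> R) : measurable_fun [set: T] f -> cmeas (fun x => (f x)%:C).
Proof. by move=> mf; split => //=; exact: measurable_cst. Qed.

Lemma cN_ge0 f : (0 <= cN f)%E.
Proof. exact: Lnorm_ge0. Qed.

Lemma integral_normc2_ge0 f : (0 <= \int[mu]_x (Normc.normc (f x) ^+ 2)%:E)%E.
Proof. by apply: integral_ge0 => x _; rewrite lee_fin sqr_ge0. Qed.

Lemma cN_sqrt f : cN f = ((\int[mu]_x (Normc.normc (f x) ^+ 2)%:E) `^ 2^-1)%E.
Proof.
rewrite /cN unlock; congr poweR; apply: eq_integral => x _ /=.
by rewrite powR_mulrn ?normr_ge0// real_normK// num_real.
Qed.

Lemma cN_sqr f : (cN f * cN f = \int[mu]_x (Normc.normc (f x) ^+ 2)%:E)%E.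
Proof.
rewrite cN_sqrt -poweRD; last by rewrite add_neq0_poweRD_def// -[X in X != 0]splitr oner_eq0.
by rewrite -div1r -splitr poweRe1// integral_normc2_ge0.
Qed.

Lemma cN_le_ae f g : cmeas f -> cmeas g ->
  {ae mu, forall x, Normc.normc (f x) <= Normc.normc (g x)} -> (cN f <= cN g)%E.
Proof.
move=> mf mg fg; rewrite !cN_sqrt gt0_ler_poweR//.
- by rewrite in_itv/= integral_normc2_ge0 leey.
- by rewrite in_itv/= integral_normc2_ge0 leey.
- apply: ae_ge0_le_integral => //.
  + by move=> x _; rewrite lee_fin sqr_ge0.
  + by apply/measurable_EFinP/measurable_funX; exact: cmeas_normc.
  + by move=> x _; rewrite lee_fin sqr_ge0.
  + by apply/measurable_EFinP/measurable_funX; exact: cmeas_normc.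
  + apply: filterS fg => x fg _.
    by rewrite lee_fin ler_sqr// nnegrE normc_ge0.
Qed.

Lemma cN_le f g : cmeas f -> cmeas g ->
  (forall x, Normc.normc (f x) <= Normc.normc (g x)) -> (cN f <= cN g)%E.
Proof. by move=> mf mg fg; apply: cN_le_ae => //; apply: nearW => x; exact: fg. Qed.

Lemma cN_ae f g : cmeas f -> cmeas g ->
  {ae mu, forall x, f x = g x} -> cN f = cN g.
Proof.
move=> mf mg fg; apply/eqP; rewrite eq_le; apply/andP; split;
  by apply: cN_le_ae => //; apply: filterS fg => x ->.
Qed.

Lemma eq_cN f g : (forall x, f x = g x) -> cN f = cN g.
Proof. by move=> /funext ->. Qed.

Lemma cN_ge0_real (g : T -> R) : (forall x, 0 <= g x) ->
  cN (fun x => (g x)%:C) = 'N[mu]_2%:E[EFin \o g]%E.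
Proof.
move=> g0; rewrite /cN; congr Lnorm; apply/funext => x.
by rewrite /comp normc_real ger0_norm.
Qed.

Lemma cND f g : cmeas f -> cmeas g -> (cN (fun x => f x + g x)%R <= cN f + cN g)%E.
Proof.
move=> mf mg.
apply: (@le_trans _ _ (cN (fun x => (Normc.normc (f x) + Normc.normc (g x))%:C))).
  apply: cN_le; first exact: cmeasD.
    by apply/cmeas_real/measurable_funD; exact: cmeas_normc.
  move=> x; rewrite normc_real ger0_norm ?addr_ge0 ?normc_ge0//.
  exact: le_normcD.
rewrite cN_ge0_real => [|x]; last by rewrite addr_ge0 ?normc_ge0.
by apply: minkowski_EFin; [exact: cmeas_normc|exact: cmeas_normc|rewrite ler1n].
Qed.

Lemma cNZ (z : R[i]) f : cmeas f ->
  (cN (fun x => z * f x)%R = (Normc.normc z)%:E * cN f)%E.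
Proof.
move=> mf; rewrite !cN_sqrt.
under eq_integral do rewrite Normc.normcM exprMn EFinM.
rewrite ge0_integralZl_EFin ?sqr_ge0//; last 2 first.
- by move=> x _; rewrite lee_fin sqr_ge0.
- by apply/measurable_EFinP/measurable_funX; exact: cmeas_normc.
rewrite poweRM ?lee_fin ?sqr_ge0 ?integral_normc2_ge0//; congr (_ * _)%E.
rewrite poweR_EFin -powR_mulrn ?normc_ge0// -powRrM divff// powRr1//.
exact: normc_ge0.
Qed.

Lemma cN0 : cN (fun=> 0) = 0%E.
Proof.
rewrite /cN; under [X in ('N[_]__[X])%E]eq_fun do rewrite /= Normc.normc0.
by rewrite Lnorm0.
Qed.

Lemma cNN f : cN (fun x => - f x) = cN f.
Proof. by rewrite /cN; under [X in ('N[_]__[X])%E]eq_fun do rewrite /= normcN. Qed.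

Lemma cNB f g : cmeas f -> cmeas g -> (cN (fun x => f x - g x)%R <= cN f + cN g)%E.
Proof. by move=> mf mg; rewrite -(cNN g); apply: cND => //; exact: cmeasN. Qed.

Lemma cNBC f g : cN (fun x => f x - g x) = cN (fun x => g x - f x).
Proof. by rewrite -cNN; apply: eq_cN => x; rewrite opprB. Qed.

Lemma cN_conj f : cN (fun x => (f x)^*) = cN f.
Proof. by rewrite /cN; under [X in ('N[_]__[X])%E]eq_fun do rewrite /= normc_conjc. Qed.

Lemma cN_sum (I : Type) (s : seq I) (F : I -> T -> R[i]) :
  (forall i, cmeas (F i)) ->
  (cN (fun x => \sum_(i <- s) F i x)%R <= \sum_(i <- s) cN (F i))%E.
Proof.
move=> mF; elim: s => [|i s IHs].
  by under eq_cN do rewrite big_nil; rewrite cN0 big_nil.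
under eq_cN do rewrite big_cons; rewrite big_cons.
by apply: (le_trans (cND _ _)) => //; [exact: cmeas_sum|exact: leeD2l].
Qed.

Lemma cN_eq0_ae f : cmeas f -> cN f = 0%E -> {ae mu, forall x, f x = 0}.
Proof.
move=> mf f0.
have mnf : measurable_fun [set: T] (EFin \o (fun x => Normc.normc (f x))).
  by apply/measurable_EFinP; exact: cmeas_normc.
have p0 : (0 < 2%:E :> \bar R)%E by rewrite lte_fin.
have := Lnorm_eq0_eq0 mnf p0 f0; apply: filterS.
by move=> x /(_ I) [] /Normc.eq0_normc.
Qed.

(** With [cN_sqr], norms are compared through their squares, which are plain integrals to which
    Tonelli and monotone convergence apply; infinite values are allowed. *)
Lemma mule_self_le (a b : \bar R) : (0 <= a -> 0 <= b -> a * a <= b * b -> a <= b)%E.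
Proof.
case: a b => [a| |] [b| |]//; rewrite ?leey// ?lee_fin.
by move=> a0 b0; rewrite -!expr2 ler_sqr ?nnegrE.
Qed.

Lemma mule_def_self (a : \bar R) : (a *? a)%E.
Proof.
case: a => [a| |]; first exact: mule_def_fin.
  by rewrite mule_def_neq0_infty.
by rewrite mule_def_neq0_infty.
Qed.

(** Countable Minkowski inequality: the squares of the partial sums of the moduli increase to the
    square of the sum, and monotone convergence passes the finite inequality to the limit. Either
    series may be infinite. *)
Lemma cN_series f (b : nat -> T -> R[i]) (N : nat) : cmeas f -> (forall n, cmeas (b n)) ->
  (forall x, (Normc.normc (f x))%:E <= \sum_(N <= n <oo) (Normc.normc (b n x))%:E)%E ->
  (cN f <= \sum_(N <= n <oo) cN (b n))%E.
Proof.
move=> mf mb fb.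
pose s n x : R := \sum_(N <= i < n) Normc.normc (b i x).
have ms n : measurable_fun [set: T] (s n).
  by apply: measurable_sum => i; exact: cmeas_normc.
have s0 n x : 0 <= s n x by apply: sumr_ge0 => i _; exact: normc_ge0.
have snd x : {homo (fun n => s n x) : m n / (m <= n)%N >-> m <= n}.
  move=> m n mn; rewrite -lee_fin /s -!sumEFin.
  apply: (@ereal_nondecreasing_series _ (fun i => (Normc.normc (b i x))%:E)) => //.
  by move=> i _ _; rewrite lee_fin normc_ge0.
have cs x : (s n x)%:E @[n --> \oo] --> (\sum_(N <= n <oo) (Normc.normc (b n x))%:E)%E.
  rewrite (_ : (fun n => (s n x)%:E) =
      (fun n => \sum_(N <= i < n) (Normc.normc (b i x))%:E)%E); last first.
    by apply/funext => n; rewrite sumEFin.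
  by apply: is_cvg_nneseries => n _ _; rewrite lee_fin normc_ge0.
apply: mule_self_le; [exact: cN_ge0|by apply: nneseries_ge0 => *; exact: cN_ge0|].
rewrite cN_sqr.
apply: (@le_trans _ _ (\int[mu]_x limn (fun n => (s n x * s n x)%:E))%E).
  apply: ge0_le_integral => //.
  - by move=> x _; rewrite lee_fin sqr_ge0.
  - by apply/measurable_EFinP/measurable_funX; exact: cmeas_normc.
  - apply: (@emeasurable_fun_cvg _ _ _ _ (fun n x => (s n x * s n x)%:E)) => //.
      by move=> n; apply/measurable_EFinP; exact: measurable_funM.
    move=> x _; apply: ereal_nondecreasing_is_cvgn => m n mn.
    by rewrite lee_fin ler_pM// snd.
  - move=> x _; have csx := cs x.
    have L0 : (0 <= \sum_(N <= n <oo) (Normc.normc (b n x))%:E)%E.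
      by apply: nneseries_ge0 => n _ _; rewrite lee_fin normc_ge0.
    (* The limit of the squares is the square of the limit, also when it is infinite. *)
    have -> : limn (fun n => (s n x * s n x)%:E) =
        ((\sum_(N <= n <oo) (Normc.normc (b n x))%:E) *
         (\sum_(N <= n <oo) (Normc.normc (b n x))%:E))%E.
      apply/cvg_lim => //; under eq_fun do rewrite EFinM.
      apply: cvgeM => //; exact: mule_def_self.
    rewrite expr2 EFinM; apply: lee_pmul => //; rewrite lee_fin normc_ge0//.
rewrite monotone_convergence//; last 3 first.
- by move=> n; apply/measurable_EFinP; exact: measurable_funM.
- by move=> n x _; rewrite lee_fin mulr_ge0.
- by move=> x _ m n mn; rewrite lee_fin ler_pM// snd.
apply: lime_le.
  apply: ereal_nondecreasing_is_cvgn => m n mn; apply: ge0_le_integral => //.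
  - by move=> x _; rewrite lee_fin mulr_ge0.
  - by apply/measurable_EFinP; exact: measurable_funM.
  - by apply/measurable_EFinP; exact: measurable_funM.
  - by move=> x _; rewrite lee_fin ler_pM// snd.
apply: nearW => n.
have -> : (\int[mu]_x (s n x * s n x)%:E = cN (fun x => (s n x)%:C) * cN (fun x => (s n x)%:C))%E.
  rewrite cN_sqr; apply: eq_integral => x _.
  by rewrite normc_real real_normK ?num_real// expr2.
have sS : (cN (fun x => (s n x)%:C) <= \sum_(N <= n <oo) cN (b n))%E.
  apply: (@le_trans _ _ (\sum_(N <= i < n) cN (b i))%E); last first.
    by apply: nneseries_lim_ge => *; exact: cN_ge0.
  rewrite (_ : cN _ = cN (fun x => \sum_(N <= i < n) (Normc.normc (b i x))%:C)); last first.
    by apply: eq_cN => x; rewrite /s rmorph_sum.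
  apply: (le_trans (cN_sum _ _)).
    by move=> i; apply: cmeas_real; exact: cmeas_normc.
  apply: lee_sum => i _; apply: cN_le => //.
    by apply: cmeas_real; exact: cmeas_normc.
  by move=> x; rewrite normc_real ger0_norm// normc_ge0.
by apply: lee_pmul => //; exact: cN_ge0.
Qed.

End complex_L2.

Section complex_integral.
Context {d : measure_display} {T : measurableType d} {R : realType}.
Variable mu : {measure set T -> \bar R}.
Implicit Types (D : set T) (f g : T -> R[i]).

Definition cintg D f :=
  mu.-integrable D (fun x => (complex.Re (f x))%:E) /\
  mu.-integrable D (fun x => (complex.Im (f x))%:E).

Lemma integrable_cintg D f : measurable D ->
  measurable_fun D (fun x => complex.Re (f x)) ->
  measurable_fun D (fun x => complex.Im (f x)) ->
  mu.-integrable D (fun x => (Normc.normc (f x))%:E) -> cintg D f.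
Proof.
move=> mD mr mi fi; split.
  apply: le_integrable fi => //; first exact/measurable_EFinP.
  by move=> x Dx; rewrite !abse_EFin lee_fin [leRHS]ger0_norm ?normc_ge0// ler_Re_normc.
apply: le_integrable fi => //; first exact/measurable_EFinP.
by move=> x Dx; rewrite !abse_EFin lee_fin [leRHS]ger0_norm ?normc_ge0// ler_Im_normc.
Qed.

Lemma cintg_fin f : cmeas f -> (\int[mu]_x (Normc.normc (f x))%:E < +oo)%E ->
  cintg setT f.
Proof.
move=> [mr mi] fi; apply: integrable_cintg => //; apply/integrableP; split.
  by apply/measurable_EFinP; exact: cmeas_normc.
by under eq_integral do rewrite abse_EFin ger0_norm ?normc_ge0//.
Qed.

Lemma cintg_cmeas f : cintg setT f -> cmeas f.
Proof.
by move=> [/measurable_int/measurable_EFinP mr /measurable_int/measurable_EFinP mi].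
Qed.

Lemma cintg_normc D f : measurable D -> cintg D f ->
  mu.-integrable D (fun x => (Normc.normc (f x))%:E).
Proof.
move=> mD [fr fi].
have mr := measurable_int _ fr; have mi := measurable_int _ fi.
apply: (le_integrable mD) (integrableD mD (integrable_abse fr) (integrable_abse fi)).
  apply/measurable_EFinP; under eq_fun do rewrite normcE2.
  apply: measurableT_comp; first exact: (continuous_measurable_fun (@sqrt_continuous R)).
  by apply: measurable_funD; apply: measurable_funX; exact/measurable_EFinP.
move=> x Dx; rewrite /= lee_fin [leLHS]ger0_norm ?normc_ge0//.
by rewrite [leRHS]ger0_norm ?addr_ge0// normc_le_ReIm.
Qed.

Lemma cintgD D f g : measurable D -> cintg D f -> cintg D g ->
  cintg D (fun x => f x + g x).
Proof.
move=> mD [fr fi] [gr gi]; split.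
  under eq_fun do rewrite ReD EFinD; exact: integrableD.
under eq_fun do rewrite ImD EFinD; exact: integrableD.
Qed.

Lemma cintgZ D z f : measurable D -> cintg D f -> cintg D (fun x => z * f x).
Proof.
move=> mD [fr fi]; split.
  under eq_fun do rewrite ReM EFinB !EFinM.
  by apply: integrableB => //; exact: integrableZl.
under eq_fun do rewrite ImM EFinD !EFinM.
by apply: integrableD => //; exact: integrableZl.
Qed.

Lemma cintgN D f : measurable D -> cintg D f -> cintg D (fun x => - f x).
Proof.
by move=> mD fi; under eq_fun do rewrite -mulN1r; exact: cintgZ.
Qed.

Lemma cintgB D f g : measurable D -> cintg D f -> cintg D g ->
  cintg D (fun x => f x - g x).
Proof. by move=> mD fi gi; apply: cintgD => //; exact: cintgN. Qed.

Lemma cintg0 D : measurable D -> cintg D (fun=> 0).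
Proof. by move=> mD; split; exact: integrable0. Qed.

Lemma cintg_sum D (I : Type) (s : seq I) (F : I -> T -> R[i]) : measurable D ->
  (forall i, cintg D (F i)) -> cintg D (fun x => \sum_(i <- s) F i x).
Proof.
move=> mD iF; elim: s => [|i s IHs].
  by under eq_fun do rewrite big_nil; exact: cintg0.
by under eq_fun do rewrite big_cons; exact: cintgD.
Qed.

Lemma cintD D f g : measurable D -> cintg D f -> cintg D g ->
  cint mu D (fun x => f x + g x) = cint mu D f + cint mu D g.
Proof.
move=> mD [fr fi] [gr gi]; apply: complexP; rewrite cReE /cint /=.
  under eq_Rintegral do rewrite ReD; exact: RintegralD.
under eq_Rintegral do rewrite ImD; exact: RintegralD.
Qed.

Lemma cintZ D z f : measurable D -> cintg D f ->
  cint mu D (fun x => z * f x) = z * cint mu D f.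
Proof.
move=> mD [fr fi].
have zi (a : R) (u : T -> R) : mu.-integrable D (EFin \o u) ->
    mu.-integrable D (EFin \o (fun x => a * u x)).
  by move=> ui; under [X in _.-integrable _ X]eq_fun do rewrite /= EFinM; exact: integrableZl.
apply: complexP; rewrite cReE /cint /=.
  under eq_Rintegral do rewrite ReM.
  by rewrite RintegralB ?RintegralZl//; exact: zi.
under eq_Rintegral do rewrite ImM.
by rewrite RintegralD ?RintegralZl//; exact: zi.
Qed.

Lemma cintN D f : measurable D -> cintg D f ->
  cint mu D (fun x => - f x) = - cint mu D f.
Proof.
by move=> mD fi; under [X in cint _ _ X]eq_fun do rewrite -mulN1r; rewrite cintZ// mulN1r.
Qed.

Lemma cintB D f g : measurable D -> cintg D f -> cintg D g ->
  cint mu D (fun x => f x - g x) = cint mu D f - cint mu D g.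
Proof. by move=> mD fi gi; rewrite cintD ?cintN//; exact: cintgN. Qed.

Lemma cint0 D : cint mu D (fun=> 0) = 0.
Proof. by rewrite /cint/= /Rintegral integral0. Qed.

Lemma cint_sum D (I : Type) (s : seq I) (F : I -> T -> R[i]) : measurable D ->
  (forall i, cintg D (F i)) ->
  cint mu D (fun x => \sum_(i <- s) F i x) = \sum_(i <- s) cint mu D (F i).
Proof.
move=> mD iF; elim: s => [|i s IHs].
  by under [X in cint _ _ X]eq_fun do rewrite big_nil; rewrite big_nil cint0.
under [X in cint _ _ X]eq_fun do rewrite big_cons; rewrite big_cons cintD ?IHs//.
exact: cintg_sum.
Qed.

Lemma cint_conj D f : measurable D -> cintg D f ->
  cint mu D (fun x => (f x)^*) = (cint mu D f)^*.
Proof.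
move=> mD [fr fi]; apply: complexP; rewrite cReE /cint /=.
  by under eq_Rintegral do rewrite cReE.
under eq_Rintegral do rewrite cReE -mulN1r.
by rewrite RintegralZl// mulN1r.
Qed.

Lemma eq_cint D f g : (forall x, D x -> f x = g x) -> cint mu D f = cint mu D g.
Proof.
by move=> fg; rewrite /cint; congr Complex; apply: eq_Rintegral => x;
  rewrite inE => Dx; rewrite fg.
Qed.

Lemma ae_eq_cint f g : cmeas f -> cmeas g -> {ae mu, forall x, f x = g x} ->
  cint mu setT f = cint mu setT g.
Proof.
move=> [fr fi] [gr gi] fg; rewrite /cint /Rintegral; congr Complex; congr fine;
  apply: ae_eq_integral => //; do ?[exact/measurable_EFinP];
  by apply: filterS fg => x fgx _; rewrite fgx.
Qed.

(** A rotation reduces the bound to real parts: for [z] the integral, |z|^2 is the real part of the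
    integral of conj(z) f, at most |z| times the integral of |f|. *)
Lemma normc_cint D f : measurable D -> cintg D f ->
  Normc.normc (cint mu D f) <= \int[mu]_(x in D) Normc.normc (f x).
Proof.
move=> mD fi; set z := cint mu D f.
have ni := cintg_normc mD fi.
have I0 : 0 <= \int[mu]_(x in D) Normc.normc (f x).
  by apply: Rintegral_ge0 => x _; exact: normc_ge0.
have [z0|z0] := leP (Normc.normc z) 0; first exact: le_trans I0.
rewrite -(ler_pM2l z0) -expr2.
have -> : Normc.normc z ^+ 2 = complex.Re (z^* * z).
  by rewrite sqr_normc2 !cReE mulNr opprK !expr2.
have [zr zi] := cintgZ z^* mD fi.
rewrite /z -cintZ//= -RintegralZl//; apply: le_Rintegral => //.
  by under [X in _.-integrable _ X]eq_fun do rewrite /= EFinM; exact: integrableZl.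
move=> x Dx; apply: le_trans (ler_norm _) _; apply: le_trans (ler_Re_normc _) _.
by rewrite Normc.normcM normc_conjc.
Qed.

Lemma cLfun2P f : cLfun2 mu f <-> cmeas f /\ (cN mu f < +oo)%E.
Proof.
split.
  move=> [/andP[]]; rewrite !inE /= => mr fr /andP[]; rewrite !inE /= => mi fi.
  split => //.
  apply: (@le_lt_trans _ _ (cN mu (fun x => `|complex.Re (f x)|%:C) + cN mu (fun x => `|complex.Im (f x)|%:C))%E).
    apply: le_trans; last first.
      by apply: cND; apply: cmeas_real; exact: measurableT_comp.
    apply: cN_le => //.
      by apply: cmeasD; apply: cmeas_real; exact: measurableT_comp.
    move=> x; rewrite -rmorphD/= normc_real ger0_norm ?addr_ge0//.
    exact: normc_le_ReIm.
  rewrite lte_add_pinfty// cN_ge0_real//.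
    by rewrite (_ : _ \o _ = abse \o (EFin \o (fun x => complex.Re (f x))))// Lnorm_abse.
  by rewrite (_ : _ \o _ = abse \o (EFin \o (fun x => complex.Im (f x))))// Lnorm_abse.
move=> [mf foo]; have [mr mi] := mf.
split; rewrite inE; apply/andP; split; rewrite inE//= /finite_norm -Lnorm_abse.
  apply: le_lt_trans foo; rewrite (_ : Lnorm _ _ _ = cN mu (fun x => `|complex.Re (f x)|%:C)).
    apply: cN_le => //; first by apply: cmeas_real; exact: measurableT_comp.
    by move=> x; rewrite normc_real normr_id ler_Re_normc.
  by rewrite cN_ge0_real.
apply: le_lt_trans foo; rewrite (_ : Lnorm _ _ _ = cN mu (fun x => `|complex.Im (f x)|%:C)).
  apply: cN_le => //; first by apply: cmeas_real; exact: measurableT_comp.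
  by move=> x; rewrite normc_real normr_id ler_Im_normc.
by rewrite cN_ge0_real.
Qed.

Lemma cLfun2D f g : cLfun2 mu f -> cLfun2 mu g -> cLfun2 mu (fun x => f x + g x).
Proof.
move=> /cLfun2P[mf fo] /cLfun2P[mg go]; apply/cLfun2P; split; first exact: cmeasD.
by apply: le_lt_trans (cND _ mf mg) _; rewrite lte_add_pinfty.
Qed.

Lemma cLfun2Z z f : cLfun2 mu f -> cLfun2 mu (fun x => z * f x).
Proof.
move=> /cLfun2P[mf fo]; apply/cLfun2P; split.
  by apply: cmeasM => //; exact: cmeas_cst.
by rewrite cNZ// lte_mul_pinfty// lee_fin normc_ge0.
Qed.

Lemma cLfun2_0 : cLfun2 mu (fun=> 0).
Proof. by apply/cLfun2P; split; [exact: cmeas_cst|rewrite cN0]. Qed.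

Lemma cLfun2N f : cLfun2 mu f -> cLfun2 mu (fun x => - f x).
Proof. by move=> fi; under eq_fun do rewrite -mulN1r; exact: cLfun2Z. Qed.

Lemma cLfun2B f g : cLfun2 mu f -> cLfun2 mu g -> cLfun2 mu (fun x => f x - g x).
Proof. by move=> fi gi; apply: cLfun2D => //; exact: cLfun2N. Qed.

Lemma cLfun2_sum (I : Type) (s : seq I) (F : I -> T -> R[i]) :
  (forall i, cLfun2 mu (F i)) -> cLfun2 mu (fun x => \sum_(i <- s) F i x).
Proof.
move=> iF; elim: s => [|i s IHs].
  by under eq_fun do rewrite big_nil; exact: cLfun2_0.
by under eq_fun do rewrite big_cons; exact: cLfun2D.
Qed.

Lemma cLfun2_conj f : cLfun2 mu f -> cLfun2 mu (fun x => (f x)^*).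
Proof.
move=> /cLfun2P[mf fo]; apply/cLfun2P; split; first exact: cmeas_conj.
by rewrite cN_conj.
Qed.

Lemma cLfun2_real (f : T -> R) : f \in Lfun mu 2%:E -> cLfun2 mu (fun x => (f x)%:C).
Proof.
move=> fL; split => //=; rewrite inE; apply/andP; split; rewrite inE//= /finite_norm.
by rewrite (_ : _ \o _ = cst 0%E)// Lnorm0.
Qed.

Lemma cLfun2_fin f : cLfun2 mu f -> cN mu f \is a fin_num.
Proof. by move=> /cLfun2P[_ fo]; rewrite ge0_fin_numE// cN_ge0. Qed.

Lemma cauchy_schwarz f g : cmeas f -> cmeas g ->
  (\int[mu]_x (Normc.normc (f x * g x))%:E <= cN mu f * cN mu g)%E.
Proof.
move=> mf mg.
have := @hoelder _ _ _ mu (fun x => Normc.normc (f x)) (fun x => Normc.normc (g x))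
  2 2 (cmeas_normc mf) (cmeas_normc mg) (ltr0n _ 2) (ltr0n _ 2).
have h2 : 2^-1 + 2^-1 = 1 :> R by rewrite [RHS]splitr !div1r.
move=> /(_ h2).
rewrite Lnorm1; apply: le_trans; apply: ge0_le_integral => //.
- by move=> x _; rewrite lee_fin normc_ge0.
- by apply/measurable_EFinP; apply: cmeas_normc; exact: cmeasM.
- by do 2 apply/measurableT_comp => //; apply: measurable_funM; exact: cmeas_normc.
- by move=> x _; rewrite Normc.normcM /= lee_fin ler_norm.
Qed.

Lemma cintgM2 f g : cLfun2 mu f -> cLfun2 mu g -> cintg setT (fun x => f x * g x).
Proof.
move=> /cLfun2P[mf fo] /cLfun2P[mg go]; apply: cintg_fin; first exact: cmeasM.
apply: le_lt_trans (cauchy_schwarz mf mg) _.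
by rewrite lte_mul_pinfty// ?cN_ge0// ge0_fin_numE// cN_ge0.
Qed.

Lemma normc_cintM2 f g : cLfun2 mu f -> cLfun2 mu g ->
  ((Normc.normc (cint mu setT (fun x => f x * g x)))%:E <= cN mu f * cN mu g)%E.
Proof.
move=> fL gL; have fg := cintgM2 fL gL.
have := normc_cint measurableT fg; rewrite -lee_fin => /le_trans; apply.
rewrite fineK; last by apply: integrable_fin_num => //; exact: cintg_normc.
by apply: cauchy_schwarz; [have /cLfun2P[] := fL|have /cLfun2P[] := gL].
Qed.

End complex_integral.

(** * Series indexed by the integers *)

Section series.
Context {R : realType}.

Lemma nneseries_splitn (f : nat -> \bar R) n : (forall k, 0 <= f k)%E ->
  (\sum_(0 <= k <oo) f k = \sum_(0 <= k < n) f k + \sum_(n <= k <oo) f k)%E.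
Proof. by move=> f0; rewrite (nneseries_split 0 n) ?add0n. Qed.

Lemma series_tail_small (f : nat -> \bar R) : (forall k, 0 <= f k)%E ->
  (\sum_(0 <= k <oo) f k < +oo)%E ->
  forall e : R, 0 < e -> exists N, forall n, (N <= n)%N ->
    (\sum_(n <= k <oo) f k <= e%:E)%E.
Proof.
move=> f0 foo e e0.
have /fine_cvgP[tfin tcvg] := nneseries_tail_cvg foo (fun k _ => f0 k).
have /cvgrPdist_le/(_ _ e0) := tcvg.
move=> /(filterI tfin)[N _ NP]; exists N => n /NP[/= tn].
rewrite sub0r normrN => /(le_trans (ler_norm _)).
by rewrite -lee_fin fineK.
Qed.

Lemma cvge0P {T : Type} (F : set_system T) {FF : Filter F} (u : T -> \bar R) :
  (forall t, 0 <= u t)%E ->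
  (u x @[x --> F] --> 0%E <-> forall e : R, 0 < e -> \forall x \near F, (u x <= e%:E)%E).
Proof.
move=> u0; split.
  move=> /fine_cvgP[ufin ucvg] e e0; have /cvgrPdist_le/(_ _ e0) := ucvg.
  move=> H; near=> x.
  have xfin : u x \is a fin_num by near: x.
  rewrite -(fineK xfin) lee_fin; apply: (le_trans (ler_norm _)).
  rewrite -normrN -sub0r; near: x; exact: H.
move=> H; apply/fine_cvgP; split.
  apply: filterS (H _ ltr01) => x ux; rewrite ge0_fin_numE//.
  exact: le_lt_trans ux (ltry _).
apply/cvgrPdist_le => e e0; apply: filterS (H _ e0) => x ux /=.
rewrite sub0r normrN ger0_norm ?fine_ge0// -lee_fin fineK//.
by rewrite ge0_fin_numE//; exact: le_lt_trans ux (ltry _).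
Unshelve. all: by end_near. Qed.

Lemma cvge0_seqP (u : nat -> \bar R) : (forall t, 0 <= u t)%E ->
  (u n @[n --> \oo] --> 0%E <->
   forall e : R, 0 < e -> exists N, forall n, (N <= n)%N -> (u n <= e%:E)%E).
Proof.
move=> u0; rewrite cvge0P//; split=> H e /H.
  by move=> [N _ NP]; exists N => n /NP.
by move=> [N NP]; exists N.
Qed.

Lemma cvge0_pairP (u : nat * nat -> \bar R) : (forall t, 0 <= u t)%E ->
  (u mn @[mn --> (\oo, \oo)] --> 0%E <->
   forall e : R, 0 < e -> exists N, forall m n, (N <= m)%N -> (N <= n)%N ->
     (u (m, n) <= e%:E)%E).
Proof.
move=> u0; rewrite cvge0P//; split=> H e /H.
  move=> [[A B] [/= [M _ MA] [N _ NB]] AB]; exists (maxn M N) => m n.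
  rewrite !geq_max => /andP[Mm _] /andP[_ Nn].
  by apply: (AB (m, n)); split; [exact: MA|exact: NB].
move=> [N NP].
exists ([set n | (N <= n)%N], [set n | (N <= n)%N]); first by split; exists N.
by move=> [m n] [/= Nm Nn]; exact: NP.
Qed.

Lemma lee_eps (x y : \bar R) : (forall e : R, 0 < e -> (x <= y + e%:E)%E) -> (x <= y)%E.
Proof. by move=> H; apply/lee_addgt0Pr. Qed.

Lemma lee0_eps (x : \bar R) : (0 <= x)%E -> (forall e : R, 0 < e -> (x <= e%:E)%E) -> x = 0%E.
Proof.
move=> x0 H; apply/eqP; rewrite eq_le x0 andbT.
by apply: lee_eps => e /H; rewrite add0e.
Qed.

(** [Negz n] is -(n+1), so index [n] pairs the times n and -(n+1). Unordered sums thus become series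
    over nat, which have tails. *)
Lemma esum_int (a : int -> \bar R) : (forall t, 0 <= a t)%E ->
  (\esum_(t in [set: int]) a t = \sum_(0 <= n <oo) (a (Posz n) + a (Negz n)))%E.
Proof.
move=> a0; rewrite (esumID (range Posz))//.
rewrite nneseriesD// !nneseries_esumT//; congr (_ + _)%E.
  rewrite setTI; apply: reindex_esum; split => //=.
  by move=> m n _ _ [].
apply: reindex_esum; split => //=; last 2 first.
- by move=> m n _ _ [].
- move=> [n|n] [_ /= nP]; last by exists n.
  by exfalso; apply: nP; exists n.
by move=> n _; split => // -[m _].
Qed.

Lemma zsumE (V : nmodType) (m n : nat) (F : int -> V) :
  zsum m n F = \sum_(j < m) F (Negz j) + \sum_(j < n.+1) F (Posz j).
Proof.
rewrite /zsum -addnS big_split_ord/=; congr (_ + _).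
  (* [zsum] lists the negative times upwards from -m, [Negz] downwards from -1. *)
  rewrite (reindex_inj rev_ord_inj)/=; apply: eq_bigr => j _; congr F.
  have := ltn_ord j; lia.
by apply: eq_bigr => j _; congr F; lia.
Qed.

Lemma eq_zsum (V : nmodType) (m n : nat) (F G : int -> V) :
  F =1 G -> zsum m n F = zsum m n G.
Proof. by move=> FG; apply: eq_bigr. Qed.

End series.

(** * Measurable pointwise sums of complex series *)

Section csum.
Context {d : measure_display} {T : measurableType d} {R : realType}.

(** Upper limits of the real and imaginary partial sums, made finite by [fine], are measurable and
    defined everywhere, and they are the true sums where the moduli are summable. Elsewhere the
    right-hand side is [+oo], so the bound holds at every point. *)
Lemma csum_exists (w : nat -> T -> R[i]) : (forall n, cmeas (w n)) ->
  exists2 S : T -> R[i], cmeas S & forall x n,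
    ((Normc.normc (S x - \sum_(i < n) w i x))%:E <=
     \sum_(n <= i <oo) (Normc.normc (w i x))%:E)%E.
Proof.
move=> mw.
pose L (g : nat -> T -> R) x := fine (limn_esup (fun n => (\sum_(i < n) g i x)%:E)).
have mL g : (forall n, measurable_fun [set: T] (g n)) -> measurable_fun [set: T] (L g).
  move=> mg; apply: measurableT_comp => //.
  apply: (measurable_fun_limn_esup (f := fun n x => (\sum_(i < n) g i x)%:E)) => n.
  by apply/measurable_EFinP; apply: measurable_sum => i.
have cL (g : nat -> T -> R) x :
    (forall n, `|g n x| <= Normc.normc (w n x)) ->
    (\sum_(0 <= i <oo) (Normc.normc (w i x))%:E < +oo)%E ->
    \sum_(i < n) g i x @[n --> \oo] --> L g x.
  move=> gw woo.
  have cg : cvgn (series (g ^~ x)).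
    apply: normed_cvg; apply: nnseries_is_cvg => [i|]; first exact: normr_ge0.
    apply: le_lt_trans woo; apply: lee_nneseries => i _; first by move=> _; rewrite lee_fin normr_ge0.
    by rewrite lee_fin gw.
  rewrite (_ : (fun n => _) = series (g ^~ x)); last first.
    by apply/funext => n; rewrite /series/= big_mkord.
  suff -> : L g x = limn (series (g ^~ x)) by [].
  rewrite /L (_ : (fun n => _) = EFin \o series (g ^~ x)); last first.
    by apply/funext => n; rewrite /series/= big_mkord.
  rewrite is_cvg_limn_esupE.
    by rewrite EFin_lim.
  by apply/cvg_ex; exists (limn (series (g ^~ x)))%:E; apply: cvg_EFin => //; exact: nearW.
pose S x := L (fun n x => complex.Re (w n x)) x +i* L (fun n x => complex.Im (w n x)) x.
exists S.
  by split; apply: mL => n; have [] := mw n.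
move=> x n.
have w0 i : (0 <= (Normc.normc (w i x))%:E)%E by rewrite lee_fin normc_ge0.
(* A finite head cannot account for an infinite total: every tail is then infinite. *)
have [woo|woo] := ltP (\sum_(0 <= i <oo) (Normc.normc (w i x))%:E)%E +oo%E; last first.
  move: woo; rewrite leye_eq (nneseries_splitn n)// sumEFin => /eqP.
  by case: (\sum_(n <= i <oo) _)%E => [r||]// _; rewrite leey.
have /cvgrPdist_le cr := cL (fun n x => complex.Re (w n x)) x (fun n => ler_Re_normc (w n x)) woo.
have /cvgrPdist_le ci := cL (fun n x => complex.Im (w n x)) x (fun n => ler_Im_normc (w n x)) woo.
apply: lee_eps => e e0.
have e20 : 0 < e / 2 by rewrite divr_gt0.
have [M _ MP] := filterI (cr _ e20) (ci _ e20).
pose N := maxn M n.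
have [HR HI] := MP N (leq_maxl _ _).
have nN : (n <= N)%N by exact: leq_maxr.
(* The sum up to [N] is within e of [S x]; the terms from n to N belong to the tail. *)
rewrite (_ : S x - _ = (S x - \sum_(i < N) w i x) + \sum_(n <= i < N) w i x); last first.
  rewrite -!(big_mkord xpredT (fun i => w i x)).
  by rewrite (@big_cat_nat _ _ _ n 0 N)//= opprD addrA subrK.
apply: (@le_trans _ _ ((e / 2 + e / 2)%:E + \sum_(n <= i < N) (Normc.normc (w i x))%:E)%E).
  rewrite sumEFin -EFinD lee_fin; apply: le_trans (le_normcD _ _) _.
  rewrite lerD ?normc_sum//; apply: le_trans (normc_le_ReIm _) _.
  by rewrite !cReE Re_sum Im_sum; exact: lerD.
rewrite addeC -splitr leeD2r//.
exact: nneseries_lim_ge.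
Qed.

End csum.

(** * Kernel norms *)

Section kernel_norms.
Context {R : realType}.
Local Notation C := R[i].
Local Notation TR := (measurableTypeR R : measurableType _).
Local Notation mu := (leb01 R : {measure set TR -> \bar R}).
Implicit Types k l : R -> R -> C.

Definition kmeas k := cmeas (fun x : measurableTypeR R * measurableTypeR R => k x.1 x.2).

Lemma kmeasD k l : kmeas k -> kmeas l -> kmeas (fun s t => k s t + l s t).
Proof. exact: cmeasD. Qed.

Lemma kmeasB k l : kmeas k -> kmeas l -> kmeas (fun s t => k s t - l s t).
Proof. exact: cmeasB. Qed.

Lemma kmeas_sum (I : Type) (s : seq I) (F : I -> R -> R -> C) :
  (forall i, kmeas (F i)) -> kmeas (fun a b => \sum_(i <- s) F i a b).
Proof. by move=> mF; apply: (@cmeas_sum _ _ _ _ s (fun i x => F i x.1 x.2)). Qed.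

Lemma knorm2E k : knorm 2%:E k = cN (leb01sq R) (fun x => k x.1 x.2).
Proof. by []. Qed.

Lemma knormyE k : knorm +oo%E k = ereal_sup
  [set (Normc.normc (k x.1 x.2))%:E | x in `[0%R, 1%R] `*` `[0%R, 1%R]].
Proof. by rewrite /knorm eqxx. Qed.

Lemma knormy_ge k s t : 0 <= s <= 1 -> 0 <= t <= 1 ->
  ((Normc.normc (k s t))%:E <= knorm +oo k)%E.
Proof.
move=> hs ht; rewrite knormyE; apply: ereal_sup_ubound; exists (s, t) => //=.
Qed.

Lemma knormy_le k (M : \bar R) :
  (forall s t, 0 <= s <= 1 -> 0 <= t <= 1 -> ((Normc.normc (k s t))%:E <= M)%E) ->
  (knorm +oo k <= M)%E.
Proof.
move=> H; rewrite knormyE; apply: ge_ereal_sup => _ [[s t] [/= hs ht] <-].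
by move: hs ht; rewrite !in_itv/=; exact: H.
Qed.

Lemma knorm_ge0 (p : \bar R) k : (0 <= knorm p k)%E.
Proof.
rewrite /knorm; case: ifPn => _; last exact: Lnorm_ge0.
apply: (@le_trans _ _ (Normc.normc (k 0 0))%:E); first by rewrite lee_fin normc_ge0.
by apply: ereal_sup_ubound; exists (0, 0) => //; split; rewrite /= in_itv/= lexx ler01.
Qed.

Section exponent.
Variables (p : \bar R) (Hp : p = 2%:E \/ p = +oo%E).

(** Countable triangle inequality for both exponents. The hypothesis is imposed pointwise, in the
    form that the true supremum requires. *)
Lemma knorm_series k (b : nat -> R -> R -> C) N : kmeas k -> (forall n, kmeas (b n)) ->
  (forall s t, ((Normc.normc (k s t))%:E <=
     \sum_(N <= n <oo) (Normc.normc (b n s t))%:E)%E) ->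
  (knorm p k <= \sum_(N <= n <oo) knorm p (b n))%E.
Proof.
move=> mk mb kb; case: Hp => ->; first by apply: cN_series => // x; exact: kb.
apply: knormy_le => s t hs ht; apply: le_trans (kb s t) _.
apply: lee_nneseries => n _; last exact: knormy_ge.
by move=> _; rewrite lee_fin normc_ge0.
Qed.

Lemma knorm_le k l : kmeas k -> kmeas l ->
  (forall s t, Normc.normc (k s t) <= Normc.normc (l s t)) -> (knorm p k <= knorm p l)%E.
Proof.
move=> mk ml kl; case: Hp => ->; first by apply: cN_le => // x; exact: kl.
apply: knormy_le => s t hs ht; apply: le_trans (knormy_ge _ hs ht).
by rewrite lee_fin.
Qed.

Lemma knormD k l : kmeas k -> kmeas l ->
  (knorm p (fun s t => k s t + l s t)%R <= knorm p k + knorm p l)%E.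
Proof.
move=> mk ml; case: Hp => ->; first exact: cND.
apply: knormy_le => s t hs ht.
apply: (@le_trans _ _ ((Normc.normc (k s t))%:E + (Normc.normc (l s t))%:E)%E).
  by rewrite -EFinD lee_fin le_normcD.
by apply: leeD; exact: knormy_ge.
Qed.

Lemma knormZ z k : kmeas k ->
  (knorm p (fun s t => z * k s t)%R <= (Normc.normc z)%:E * knorm p k)%E.
Proof.
move=> mk; case: Hp => ->; first by rewrite !knorm2E cNZ.
apply: knormy_le => s t hs ht; rewrite Normc.normcM EFinM.
by apply: lee_wpmul2l; [rewrite lee_fin normc_ge0|exact: knormy_ge].
Qed.

Lemma knormN k : knorm p (fun s t => - k s t) = knorm p k.
Proof.
rewrite /knorm; case: ifPn => _.
  by under eq_imagel do rewrite normcN.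
by congr Lnorm; apply/funext => x; rewrite /comp normcN.
Qed.

Lemma knormBC k l : knorm p (fun s t => k s t - l s t) = knorm p (fun s t => l s t - k s t).
Proof.
by rewrite -knormN; congr knorm; apply/funext => s; apply/funext => t; rewrite opprB.
Qed.

Lemma knorm0 : knorm p (fun _ _ => 0 : C) = 0%E.
Proof.
case: Hp => ->; first exact: cN0.
apply/eqP; rewrite eq_le knorm_ge0 andbT; apply: knormy_le => s t _ _.
by rewrite Normc.normc0.
Qed.

Lemma knorm_sum (I : Type) (s : seq I) (F : I -> R -> R -> C) :
  (forall i, kmeas (F i)) ->
  (knorm p (fun a b => \sum_(i <- s) F i a b)%R <= \sum_(i <- s) knorm p (F i))%E.
Proof.
move=> mF; elim: s => [|i s IHs].
  rewrite big_nil (_ : (fun _ => _) = (fun _ _ => 0 : C)) ?knorm0//.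
  by apply/funext => a; apply/funext => b; rewrite big_nil.
rewrite big_cons (_ : (fun _ => _) = (fun a b => F i a b + \sum_(j <- s) F j a b)); last first.
  by apply/funext => a; apply/funext => b; rewrite big_cons.
by apply: le_trans (knormD _ _) _ => //; [exact: kmeas_sum|exact: leeD2l].
Qed.

Lemma knorm_dist3 l k m : kmeas k -> kmeas l -> kmeas m ->
  (knorm p (fun s t => k s t - m s t)%R <=
   knorm p (fun s t => k s t - l s t)%R + knorm p (fun s t => l s t - m s t)%R)%E.
Proof.
move=> mk ml mm; rewrite (_ : (fun _ => _) = (fun s t => (k s t - l s t) + (l s t - m s t))).
  by apply: knormD; exact: kmeasB.
by apply/funext => s; apply/funext => t; rewrite addrA subrK.
Qed.

End exponent.

Lemma leb01_setT : mu setT = 1%E.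
Proof.
rewrite /leb01 /= /mfrestr /= /mrestr setTI lebesgue_measure_itv /= lte_fin ltr01.
by rewrite oppr0 adde0.
Qed.

Lemma leb01_out : mu (~` `[0%R, 1%R]) = 0%E.
Proof. by rewrite /leb01 /= /mfrestr /= /mrestr setICl measure0. Qed.

Lemma leb01sqX (A B : set (measurableTypeR R)) : measurable A -> measurable B ->
  leb01sq R (A `*` B) = (mu A * mu B)%E.
Proof. by move=> mA mB; exact: product_measure1E. Qed.

Lemma leb01sq_setT : leb01sq R setT = 1%E.
Proof. by rewrite -setXTT leb01sqX// leb01_setT mule1. Qed.

(** The complement of the square is covered by two strips over the complement of [0, 1], each of
    product measure 0. *)
Lemma leb01sq_ae (Q : R * R -> Prop) :
  (forall s t, 0 <= s <= 1 -> 0 <= t <= 1 -> Q (s, t)) -> {ae leb01sq R, forall x, Q x}.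
Proof.
move=> HQ; exists ((~` `[0%R, 1%R]) `*` setT `|` setT `*` (~` `[0%R, 1%R])).
have m0 : measurable (~` `[0%R, 1%R] : set (measurableTypeR R)) by exact: measurableC.
split.
- by apply: measurableU; exact: measurableX.
- apply/eqP; rewrite eq_le measure_ge0 andbT.
  apply: (@le_trans _ _ (leb01sq R ((~` `[0%R, 1%R]) `*` setT) +
      leb01sq R (setT `*` (~` `[0%R, 1%R])))%E).
    by apply: measureU2; exact: measurableX.
  by rewrite !leb01sqX// leb01_out mule0 mul0e adde0.
- move=> [s t] nQ; apply: contrapT => /=.
  move=> /not_orP[/not_andP[|]]; last by [].
  move=> /contrapT; rewrite in_itv/= => hs /not_andP[//|/contrapT].
  by rewrite /= in_itv/= => ht; apply: nQ; exact: HQ.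
Qed.

(** The square has mass 1, so a constant M has norm M. Hence I(oo) implies I(2), and the L^2 results
    hold under both conditions. *)
Lemma knorm_le2y k : kmeas k -> (knorm 2%:E k <= knorm +oo k)%E.
Proof.
move=> mk; have := knorm_ge0 +oo k.
case kM : (knorm +oo k) => [M| |]; rewrite ?leey//.
rewrite lee_fin => M0; rewrite knorm2E.
apply: (@le_trans _ _ (cN (leb01sq R) (fun=> M%:C))).
  apply: cN_le_ae; [exact: mk|exact: cmeas_cst|].
  apply: leb01sq_ae => s t hs ht /=; rewrite normc_real ger0_norm//.
  by rewrite -lee_fin -kM knormy_ge.
rewrite cN_ge0_real// unlock /= integral_cst// leb01sq_setT mule1 poweR_EFin.
by rewrite -powRrM divff// powRr1// ger0_norm.
Qed.

End kernel_norms.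

(** * Product measures and integral operators *)

Lemma cmeas_comp {d1 d2 : measure_display} {T1 : measurableType d1}
    {T2 : measurableType d2} {R : realType} (f : T2 -> R[i]) (phi : T1 -> T2) :
  measurable_fun setT phi -> cmeas f -> cmeas (fun x => f (phi x)).
Proof.
by move=> mphi [mr mi]; split; [exact: (measurableT_comp mr)|exact: (measurableT_comp mi)].
Qed.

(** * Fubini's theorem for real and complex integrals *)

Section fubini_real_complex.
Context {d1 d2 : measure_display} {T1 : measurableType d1} {T2 : measurableType d2}
  {R : realType}.
Variables (m1 : {sigma_finite_measure set T1 -> \bar R})
  (m2 : {sigma_finite_measure set T2 -> \bar R}).

(** Tonelli gives measurability for each of the positive and negative parts; the difference of their
    integrals is measurable whether or not [f] is integrable. *)
Lemma measurable_integral_snd (f : T1 * T2 -> \bar R) : measurable_fun setT f ->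
  measurable_fun setT (fun x => \int[m2]_y f (x, y))%E.
Proof.
move=> mf.
rewrite (_ : (fun x => _) = ((fun x => \int[m2]_y f^\+ (x, y)) \-
    (fun x => \int[m2]_y f^\- (x, y)))%E); last first.
  apply/funext => x; rewrite [LHS]integralE /=.
  under eq_integral do rewrite funepos_comp/=.
  by under [X in (_ - X = _)%E]eq_integral do rewrite funeneg_comp/=.
apply: emeasurable_funB.
  by apply: measurable_fun_fubini_tonelli_F => //; exact: measurable_funepos.
by apply: measurable_fun_fubini_tonelli_F => //; exact: measurable_funeneg.
Qed.

Lemma measurable_integral_fst (f : T1 * T2 -> \bar R) : measurable_fun setT f ->
  measurable_fun setT (fun y => \int[m1]_x f (x, y))%E.
Proof.
move=> mf.
rewrite (_ : (fun y => _) = ((fun y => \int[m1]_x f^\+ (x, y)) \-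
    (fun y => \int[m1]_x f^\- (x, y)))%E); last first.
  apply/funext => y; rewrite [LHS]integralE /=.
  under eq_integral do rewrite funepos_comp/=.
  by under [X in (_ - X = _)%E]eq_integral do rewrite funeneg_comp/=.
apply: emeasurable_funB.
  by apply: measurable_fun_fubini_tonelli_G => //; exact: measurable_funepos.
by apply: measurable_fun_fubini_tonelli_G => //; exact: measurable_funeneg.
Qed.

Lemma measurable_Rintegral_snd (f : T1 * T2 -> R) : measurable_fun setT f ->
  measurable_fun setT (fun x => \int[m2]_y f (x, y)).
Proof.
move=> mf; apply: measurableT_comp => //.
by apply: (measurable_integral_snd (f := EFin \o f)); exact/measurable_EFinP.
Qed.

Lemma measurable_Rintegral_fst (f : T1 * T2 -> R) : measurable_fun setT f ->
  measurable_fun setT (fun y => \int[m1]_x f (x, y)).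
Proof.
move=> mf; apply: measurableT_comp => //.
by apply: (measurable_integral_fst (f := EFin \o f)); exact/measurable_EFinP.
Qed.

(** Fubini concerns extended integrals, and the real inner integral is [fine] of the extended one;
    the two agree for almost every [x], namely where the section is integrable. *)
Lemma Rintegral_snd (f : T1 * T2 -> R) : (m1 \x m2)%E.-integrable setT (EFin \o f) ->
  m1.-integrable setT (EFin \o (fun x => \int[m2]_y f (x, y))) /\
  \int[(m1 \x m2)%E]_z f z = \int[m1]_x \int[m2]_y f (x, y).
Proof.
move=> fi; have mf := measurable_int _ fi.
have Fi := integrable_fubini_F fi.
have E : ae_eq m1 setT (fubini_F m2 (EFin \o f))
    (EFin \o (fun x => \int[m2]_y f (x, y))).
  apply: filterS (ae_integrable1 fi) => x ix _.
  by rewrite /= /Rintegral fineK//; exact: integrable_fin_num.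
have mF : measurable_fun setT (EFin \o (fun x => \int[m2]_y f (x, y))).
  by apply/measurable_EFinP/measurable_Rintegral_snd; exact/measurable_EFinP.
split.
  apply/integrableP; split => //.
  have /integrableP[mFF] := Fi; apply: le_lt_trans; apply: ae_ge0_le_integral => //.
  - exact: measurableT_comp.
  - exact: measurableT_comp.
  - by apply: filterS E => x /(_ I) -> _.
rewrite {1}/Rintegral -integral12_prod_meas1// [RHS]/Rintegral.
by congr fine; apply: ae_eq_integral => //; exact: measurable_int Fi.
Qed.

Lemma Rintegral_fst (f : T1 * T2 -> R) : (m1 \x m2)%E.-integrable setT (EFin \o f) ->
  \int[(m1 \x m2)%E]_z f z = \int[m2]_y \int[m1]_x f (x, y).
Proof.
move=> fi; have mf := measurable_int _ fi.
have E : ae_eq m2 setT (fubini_G m1 (EFin \o f))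
    (EFin \o (fun y => \int[m1]_x f (x, y))).
  apply: filterS (ae_integrable2 fi) => y iy _.
  by rewrite /= /Rintegral fineK//; exact: integrable_fin_num.
have mF : measurable_fun setT (EFin \o (fun y => \int[m1]_x f (x, y))).
  by apply/measurable_EFinP/measurable_Rintegral_fst; exact/measurable_EFinP.
rewrite {1}/Rintegral -integral21_prod_meas1// [RHS]/Rintegral.
by congr fine; apply: ae_eq_integral => //; exact: measurable_integral_fst.
Qed.

Lemma cmeas_cint_snd (f : T1 * T2 -> R[i]) : cmeas f ->
  cmeas (fun x => cint m2 setT (fun y => f (x, y))).
Proof.
by move=> [mr mi]; split;
  [exact: (measurable_Rintegral_snd mr)|exact: (measurable_Rintegral_snd mi)].
Qed.

Lemma cint_snd (f : T1 * T2 -> R[i]) : cintg (m1 \x m2)%E setT f ->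
  cint (m1 \x m2)%E setT f = cint m1 setT (fun x => cint m2 setT (fun y => f (x, y))).
Proof.
move=> [fr fi]; rewrite /cint /=.
by rewrite (Rintegral_snd fr).2 (Rintegral_snd fi).2.
Qed.

Lemma cintg_section_snd (f : T1 * T2 -> R[i]) : cintg (m1 \x m2)%E setT f ->
  {ae m1, forall x, cintg m2 setT (fun y => f (x, y))}.
Proof.
move=> [fr fi]; apply: filterS2 (ae_integrable1 fr) (ae_integrable1 fi).
by move=> x ix iy; split.
Qed.

Lemma cmeas_cint_fst (f : T1 * T2 -> R[i]) : cmeas f ->
  cmeas (fun y => cint m1 setT (fun x => f (x, y))).
Proof.
by move=> [mr mi]; split;
  [exact: (measurable_Rintegral_fst mr)|exact: (measurable_Rintegral_fst mi)].
Qed.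

Lemma cint_fst (f : T1 * T2 -> R[i]) : cintg (m1 \x m2)%E setT f ->
  cint (m1 \x m2)%E setT f = cint m2 setT (fun y => cint m1 setT (fun x => f (x, y))).
Proof.
move=> [fr fi]; rewrite /cint /=.
by rewrite (Rintegral_fst fr) (Rintegral_fst fi).
Qed.

Lemma cintg_section_fst (f : T1 * T2 -> R[i]) : cintg (m1 \x m2)%E setT f ->
  {ae m2, forall y, cintg m1 setT (fun x => f (x, y))}.
Proof.
move=> [fr fi]; apply: filterS2 (ae_integrable2 fr) (ae_integrable2 fi).
by move=> x ix iy; split.
Qed.

Lemma cmeas_pair_snd (f : T1 * T2 -> R[i]) x : cmeas f -> cmeas (fun y => f (x, y)).
Proof. by apply: cmeas_comp; exact: pair1_measurable. Qed.

Lemma cN_tensor (u : T1 -> R[i]) (v : T2 -> R[i]) : cmeas u -> cmeas v ->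
  cN (m1 \x m2)%E (fun x => u x.1 * v x.2) = (cN m1 u * cN m2 v)%E.
Proof.
move=> mu mv.
have mu2 := measurable_funX 2 (cmeas_normc mu).
have mv2 := measurable_funX 2 (cmeas_normc mv).
rewrite !cN_sqrt -poweRM ?integral_normc2_ge0//; congr poweR.
rewrite fubini_tonelli1//; last 2 first.
- apply/measurable_EFinP; apply: measurable_funX; apply: cmeas_normc.
  by apply: cmeasM; [exact: cmeas_comp measurable_fst mu|exact: cmeas_comp measurable_snd mv].
- by move=> x; rewrite lee_fin sqr_ge0.
rewrite /fubini_F/=.
under eq_integral => x _.
  under eq_integral do rewrite Normc.normcM exprMn EFinM.
  rewrite ge0_integralZl_EFin ?sqr_ge0//; last 2 first.
  - by move=> y _; rewrite lee_fin sqr_ge0.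
  - exact/measurable_EFinP.
  over.
rewrite ge0_integralZr// ?integral_normc2_ge0//; first exact/measurable_EFinP.
by move=> x _; rewrite lee_fin sqr_ge0.
Qed.

End fubini_real_complex.

Section finite_product.
Context {d1 d2 : measure_display} {T1 : measurableType d1} {T2 : measurableType d2}
  {R : realType}.
Variables (m1 : {finite_measure set T1 -> \bar R})
  (m2 : {finite_measure set T2 -> \bar R}).

Lemma cLfun2_cst1 : cLfun2 m1 (fun=> 1).
Proof.
apply/cLfun2P; split; first exact: cmeas_cst.
rewrite /cN (_ : _ \o _ = cst 1%E); last by apply/funext => x; rewrite /= Normc.normc1.
rewrite Lnorm_cst1; apply: poweR_lty; rewrite -ge0_fin_numE//.
exact: fin_num_measure.
Qed.

Lemma cLfun2_tensor (u : T1 -> R[i]) (v : T2 -> R[i]) : cLfun2 m1 u -> cLfun2 m2 v ->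
  cLfun2 (m1 \x m2)%E (fun x => u x.1 * v x.2).
Proof.
move=> uL vL; have /cLfun2P[mu uoo] := uL; have /cLfun2P[mv voo] := vL.
apply/cLfun2P; split.
  by apply: cmeasM; [exact: cmeas_comp measurable_fst mu|exact: cmeas_comp measurable_snd mv].
by rewrite cN_tensor// lte_mul_pinfty// ?cN_ge0// cLfun2_fin.
Qed.

(** As [m1] is finite, h(y) is square integrable as a function of (x, y); its product with [f] is
    integrable by Cauchy-Schwarz, and Fubini gives the sections. *)
Lemma cintg_section_mul (f : T1 * T2 -> R[i]) (h : T2 -> R[i]) :
  cLfun2 (m1 \x m2)%E f -> cLfun2 m2 h ->
  {ae m1, forall x, cintg m2 setT (fun y => f (x, y) * h y)}.
Proof.
move=> fL hL.
have tL := cLfun2_tensor cLfun2_cst1 hL.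
have := cintgM2 fL tL => /=; under eq_fun do rewrite mul1r.
exact: cintg_section_snd.
Qed.

Lemma cmeas_cint_mul (f : T1 * T2 -> R[i]) (h : T2 -> R[i]) : cmeas f -> cmeas h ->
  cmeas (fun x => cint m2 setT (fun y => f (x, y) * h y)).
Proof.
move=> mf mh; apply: (cmeas_cint_snd m2 (f := fun x => f x * h x.2)).
by apply: cmeasM => //; exact: cmeas_comp measurable_snd mh.
Qed.

(** Hilbert-Schmidt bound: Cauchy-Schwarz on almost every section, then Tonelli for the squared
    norms. *)
Lemma cN_cint_mul (f : T1 * T2 -> R[i]) (h : T2 -> R[i]) :
  cLfun2 (m1 \x m2)%E f -> cLfun2 m2 h ->
  (cN m1 (fun x => cint m2 setT (fun y => f (x, y) * h y)%R) <= cN (m1 \x m2) f * cN m2 h)%E.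
Proof.
move=> fL hL.
have [mh hoo] := (cLfun2P _ _).1 hL; have [mf foo] := (cLfun2P _ _).1 fL.
have mn2 : measurable_fun setT (fun x => (Normc.normc (f x) ^+ 2)%:E).
  by apply/measurable_EFinP; apply: measurable_funX; exact: cmeas_normc.
have mI := measurable_integral_snd m2 mn2.
apply: mule_self_le; [exact: cN_ge0|by rewrite mule_ge0 ?cN_ge0|].
rewrite muleACA !cN_sqr fubini_tonelli1//; last by move=> x; rewrite lee_fin sqr_ge0.
rewrite /fubini_F -ge0_integralZr ?integral_normc2_ge0//; last first.
  by move=> x _; exact: integral_normc2_ge0.
apply: ae_ge0_le_integral => //.
- by move=> x _; rewrite lee_fin sqr_ge0.
- apply/measurable_EFinP; apply: measurable_funX; apply: cmeas_normc.
  exact: cmeas_cint_mul.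
- by move=> x _; rewrite mule_ge0// integral_normc2_ge0.
- exact: emeasurable_funM.
apply: (aeS (cintg_section_mul fL hL)) => x xi _.
have mfx := cmeas_pair_snd x mf.
have : ((Normc.normc (cint m2 setT (fun y => f (x, y) * h y)%R))%:E <=
    cN m2 (fun y => f (x, y)) * cN m2 h)%E.
  have := normc_cint measurableT xi; rewrite -lee_fin => /le_trans; apply.
  rewrite fineK; last by apply: integrable_fin_num => //; exact: cintg_normc.
  exact: cauchy_schwarz.
move=> H; rewrite -!cN_sqr -muleACA expr2 EFinM.
by apply: lee_pmul => //; rewrite lee_fin normc_ge0.
Qed.

Lemma cLfun2_cint_mul (f : T1 * T2 -> R[i]) (h : T2 -> R[i]) :
  cLfun2 (m1 \x m2)%E f -> cLfun2 m2 h ->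
  cLfun2 m1 (fun x => cint m2 setT (fun y => f (x, y) * h y)).
Proof.
move=> fL hL; have [mh hoo] := (cLfun2P _ _).1 hL; have [mf foo] := (cLfun2P _ _).1 fL.
apply/cLfun2P; split; first exact: cmeas_cint_mul.
apply: le_lt_trans (cN_cint_mul fL hL) _.
by rewrite lte_mul_pinfty ?cN_ge0// (cLfun2_fin fL).
Qed.

(* A name for the product measure, to which finiteness instances can be attached. *)
Definition finprod : set (T1 * T2) -> \bar R := (m1 \x m2)%E.

HB.instance Definition _ := Measure.on finprod.

Let finprod_fin : fin_num_fun finprod.
Proof.
move=> A mA; rewrite ge0_fin_numE ?measure_ge0//.
apply: (@le_lt_trans _ _ ((m1 \x m2)%E setT)); first by apply: le_measure; rewrite ?inE.
rewrite -setXTT product_measure1E//.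
by rewrite lte_mul_pinfty// ?fin_num_measure// -ge0_fin_numE// fin_num_measure.
Qed.

HB.instance Definition _ := Measure_isFinite.Build _ _ _ finprod finprod_fin.

Lemma ge0_integral_tensor (a : T1 -> \bar R) (b : T2 -> \bar R) :
  measurable_fun setT a -> measurable_fun setT b ->
  (forall x, 0 <= a x)%E -> (forall y, 0 <= b y)%E ->
  (\int[m1 \x m2]_x (a x.1 * b x.2) = \int[m1]_x a x * \int[m2]_y b y)%E.
Proof.
move=> ma mb a0 b0.
rewrite fubini_tonelli1//; last 2 first.
- by apply: emeasurable_funM; [exact: measurableT_comp|exact: measurableT_comp].
- by move=> x; rewrite mule_ge0.
rewrite /fubini_F/=; under eq_integral do rewrite ge0_integralZl//.
by rewrite ge0_integralZr// integral_ge0.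
Qed.

Lemma cintg_tensor (a : T1 -> R[i]) (b : T2 -> R[i]) :
  cintg m1 setT a -> cintg m2 setT b -> cintg (m1 \x m2)%E setT (fun x => a x.1 * b x.2).
Proof.
move=> ai bi; have ma := cintg_cmeas ai; have mb := cintg_cmeas bi.
apply: cintg_fin.
  by apply: cmeasM; [exact: cmeas_comp measurable_fst ma|exact: cmeas_comp measurable_snd mb].
under eq_integral do rewrite Normc.normcM EFinM.
rewrite (@ge0_integral_tensor (fun x => (Normc.normc (a x))%:E)
  (fun x => (Normc.normc (b x))%:E)).
- have ni1 := cintg_normc measurableT ai; have ni2 := cintg_normc measurableT bi.
  have f1 := integrable_fin_num measurableT ni1; have f2 := integrable_fin_num measurableT ni2.
  by rewrite -(fineK f1) -(fineK f2) ltry.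
- by apply/measurable_EFinP; exact: cmeas_normc.
- by apply/measurable_EFinP; exact: cmeas_normc.
- by move=> x; rewrite lee_fin normc_ge0.
- by move=> x; rewrite lee_fin normc_ge0.
Qed.

Lemma cint_tensor (a : T1 -> R[i]) (b : T2 -> R[i]) :
  cintg m1 setT a -> cintg m2 setT b ->
  cint (m1 \x m2)%E setT (fun x => a x.1 * b x.2) = cint m1 setT a * cint m2 setT b.
Proof.
move=> ai bi; rewrite cint_snd; last exact: cintg_tensor.
transitivity (cint m1 setT (fun x => cint m2 setT b * a x)).
  by apply: eq_cint => x _; rewrite /= (cintZ _ measurableT bi) mulrC.
by rewrite cintZ// mulrC.
Qed.

End finite_product.

(** * Fubini for the expectation of a product of two integrals *)

Section covariance_fubini.
Context {d0 d1 : measure_display} {T0 : measurableType d0} {T : measurableType d1}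
  {R : realType}.
Variables (m0 : {finite_measure set T0 -> \bar R})
  (m : {finite_measure set T -> \bar R}).
Variables (f1 f2 : T0 * T -> R[i]).
Hypotheses (f1L : cLfun2 (m0 \x m)%E f1) (f2L : cLfun2 (m0 \x m)%E f2).

Let G (u v : T -> R[i]) (z : T0 * (T * T)) : R[i] :=
  f1 (z.1, z.2.1) * u z.2.1 * (f2 (z.1, z.2.2) * v z.2.2).

Let cLfun2_normc d (S : measurableType d) (mu : {measure set S -> \bar R}) (f : S -> R[i]) :
  cLfun2 mu f -> cLfun2 mu (fun x => (Normc.normc (f x))%:C).
Proof.
move=> /cLfun2P[mf fo]; apply/cLfun2P; split; first exact/cmeas_real/cmeas_normc.
by rewrite cN_ge0_real// => x; exact: normc_ge0.
Qed.

(** With w fixed, the modulus of [G] integrates over the square to a product of two functions of w,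
    each in L^2 by the Hilbert-Schmidt bound applied to the moduli; Cauchy-Schwarz in w then gives a
    finite integral. *)
Lemma cintg_cov_product u v : cLfun2 m u -> cLfun2 m v ->
  cintg (m0 \x finprod m m)%E setT (G u v).
Proof.
move=> uL vL.
have [mu_ _] := (cLfun2P _ _).1 uL; have [mv _] := (cLfun2P _ _).1 vL.
have [mf1 _] := (cLfun2P _ _).1 f1L; have [mf2 _] := (cLfun2P _ _).1 f2L.
pose p1 (z : T0 * (T * T)) := (z.1, z.2.1).
pose p2 (z : T0 * (T * T)) := (z.1, z.2.2).
have mp1 : measurable_fun setT p1.
  by apply/measurable_fun_pair => //; exact: measurableT_comp.
have mp2 : measurable_fun setT p2.
  by apply/measurable_fun_pair => //; exact: measurableT_comp.
have mG1 (f : T0 * T -> R[i]) (w : T -> R[i]) : cmeas f -> cmeas w ->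
    cmeas (fun x => f x * w x.2).
  by move=> mf mw; apply: cmeasM => //; exact: cmeas_comp measurable_snd mw.
have mG : cmeas (G u v).
  by apply: cmeasM; [exact: cmeas_comp mp1 (mG1 _ _ mf1 mu_)|exact: cmeas_comp mp2 (mG1 _ _ mf2 mv)].
apply: cintg_fin => //.
rewrite fubini_tonelli1//; last 2 first.
- by apply/measurable_EFinP; exact: cmeas_normc.
- by move=> z; rewrite lee_fin normc_ge0.
have n1 := cLfun2_cint_mul (cLfun2_normc f1L) (cLfun2_normc uL).
have n2 := cLfun2_cint_mul (cLfun2_normc f2L) (cLfun2_normc vL).
have s1 := cintg_section_mul (cLfun2_normc f1L) (cLfun2_normc uL).
have s2 := cintg_section_mul (cLfun2_normc f2L) (cLfun2_normc vL).
have [mn1 _] := (cLfun2P _ _).1 n1; have [mn2 _] := (cLfun2P _ _).1 n2.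
have cs := cauchy_schwarz m0 mn1 mn2.
apply: le_lt_trans (le_lt_trans cs _); last first.
  by rewrite lte_mul_pinfty ?cN_ge0// ?(cLfun2_fin n1)//; have [] := (cLfun2P _ _).1 n2.
apply: ae_ge0_le_integral => //.
- by move=> w _; apply: integral_ge0 => x _; rewrite lee_fin normc_ge0.
- apply: (measurable_integral_snd (finprod m m) (f := fun z => (Normc.normc (G u v z))%:E)).
  by apply/measurable_EFinP; exact: cmeas_normc.
- by move=> w _; rewrite lee_fin normc_ge0.
- by apply/measurable_EFinP; apply: cmeas_normc; exact: cmeasM.
apply: (aeS2 s1 s2) => w w1 w2 _; rewrite /fubini_F /=.
have mfw1 : cmeas (fun s => f1 (w, s) * u s) by exact: (cmeas_pair_snd w (mG1 _ _ mf1 mu_)).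
have mfw2 : cmeas (fun s => f2 (w, s) * v s) by exact: (cmeas_pair_snd w (mG1 _ _ mf2 mv)).
under eq_integral do rewrite Normc.normcM EFinM.
rewrite (@ge0_integral_tensor _ _ _ _ _ m m (fun s => (Normc.normc (f1 (w, s) * u s))%:E)
  (fun s => (Normc.normc (f2 (w, s) * v s))%:E)); last 4 first.
- by apply/measurable_EFinP; exact: cmeas_normc.
- by apply/measurable_EFinP; exact: cmeas_normc.
- by move=> s; rewrite lee_fin normc_ge0.
- by move=> s; rewrite lee_fin normc_ge0.
(* Rewriting the integral of the modulus as the modulus of a [cint] of moduli puts it in the form
   bounded by [cs]. *)
have H (f : T0 * T -> R[i]) (h : T -> R[i]) :
    cintg m setT (fun y => (Normc.normc (f (w, y)))%:C * (Normc.normc (h y))%:C) ->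
    (\int[m]_s (Normc.normc (f (w, s) * h s))%:E = (Normc.normc (cint m setT
      (fun y => (Normc.normc (f (w, y)))%:C * (Normc.normc (h y))%:C)))%:E)%E.
  move=> fhi.
  have E : cint m setT (fun y => (Normc.normc (f (w, y)))%:C * (Normc.normc (h y))%:C) =
      (\int[m]_s Normc.normc (f (w, s) * h s))%:C.
    apply: complexP => /=.
      by apply: eq_Rintegral => s _; rewrite Normc.normcM mul0r subr0.
    by rewrite /Rintegral integral0_eq// => s _; rewrite mulr0 mul0r addr0.
  rewrite E normc_real ger0_norm; last by apply: Rintegral_ge0 => s _; exact: normc_ge0.
  rewrite fineK//; apply: integrable_fin_num => //.
  have := cintg_normc measurableT fhi; apply: eq_integrable => // s _.
  by rewrite !Normc.normcM !normc_real !ger0_norm ?normc_ge0.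
by rewrite H// H// -EFinM -Normc.normcM.
Qed.

Lemma cint_cov_product u v : cLfun2 m u -> cLfun2 m v ->
  cint m0 setT (fun w => cint m setT (fun s => f1 (w, s) * u s) *
    cint m setT (fun s => f2 (w, s) * v s)) =
  cint (m \x m)%E setT (fun x =>
    cint m0 setT (fun w => f1 (w, x.1) * f2 (w, x.2)) * (u x.1 * v x.2)).
Proof.
move=> uL vL; have Gi := cintg_cov_product uL vL.
have [mu_ _] := (cLfun2P _ _).1 uL; have [mv _] := (cLfun2P _ _).1 vL.
have [mf1 _] := (cLfun2P _ _).1 f1L; have [mf2 _] := (cLfun2P _ _).1 f2L.
(* Constant weights give the integrability of f1 f2 itself, which lets u v be taken out of the inner
   integral over [m0]. *)
have G1i := cintg_cov_product (cLfun2_cst1 m) (cLfun2_cst1 m).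
have s1 := cintg_section_mul f1L uL; have s2 := cintg_section_mul f2L vL.
transitivity (cint (m0 \x finprod m m)%E setT (G u v)).
  rewrite cint_snd//; apply: ae_eq_cint.
  - by apply: cmeasM; exact: cmeas_cint_mul.
  - exact: (cmeas_cint_snd (finprod m m) (cintg_cmeas Gi)).
  apply: (aeS2 s1 s2) => w w1 w2.
  by rewrite -(cint_tensor w1 w2).
rewrite cint_fst//; apply: ae_eq_cint.
- exact: (cmeas_cint_fst m0 (cintg_cmeas Gi)).
- have mG1 := cmeas_cint_fst m0 (cintg_cmeas G1i).
  apply: cmeasM.
    move: mG1; congr cmeas; apply/funext => x; apply: eq_cint => w _.
    by rewrite /G !mulr1.
  by apply: cmeasM; [exact: cmeas_comp measurable_fst mu_|exact: cmeas_comp measurable_snd mv].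
have s3 := cintg_section_fst G1i; apply: (aeS s3) => x xi.
have xi' : cintg m0 setT (fun w => f1 (w, x.1) * f2 (w, x.2)).
  move: xi; congr (cintg _ _ _); apply/funext => w.
  by rewrite /G !mulr1.
rewrite mulrC -cintZ//; apply: eq_cint => w _; rewrite /G /=.
by rewrite mulrACA mulrC.
Qed.

End covariance_fubini.

(** * Integral operators and their sesquilinear forms *)

Section kernel_operators.
Context {R : realType}.
Local Notation C := R[i].
Local Notation TR := (measurableTypeR R : measurableType _).
Local Notation mu := (leb01 R : {measure set TR -> \bar R}).
Local Notation sq := (leb01sq R).
Implicit Types (k l : R -> R -> C) (h g : R -> C).

Definition kL2 k := cLfun2 sq (fun x => k x.1 x.2).

Lemma kL2_meas k : kL2 k -> kmeas k.
Proof. by move=> /cLfun2P[]. Qed.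

Lemma kL2_lty k : kL2 k -> (knorm 2%:E k < +oo)%E.
Proof. by move=> /cLfun2P[]. Qed.

Lemma knorm_tensor (u v : R -> C) : cmeas (u : measurableTypeR R -> C) ->
  cmeas (v : measurableTypeR R -> C) ->
  knorm 2%:E (fun s t => u s * v t) = (cN mu u * cN mu v)%E.
Proof. by move=> mu_ mv; exact: cN_tensor. Qed.

Lemma kL2_tensor (u v : R -> C) : cLfun2 mu u -> cLfun2 mu v ->
  kL2 (fun s t => u s * v t).
Proof. exact: (@cLfun2_tensor _ _ _ _ _ (leb01 R) (leb01 R)). Qed.

Lemma int_op_section k h : kL2 k -> cLfun2 mu h ->
  {ae mu, forall s, cintg mu setT (fun t => k s t * h t)}.
Proof. exact: (@cintg_section_mul _ _ _ _ _ (leb01 R) (leb01 R)). Qed.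

Lemma cmeas_int_op k h : kmeas k -> cmeas (h : measurableTypeR R -> C) ->
  cmeas (int_op k h : measurableTypeR R -> C).
Proof. exact: (@cmeas_cint_mul _ _ _ _ _ (leb01 R)). Qed.

Lemma cN_int_op k h : kL2 k -> cLfun2 mu h ->
  (cN mu (int_op k h) <= knorm 2%:E k * cN mu h)%E.
Proof. exact: (@cN_cint_mul _ _ _ _ _ (leb01 R) (leb01 R)). Qed.

Lemma cLfun2_int_op k h : kL2 k -> cLfun2 mu h -> cLfun2 mu (int_op k h).
Proof. exact: (@cLfun2_cint_mul _ _ _ _ _ (leb01 R) (leb01 R)). Qed.

(** The form <K h, g>, written over the square: on L^2 kernels it is exactly linear in the kernel,
    while [int_op] is so only almost everywhere. *)
Definition qform k h g : C := cint sq setT (fun x => k x.1 x.2 * ((g x.1)^* * h x.2)).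

Lemma qform_cintg k h g : kL2 k -> cLfun2 mu h -> cLfun2 mu g ->
  cintg sq setT (fun x => k x.1 x.2 * ((g x.1)^* * h x.2)).
Proof.
move=> kL hL gL; apply: cintgM2 => //.
by apply: (@kL2_tensor (fun s => (g s)^*) h) => //; exact: cLfun2_conj.
Qed.

Lemma cinner_int_op k h g : kL2 k -> cLfun2 mu h -> cLfun2 mu g ->
  cinner (int_op k h) g = qform k h g.
Proof.
move=> kL hL gL; have qi := qform_cintg kL hL gL.
have [mh _] := (cLfun2P _ _).1 hL; have [mg _] := (cLfun2P _ _).1 gL.
rewrite /qform (@cint_snd _ _ _ _ _ (leb01 R) (leb01 R) _ qi).
apply: ae_eq_cint.
- by apply: cmeasM; [apply: cmeas_int_op => //; exact: kL2_meas|exact: cmeas_conj].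
- exact: (@cmeas_cint_snd _ _ _ _ _ (leb01 R) _ (cintg_cmeas qi)).
have ks_ := int_op_section kL hL; apply: (aeS ks_) => s si /=.
rewrite /int_op mulrC -cintZ//; apply: eq_cint => t _.
by rewrite mulrCA.
Qed.

Lemma qform_le k h g : kL2 k -> cLfun2 mu h -> cLfun2 mu g ->
  ((Normc.normc (qform k h g))%:E <= knorm 2%:E k * (cN mu g * cN mu h))%E.
Proof.
move=> kL hL gL; have cgL := cLfun2_conj gL.
have [mg _] := (cLfun2P _ _).1 cgL; have [mh _] := (cLfun2P _ _).1 hL.
have -> : (cN mu g * cN mu h)%E = knorm 2%:E (fun s t => (g s)^* * h t).
  by rewrite knorm_tensor// cN_conj.
exact: (normc_cintM2 kL (kL2_tensor cgL hL)).
Qed.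

Lemma kL2B k l : kL2 k -> kL2 l -> kL2 (fun s t => k s t - l s t).
Proof. exact: cLfun2B. Qed.

Lemma kL2Z z k : kL2 k -> kL2 (fun s t => z * k s t).
Proof. exact: cLfun2Z. Qed.

Lemma kL2_sum (I : Type) (s : seq I) (F : I -> R -> R -> C) :
  (forall i, kL2 (F i)) -> kL2 (fun a b => \sum_(i <- s) F i a b).
Proof. by move=> FL; apply: (@cLfun2_sum _ _ _ sq I s (fun i x => F i x.1 x.2)). Qed.

Lemma qformB k l h g : kL2 k -> kL2 l -> cLfun2 mu h -> cLfun2 mu g ->
  qform (fun s t => k s t - l s t) h g = qform k h g - qform l h g.
Proof.
move=> kL lL hL gL; rewrite /qform -cintB//; try exact: qform_cintg.
by apply: eq_cint => x _; rewrite mulrBl.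
Qed.

Lemma qformZ z k h g : kL2 k -> cLfun2 mu h -> cLfun2 mu g ->
  qform (fun s t => z * k s t) h g = z * qform k h g.
Proof.
move=> kL hL gL; rewrite /qform -cintZ//; try exact: qform_cintg.
by apply: eq_cint => x _; rewrite mulrA.
Qed.

Lemma qform_sum (I : Type) (s : seq I) (F : I -> R -> R -> C) h g :
  (forall i, kL2 (F i)) -> cLfun2 mu h -> cLfun2 mu g ->
  qform (fun a b => \sum_(i <- s) F i a b) h g = \sum_(i <- s) qform (F i) h g.
Proof.
move=> FL hL gL; rewrite /qform -cint_sum//; last by move=> i; exact: qform_cintg.
by apply: eq_cint => x _; rewrite mulr_suml.
Qed.

(** Linearity of the integral needs integrable sections, available for almost every [s]; elsewhere
    the total operation [cint] need not be additive. *)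
Lemma int_opB_ae k l h : kL2 k -> kL2 l -> cLfun2 mu h ->
  {ae mu, forall s, int_op (fun s t => k s t - l s t) h s = int_op k h s - int_op l h s}.
Proof.
move=> kL lL hL; have ks_ := int_op_section kL hL; have ls_ := int_op_section lL hL.
apply: (aeS2 ks_ ls_) => s ks ls.
by rewrite /int_op -cintB//; apply: eq_cint => t _; rewrite mulrBl.
Qed.

Lemma int_opZ_ae z k h : kL2 k -> cLfun2 mu h ->
  {ae mu, forall s, int_op (fun s t => z * k s t) h s = z * int_op k h s}.
Proof.
move=> kL hL; have ks_ := int_op_section kL hL; apply: (aeS ks_) => s ks.
by rewrite /int_op -cintZ//; apply: eq_cint => t _; rewrite mulrA.
Qed.

Lemma int_op_sum_ae (I : Type) (s : seq I) (F : I -> R -> R -> C) h :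
  (forall i, kL2 (F i)) -> cLfun2 mu h ->
  {ae mu, forall a, int_op (fun a b => \sum_(i <- s) F i a b) h a =
     \sum_(i <- s) int_op (F i) h a}.
Proof.
move=> FL hL; elim: s => [|i s IHs].
  apply: nearW => a; rewrite big_nil /int_op -[RHS](cint0 mu setT).
  by apply: eq_cint => t _; rewrite big_nil mul0r.
have sL := kL2_sum s FL.
have is_ := int_op_section (FL i) hL; have ss_ := int_op_section sL hL.
apply: (aeS3 is_ ss_ IHs) => a ia sa IH.
rewrite big_cons -IH /int_op -cintD//; apply: eq_cint => t _.
by rewrite big_cons mulrDl.
Qed.

End kernel_operators.

(** * The spectral density kernel *)

Section characters.
Context {R : realType}.
Implicit Types x y : R.

Lemma normc_expi x : Normc.normc (expi x) = 1.
Proof. by rewrite normcE2 /= cos2Dsin2 sqrtr1. Qed.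

Lemma expiD x y : expi (x + y) = expi x * expi y.
Proof. by apply: complexP; rewrite cReE /= ?cosD ?sinD// addrC. Qed.

Lemma expi_conj x : (expi x)^* = expi (- x).
Proof. by apply: complexP; rewrite cReE /= ?cosN ?sinN. Qed.

Lemma cos_lip x y : `|cos x - cos y| <= `|x - y|.
Proof.
wlog xy : x y / x <= y => [H|].
  have [xy|/ltW yx] := leP x y; first exact: H.
  by rewrite (distrC (cos x)) (distrC x); exact: H.
have [z _ E] : exists2 z, z \in `[x, y]%R & cos y - cos x = (- sin z) * (y - x).
  apply: (@MVT_segment R cos (fun z => - sin z)) => //.
  by apply: continuous_subspaceT => z; exact: continuous_cos.
rewrite distrC E distrC normrM normrN ler_piMl//.
by rewrite ler_norml sin_geN1 sin_le1.
Qed.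

Lemma sin_lip x y : `|sin x - sin y| <= `|x - y|.
Proof.
wlog xy : x y / x <= y => [H|].
  have [xy|/ltW yx] := leP x y; first exact: H.
  by rewrite (distrC (sin x)) (distrC x); exact: H.
have [z _ E] : exists2 z, z \in `[x, y]%R & sin y - sin x = cos z * (y - x).
  apply: (@MVT_segment R sin cos) => //.
  by apply: continuous_subspaceT => z; exact: continuous_sin.
rewrite distrC E distrC normrM ler_piMl//.
by rewrite ler_norml cos_geN1 cos_le1.
Qed.

Lemma expi_lip x y : Normc.normc (expi x - expi y) <= 2 * `|x - y|.
Proof.
apply: le_trans (normc_le_ReIm _) _; rewrite !cReE /= mulr2n mulrDl !mul1r.
by apply: lerD; [exact: cos_lip|exact: sin_lip].
Qed.

Lemma measurable_cos_scale (a : R) : measurable_fun [set: R] (fun x => cos (- (x * a))).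
Proof.
apply: (measurableT_comp (continuous_measurable_fun (@continuous_cos R))).
by apply: measurableT_comp => //; exact: measurable_funM.
Qed.

Lemma measurable_sin_scale (a : R) : measurable_fun [set: R] (fun x => sin (- (x * a))).
Proof.
apply: (measurableT_comp (continuous_measurable_fun (@continuous_sin R))).
by apply: measurableT_comp => //; exact: measurable_funM.
Qed.

End characters.

Lemma zsum_le (R : realType) (a : int -> \bar R) m n : (forall t, 0 <= a t)%E ->
  (zsum m n a <= \sum_(0 <= j <oo) (a (Posz j) + a (Negz j)))%E.
Proof.
move=> a0; rewrite zsumE nneseriesD// addeC.
apply: leeD.
  by rewrite -(big_mkord xpredT (fun j => a (Posz j))); apply: nneseries_lim_ge.
by rewrite -(big_mkord xpredT (fun j => a (Negz j))); apply: nneseries_lim_ge.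
Qed.

Lemma zsumB (V : zmodType) m n (F G : int -> V) :
  zsum m n F - zsum m n G = zsum m n (fun t => F t - G t).
Proof. by rewrite /zsum sumrB. Qed.

Section spectral_density.
Context {R : realType}.
Local Notation C := R[i].
Local Notation sq := (leb01sq R).
Variable r : int -> R -> R -> R.
Hypothesis rL2 : forall t, (fun x => r t x.1 x.2) \in Lfun sq 2%:E.

Let c : R := (2 * pi)^-1.

Let c_gt0 : 0 < c.
Proof. by rewrite /c invr_gt0 mulr_gt0// pi_gt0. Qed.

Lemma ckernel_kL2 t : kL2 (ckernel (r t)).
Proof. exact: (cLfun2_real (rL2 t)). Qed.

Let rmeas t : kmeas (ckernel (r t)).
Proof. exact/kL2_meas/ckernel_kL2. Qed.

Definition spectral_term omega t : R -> R -> C :=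
  fun u v => expi (- (omega * t%:~R)) * ckernel (r t) u v.

Lemma spectral_term_kL2 omega t : kL2 (spectral_term omega t).
Proof. by apply: kL2Z; exact: ckernel_kL2. Qed.

Lemma spectral_psum_kL2 omega m n : kL2 (spectral_psum r omega m n).
Proof.
apply: kL2Z; apply: (@kL2_sum _ _ _ (fun (k : 'I_(m + n).+1) => spectral_term omega (k%:Z - m%:Z))).
by move=> k; exact: spectral_term_kL2.
Qed.

Lemma normc_spectral_term omega t u v :
  Normc.normc (spectral_term omega t u v) = `|r t u v|.
Proof. by rewrite Normc.normcM normc_expi mul1r normc_real. Qed.

(** The frequency is a variable like the two arguments, so that [csum_exists] yields a limit
    measurable in all three jointly. Index [j] groups the times j and -(j+1). *)
Definition spectral_pair j (x : R * (R * R)) : C :=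
  c%:C * (spectral_term x.1 (Posz j) x.2.1 x.2.2 + spectral_term x.1 (Negz j) x.2.1 x.2.2).

(* [2 * c] times the moduli of the two terms of index [j]; the factor 2 absorbs
   the difference between the series of pairs and the rectangular sums. *)
Definition spectral_bound j : R -> R -> C :=
  fun u v => (2 * c * (`|r (Posz j) u v| + `|r (Negz j) u v|))%:C.

Lemma spectral_bound_kmeas j : kmeas (spectral_bound j).
Proof.
apply: cmeas_real; apply: measurable_funM => //.
apply: measurable_funD; apply: measurableT_comp => //.
  exact: (rmeas (Posz j)).1.
exact: (rmeas (Negz j)).1.
Qed.

Lemma normc_spectral_bound j u v : Normc.normc (spectral_bound j u v) =
  2 * c * (`|r (Posz j) u v| + `|r (Negz j) u v|).
Proof.
by rewrite normc_real ger0_norm// mulr_ge0// ?addr_ge0// mulr_ge0// ltW.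
Qed.

Lemma spectral_pair_cmeas j :
  cmeas (spectral_pair j :
    measurableTypeR R * (measurableTypeR R * measurableTypeR R) -> C).
Proof.
apply: cmeasM; first exact: cmeas_cst.
have H t : cmeas (fun x : measurableTypeR R * (measurableTypeR R * measurableTypeR R) =>
    spectral_term x.1 t x.2.1 x.2.2).
  apply: cmeasM; last exact: (cmeas_comp measurable_snd (rmeas t)).
  have He : cmeas (fun w : measurableTypeR R => expi (- (w * t%:~R)) : C).
    by split; [exact: measurable_cos_scale|exact: measurable_sin_scale].
  exact: (cmeas_comp measurable_fst He).
by apply: cmeasD.
Qed.

Lemma normc_spectral_pair j omega u v :
  2 * Normc.normc (spectral_pair j (omega, (u, v))) <= Normc.normc (spectral_bound j u v).
Proof.
rewrite normc_spectral_bound Normc.normcM normc_real ger0_norm ?(ltW c_gt0)//.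
rewrite -mulrA ler_pM2l// ler_pM2l//.
by apply: le_trans (le_normcD _ _) _; rewrite !normc_spectral_term.
Qed.

(** For N <= m, n the rectangular sum contains the first N pairs. What is left are terms of index at
    least N, counted at most once, hence at most half of the tail of [spectral_bound]. *)
Lemma spectral_psum_near omega N m n u v : (N <= m)%N -> (N <= n)%N ->
  ((2 * Normc.normc (\sum_(i < N) spectral_pair i (omega, (u, v)) -
     spectral_psum r omega m n u v))%:E <=
   \sum_(N <= j <oo) (Normc.normc (spectral_bound j u v))%:E)%E.
Proof.
move=> Nm Nn.
pose F t := spectral_term omega t u v.
have -> : spectral_psum r omega m n u v =
    \sum_(i < N) spectral_pair i (omega, (u, v)) +
    c%:C * (\sum_(N <= j < m) F (Negz j) + \sum_(N <= j < n.+1) F (Posz j)).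
  have -> : \sum_(i < N) spectral_pair i (omega, (u, v)) =
      c%:C * (\sum_(0 <= j < N) F (Posz j) + \sum_(0 <= j < N) F (Negz j)).
    by rewrite -big_split/= big_mkord mulr_sumr.
  rewrite -mulrDr /spectral_psum; congr (_ * _).
  rewrite (_ : zsum m n _ = zsum m n F)// zsumE.
  rewrite -(big_mkord xpredT (fun j => F (Posz j))) -(big_mkord xpredT (fun j => F (Negz j))).
  rewrite (@big_cat_nat _ _ _ N 0 m)// (@big_cat_nat _ _ _ N 0 n.+1)//=; last exact: leqW.
  by rewrite addrACA; congr (_ + _); rewrite addrC.
rewrite opprD addNKr normcN.
(* The rectangle may be lopsided: the indices of negative times stop before m, the others before
   n+1, and the maximum completes both. *)
apply: (@le_trans _ _ (\sum_(N <= j < maxn m n.+1) Normc.normc (spectral_bound j u v))%:E).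
  rewrite lee_fin Normc.normcM normc_real ger0_norm ?(ltW c_gt0)//.
  under [leRHS]eq_bigr do rewrite normc_spectral_bound.
  rewrite -mulr_sumr mulrA ler_pM2l; last by rewrite mulr_gt0.
  rewrite big_split/= addrC.
  have Fle s (g : nat -> int) : Normc.normc (\sum_(N <= j < s) F (g j)) <=
      \sum_(N <= j < s) `|r (g j) u v|.
    apply: le_trans (normc_sum _ _ _) _; apply: ler_sum => j _.
    by rewrite normc_spectral_term.
  apply: le_trans (le_normcD _ _) _; apply: lerD; apply: le_trans (Fle _ _) _.
    rewrite (@big_cat_nat _ _ _ m N (maxn m n.+1))//=; last exact: leq_maxl.
    by rewrite lerDl sumr_ge0.
  rewrite (@big_cat_nat _ _ _ n.+1 N (maxn m n.+1))//=; [|exact: leqW|exact: leq_maxr].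
  by rewrite lerDl sumr_ge0.
rewrite -sumEFin; apply: nneseries_lim_ge => j _ _.
by rewrite lee_fin normc_ge0.
Qed.

(** Half of the tail bounds the distance from the limit to the sum of the first N pairs, the other
    half the distance from there to the rectangular sum. Convergence, uniformity in the frequency
    and the inversion formula all come from this bound. *)
Lemma spectral_limit_exists : exists2 f : R -> R -> R -> C, jointly_measurable f &
  forall omega N m n u v, (N <= m)%N -> (N <= n)%N ->
    ((Normc.normc (f omega u v - spectral_psum r omega m n u v))%:E <=
     \sum_(N <= j <oo) (Normc.normc (spectral_bound j u v))%:E)%E.
Proof.
have [S mS SP] := csum_exists spectral_pair_cmeas.
exists (fun omega u v => S (omega, (u, v))).
  have [mr mi] := mS; split.
    by under eq_fun do rewrite -!surjective_pairing.
  by under eq_fun do rewrite -!surjective_pairing.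
move=> omega N m n u v Nm Nn.
set B := (\sum_(N <= j <oo) _)%E.
have B0 : (0 <= B)%E by apply: nneseries_ge0 => *; rewrite lee_fin normc_ge0.
pose p := \sum_(i < N) spectral_pair i (omega, (u, v)).
have H1 : ((2 * Normc.normc (S (omega, (u, v)) - p))%:E <= B)%E.
  apply: (@le_trans _ _ (2%:E * \sum_(N <= i <oo) (Normc.normc (spectral_pair i (omega, (u, v))))%:E)%E).
    by rewrite EFinM lee_pmul2l// SP.
  rewrite -nneseriesZl; last by move=> i _; rewrite lee_fin normc_ge0.
  apply: lee_nneseries => i; first by rewrite -EFinM lee_fin mulr_ge0// normc_ge0.
  by rewrite -EFinM lee_fin normc_spectral_pair.
have H2 := spectral_psum_near omega u v Nm Nn.
have := leeD H1 H2; rewrite -/p -/B -EFinD -mulrDr.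
have BE : (B + B = 2%:E * B)%E by rewrite -[2%R]/(1 + 1) EFinD ge0_muleDl// mul1e.
rewrite BE EFinM lee_pmul2l//; apply: le_trans.
rewrite lee_fin; apply: le_trans (le_normcD _ _).
by rewrite addrA subrK.
Qed.

End spectral_density.

(** * Convergence, boundedness and continuity in the kernel norms *)

Section spectral_density_norms.
Context {R : realType}.
Local Notation C := R[i].
Local Notation sq := (leb01sq R).
Variable r : int -> R -> R -> R.
Hypothesis rL2 : forall t, (fun x => r t x.1 x.2) \in Lfun sq 2%:E.

Let c : R := (2 * pi)^-1.

Let c_gt0 : 0 < c.
Proof. by rewrite /c invr_gt0 mulr_gt0// pi_gt0. Qed.

Let rmeas t : kmeas (ckernel (r t)).
Proof. exact/kL2_meas/ckernel_kL2. Qed.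

Let psum_meas omega m n : kmeas (spectral_psum r omega m n).
Proof. exact/kL2_meas/spectral_psum_kL2. Qed.

Lemma summable_knorm_le2y : (\esum_(t in [set: int]) knorm +oo (ckernel (r t)) < +oo)%E ->
  (\esum_(t in [set: int]) knorm 2%:E (ckernel (r t)) < +oo)%E.
Proof.
by apply: le_lt_trans; apply: le_esum => t _; exact: knorm_le2y.
Qed.

Lemma spectral_density_kernel_y2 omega f :
  spectral_density_kernel +oo r omega f -> spectral_density_kernel 2%:E r omega f.
Proof.
move=> [fL fcvg]; split => //; apply/cvge0_pairP => [x|e e0]; first exact: knorm_ge0.
have /(cvge0_pairP (fun=> knorm_ge0 _ _))/(_ _ e0)[N NP] := fcvg.
exists N => m n Nm Nn; apply: le_trans (NP m n Nm Nn).
by apply: knorm_le2y; apply: kmeasB => //; exact: (kL2_meas fL).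
Qed.

Section exponent.
Variables (p : \bar R) (Hp : p = 2%:E \/ p = +oo%E).
Hypothesis rp : (\esum_(t in [set: int]) knorm p (ckernel (r t)) < +oo)%E.

Let a t := knorm p (ckernel (r t)).
Let S := (\sum_(0 <= j <oo) (a (Posz j) + a (Negz j)))%E.

Let a0 t : (0 <= a t)%E.
Proof. exact: knorm_ge0. Qed.

Let aa0 j : (0 <= a (Posz j) + a (Negz j))%E.
Proof. by rewrite adde_ge0. Qed.

Let S_lty : (S < +oo)%E.
Proof. by rewrite /S -esum_int. Qed.

Let S_fin : S \is a fin_num.
Proof. by rewrite ge0_fin_numE//; apply: nneseries_ge0 => *; exact: aa0. Qed.

Lemma knorm_spectral_bound j :
  (knorm p (spectral_bound r j) <= (2 * c)%:E * (a (Posz j) + a (Negz j)))%E.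
Proof.
have habs t : knorm p (fun u v => `|r t u v|%:C) = a t.
  have mabs : kmeas (fun u v => `|r t u v|%:C).
    by apply: cmeas_real; apply: measurableT_comp => //; exact: (rmeas t).1.
  by apply/eqP; rewrite eq_le; apply/andP; split; apply: knorm_le => // u v;
    rewrite !normc_real normr_id.
rewrite (_ : spectral_bound r j =
  (fun u v => (2 * c)%:C * (`|r (Posz j) u v|%:C + `|r (Negz j) u v|%:C))); last first.
  by apply/funext => u; apply/funext => v; rewrite -rmorphD -rmorphM.
have mr t : kmeas (fun u v => `|r t u v|%:C).
  by apply: cmeas_real; apply: measurableT_comp => //; exact: (rmeas t).1.
apply: le_trans (knormZ Hp _ (kmeasD (mr _) (mr _))) _.
rewrite normc_real ger0_norm; last by rewrite mulr_ge0// ltW.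
apply: lee_wpmul2l; first by rewrite lee_fin mulr_ge0// ltW.
by apply: le_trans (knormD Hp (mr _) (mr _)) _; rewrite !habs.
Qed.

Lemma knorm_spectral_psum omega m n :
  (knorm p (spectral_psum r omega m n) <= c%:E * S)%E.
Proof.
have mF t := kL2_meas (spectral_term_kL2 rL2 omega t).
apply: le_trans (knormZ Hp _ (kmeas_sum _ (fun k : 'I_(m + n).+1 => mF (k%:Z - m%:Z)))) _.
rewrite normc_real ger0_norm ?(ltW c_gt0)//; apply: lee_wpmul2l.
  by rewrite lee_fin ltW.
apply: le_trans (zsum_le m n a0).
apply: le_trans (knorm_sum Hp _ (fun k : 'I_(m + n).+1 => mF (k%:Z - m%:Z))) _.
apply: lee_sum => k _; apply: knorm_le => // u v.
by rewrite normc_spectral_term normc_real.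
Qed.

(** For |t| <= n the character exp(-i omega t) is Lipschitz in omega with constant 2 |t|, at most 2
    (n + 1), and the norms of the kernels add up to at most [S]. *)
Lemma knorm_spectral_psumB omega1 omega2 n :
  (knorm p (fun u v => spectral_psum r omega1 n n u v - spectral_psum r omega2 n n u v)%R <=
   (2 * `|omega1 - omega2| * n.+1%:R)%:E * (c%:E * S))%E.
Proof.
have mF omega t := kL2_meas (spectral_term_kL2 rL2 omega t).
pose G (k : 'I_(n + n).+1) u v := spectral_term r omega1 (k%:Z - n%:Z) u v -
  spectral_term r omega2 (k%:Z - n%:Z) u v.
have mG k : kmeas (G k) by exact: kmeasB.
rewrite (_ : (fun u v => _) = (fun u v => c%:C * \sum_(k < (n + n).+1) G k u v)); last first.
  by apply/funext => u; apply/funext => v; rewrite /spectral_psum -mulrBr zsumB.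
apply: le_trans (knormZ Hp _ (kmeas_sum _ mG)) _.
rewrite normc_real ger0_norm ?(ltW c_gt0)// muleCA; apply: lee_wpmul2l.
  by rewrite lee_fin ltW.
apply: le_trans (knorm_sum Hp _ mG) _.
apply: (@le_trans _ _ (\sum_(k < (n + n).+1)
    ((2 * `|omega1 - omega2| * n.+1%:R)%:E * a (k%:Z - n%:Z)))%E).
  apply: lee_sum => k _.
  rewrite (_ : G k = (fun u v => (expi (- (omega1 * (k%:Z - n%:Z)%:~R)) -
      expi (- (omega2 * (k%:Z - n%:Z)%:~R))) * ckernel (r (k%:Z - n%:Z)) u v)); last first.
    by apply/funext => u; apply/funext => v; rewrite mulrBl.
  apply: le_trans (knormZ Hp _ (rmeas _)) _; apply: lee_wpmul2r; first exact: a0.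
  rewrite lee_fin; apply: le_trans (expi_lip _ _) _.
  rewrite -opprD normrN -mulrBl normrM mulrA ler_wpM2l ?mulr_ge0//.
  rewrite -intr_norm -[n.+1%:R]/(n.+1%:Z%:~R) ler_int.
  by have := ltn_ord k; lia.
rewrite -ge0_sume_distrr; last by move=> k _; exact: a0.
apply: lee_wpmul2l; first by rewrite lee_fin !mulr_ge0.
exact: (zsum_le n n a0).
Qed.

(** The pointwise tail bound passes to the norm by [knorm_series], and the tail of the norms does
    not involve omega. *)
Lemma spectral_density_near (f : R -> R -> R -> C) :
  (forall omega, kmeas (f omega)) ->
  (forall omega N m n u v, (N <= m)%N -> (N <= n)%N ->
    ((Normc.normc (f omega u v - spectral_psum r omega m n u v))%:E <=
     \sum_(N <= j <oo) (Normc.normc (spectral_bound r j u v))%:E)%E) ->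
  forall e : R, 0 < e -> exists N, forall omega m n, (N <= m)%N -> (N <= n)%N ->
    (knorm p (fun u v => f omega u v - spectral_psum r omega m n u v)%R <= e%:E)%E.
Proof.
move=> mf fP e e0.
(* Each [spectral_bound] has norm at most 2 c times the sum of the norms of its two kernels. *)
have ec0 : 0 < e / (2 * c) by rewrite divr_gt0// mulr_gt0.
have [N NP] := series_tail_small aa0 S_lty ec0.
exists N => omega m n Nm Nn.
apply: (@le_trans _ _ (\sum_(N <= j <oo) knorm p (spectral_bound r j))%E).
  apply: knorm_series => //; first exact: kmeasB.
    by move=> j; exact: spectral_bound_kmeas.
  by move=> u v; exact: fP.
apply: (@le_trans _ _ (\sum_(N <= j <oo) ((2 * c)%:E * (a (Posz j) + a (Negz j))))%E).
  by apply: lee_nneseries => j _; [move=> _; exact: knorm_ge0|exact: knorm_spectral_bound].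
rewrite nneseriesZl//.
apply: (@le_trans _ _ ((2 * c)%:E * (e / (2 * c))%:E)%E).
  by apply: lee_wpmul2l; [rewrite lee_fin mulr_ge0// ltW|exact: NP].
by rewrite -EFinM mulrC divfK// gt_eqF// mulr_gt0.
Qed.

Lemma spectral_density_kernelP (f : R -> R -> R -> C) :
  jointly_measurable f ->
  (forall omega N m n u v, (N <= m)%N -> (N <= n)%N ->
    ((Normc.normc (f omega u v - spectral_psum r omega m n u v))%:E <=
     \sum_(N <= j <oo) (Normc.normc (spectral_bound r j u v))%:E)%E) ->
  (forall omega, kL2 (f omega)) -> forall omega, spectral_density_kernel p r omega (f omega).
Proof.
move=> mf fP fL omega; split; first exact: fL.
apply/cvge0_pairP => [x|e e0]; first exact: knorm_ge0.
have [N NP] := spectral_density_near (fun omega => kL2_meas (fL omega)) fP e0.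
by exists N => m n Nm Nn; exact: NP.
Qed.

Lemma spectral_density_unique omega (f g : R -> R -> C) :
  spectral_density_kernel p r omega f -> spectral_density_kernel p r omega g ->
  knorm p (fun u v => f u v - g u v) = 0%E.
Proof.
move=> [fL /(cvge0_pairP (fun=> knorm_ge0 _ _)) fcvg].
move=> [gL /(cvge0_pairP (fun=> knorm_ge0 _ _)) gcvg].
apply: lee0_eps => [|e e0]; first exact: knorm_ge0.
have e20 : 0 < e / 2 by rewrite divr_gt0.
have [M MP] := fcvg _ e20; have [N NP] := gcvg _ e20.
have mF := kL2_meas fL; have mG := kL2_meas gL.
apply: le_trans (knorm_dist3 Hp mF (psum_meas omega (maxn M N) (maxn M N)) mG) _.
rewrite [e]splitr EFinD; apply: leeD; first by apply: MP; exact: leq_maxl.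
by rewrite knormBC; apply: NP; exact: leq_maxr.
Qed.

(** The hypothesis provides a rank for each omega separately. The constructed limit [g] has a
    uniform rank, and f omega is within any d > 0 of g omega, through partial sums whose rank may
    depend on omega and d. *)
Lemma spectral_density_uniform (f : R -> R -> R -> C) :
  (forall omega, spectral_density_kernel p r omega (f omega)) ->
  forall e : R, 0 < e -> exists N, forall omega,
    (knorm p (fun u v => f omega u v - spectral_psum r omega N N u v)%R <= e%:E)%E.
Proof.
move=> fD.
have [g mg gP] := spectral_limit_exists rL2.
have mg1 omega : kmeas (g omega).
  apply: (cmeas_comp (phi := pair omega) (f := fun x => g x.1 x.2.1 x.2.2)) mg.
  exact: pair1_measurable.
move=> e e0; have [N NP] := spectral_density_near mg1 gP e0.
exists N => omega.
have [fL /(cvge0_pairP (fun=> knorm_ge0 _ _)) fcvg] := fD omega.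
apply: lee_eps => d d0; have d20 : 0 < d / 2 by rewrite divr_gt0.
have [N1 N1P] := fcvg _ d20.
have [N2 N2P] := spectral_density_near mg1 gP d20.
pose K := maxn N1 N2.
apply: le_trans (knorm_dist3 Hp (kL2_meas fL) (psum_meas omega K K) (psum_meas omega N N)) _.
apply: (@le_trans _ _ ((d / 2)%:E + ((d / 2)%:E + e%:E))%E); last first.
  by rewrite addeA -EFinD -splitr addeC.
apply: leeD; first by apply: N1P; exact: leq_maxl.
apply: le_trans (knorm_dist3 Hp (psum_meas omega K K) (mg1 omega) (psum_meas omega N N)) _.
apply: leeD; last exact: NP.
by rewrite knormBC; apply: N2P; exact: leq_maxr.
Qed.

Lemma spectral_density_bounded (f : R -> R -> R -> C) :
  (forall omega, spectral_density_kernel p r omega (f omega)) ->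
  exists M : R, forall omega, (knorm p (f omega) <= M%:E)%E.
Proof.
move=> fD; have [N NP] := spectral_density_uniform fD ltr01.
exists (1 + c * fine S) => omega; have [fL _] := fD omega.
rewrite (_ : f omega = (fun u v => (f omega u v - spectral_psum r omega N N u v) +
    spectral_psum r omega N N u v)); last first.
  by apply/funext => u; apply/funext => v; rewrite subrK.
apply: le_trans (knormD Hp (kmeasB (kL2_meas fL) (psum_meas omega N N)) (psum_meas omega N N)) _.
rewrite EFinD EFinM fineK//; apply: leeD; first exact: NP.
exact: knorm_spectral_psum.
Qed.

Lemma spectral_density_unif_continuous (f : R -> R -> R -> C) :
  (forall omega, spectral_density_kernel p r omega (f omega)) ->
  forall e : R, 0 < e -> exists2 delta : R, 0 < delta &
    forall omega1 omega2 : R, `|omega1 - omega2| < delta ->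
      (knorm p (fun u v => f omega1 u v - f omega2 u v)%R < e%:E)%E.
Proof.
(* Two approximations and one difference of partial sums cost e / 4 each; the remaining quarter
   makes the inequality strict. *)
move=> fD e e0; have e40 : 0 < e / 4 by rewrite divr_gt0.
have [N NP] := spectral_density_uniform fD e40.
(* A Lipschitz constant in the frequency for the partial sum of rank N, plus 1 so that it can be
   divided by. *)
pose L := 2 * N.+1%:R * (c * fine S) + 1.
have S0 : 0 <= fine S by apply: fine_ge0; apply: nneseries_ge0 => *; exact: aa0.
have L0 : 0 < L by rewrite ltr_wpDl// !mulr_ge0// ltW.
exists (e / 4 / L); first by rewrite divr_gt0.
move=> w1 w2 w12; have [f1L _] := fD w1; have [f2L _] := fD w2.
have m1 := kL2_meas f1L; have m2 := kL2_meas f2L.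
apply: le_lt_trans (knorm_dist3 Hp m1 (psum_meas w1 N N) m2) _.
apply: (@le_lt_trans _ _ ((e / 4)%:E + ((e / 4)%:E + (e / 4)%:E))%E); last first.
  by rewrite -!EFinD lte_fin; lra.
apply: leeD; first exact: NP.
apply: le_trans (knorm_dist3 Hp (psum_meas w1 N N) (psum_meas w2 N N) m2) _.
apply: leeD; last by rewrite knormBC; exact: NP.
apply: le_trans (knorm_spectral_psumB _ _ _) _.
rewrite -(fineK S_fin) -!EFinM lee_fin.
apply: (@le_trans _ _ (`|w1 - w2| * L)).
  rewrite -subr_ge0 /L (_ : _ - _ = `|w1 - w2|) ?normr_ge0//.
  by ring.
by rewrite -ler_pdivlMr// ltW.
Qed.

End exponent.

Lemma spectral_limit_kL2 (f : R -> R -> R -> C) :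
  (\esum_(t in [set: int]) knorm 2%:E (ckernel (r t)) < +oo)%E ->
  (forall omega, kmeas (f omega)) ->
  (forall omega N m n u v, (N <= m)%N -> (N <= n)%N ->
    ((Normc.normc (f omega u v - spectral_psum r omega m n u v))%:E <=
     \sum_(N <= j <oo) (Normc.normc (spectral_bound r j u v))%:E)%E) ->
  forall omega, kL2 (f omega).
Proof.
move=> r2 mf fP omega; apply/cLfun2P; split; first exact: mf.
have [N NP] := spectral_density_near (or_introl erefl) r2 mf fP ltr01.
have psL := spectral_psum_kL2 rL2 omega N N.
rewrite (_ : (fun x => _) = (fun x => (f omega x.1 x.2 - spectral_psum r omega N N x.1 x.2) +
    spectral_psum r omega N N x.1 x.2)); last first.
  by apply/funext => x; rewrite subrK.
apply: le_lt_trans (knormD (or_introl erefl) (kmeasB (mf omega) (psum_meas omega N N)) (psum_meas omega N N)) _.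
rewrite lte_add_pinfty//; last exact: kL2_lty.
exact: le_lt_trans (NP omega N N (leqnn N) (leqnn N)) (ltry _).
Qed.

Lemma spectral_density_exists (p : \bar R) : p = 2%:E \/ p = +oo%E ->
  (\esum_(t in [set: int]) knorm p (ckernel (r t)) < +oo)%E ->
  exists f : R -> R -> R -> C, [/\ jointly_measurable f,
    (forall omega, spectral_density_kernel p r omega (f omega)) &
    forall omega N m n u v, (N <= m)%N -> (N <= n)%N ->
    ((Normc.normc (f omega u v - spectral_psum r omega m n u v))%:E <=
     \sum_(N <= j <oo) (Normc.normc (spectral_bound r j u v))%:E)%E].
Proof.
move=> Hp rp.
have r2 : (\esum_(t in [set: int]) knorm 2%:E (ckernel (r t)) < +oo)%E.
  by case: Hp rp => -> //; exact: summable_knorm_le2y.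
have [g mg gP] := spectral_limit_exists rL2.
exists g; split => //; apply: spectral_density_kernelP => //.
apply: spectral_limit_kL2 => // omega.
apply: (cmeas_comp (phi := pair omega) (f := fun x => g x.1 x.2.1 x.2.2)) mg.
exact: pair1_measurable.
Qed.

End spectral_density_norms.

(** * The inversion formula *)

Section fourier_integrals.
Context {R : realType}.
Local Notation leb := (@lebesgue_measure R).
Local Notation I := (`[0%R, (2 * pi)%R]%classic : set (measurableTypeR R)).

Lemma expi0 : expi 0 = 1 :> R[i].
Proof. by apply: complexP; rewrite /= ?cos0 ?sin0. Qed.

Lemma expi_2pi_nat (n : nat) : expi (2 * pi * n%:R) = 1 :> R[i].
Proof.
elim: n => [|n IHn]; first by rewrite mulr0 expi0.
rewrite -[n.+1%:R]natr1 mulrDr mulr1 expiD IHn mul1r; apply: complexP => /=.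
  by rewrite mulr_natl cos2pi.
by rewrite mulr_natl sin2pi.
Qed.

Lemma expi_2pi_int (z : int) : expi (z%:~R * (2 * pi)) = 1 :> R[i].
Proof.
rewrite mulrC; case: z => n; first exact: expi_2pi_nat.
rewrite NegzE mulrNz mulrN -expi_conj -[(n.+1)%:~R]/(n.+1%:R) expi_2pi_nat.
exact: conjc1.
Qed.

Lemma is_derive_scale (a x : R) : is_derive x 1 (fun y : R => a * y) a.
Proof.
have h := is_deriveZ a (is_derive_id x (1 : R)).
by apply: (is_derive_eq h); rewrite /GRing.scale/= mulr1.
Qed.

Lemma is_derive_sin_scale (a x : R) :
  is_derive x 1 (fun y => sin (a * y)) (a * cos (a * x)).
Proof.
have h : is_derive x 1 (fun y : R => a * y) a.
  exact: is_derive_scale.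
have := is_derive1_comp (f := sin) (g := fun y => a * y) (is_derive_sin (a * x)) h.
by rewrite mulrC.
Qed.

Lemma is_derive_cos_scale (a x : R) :
  is_derive x 1 (fun y => - cos (a * y)) (a * sin (a * x)).
Proof.
have h : is_derive x 1 (fun y : R => a * y) a.
  exact: is_derive_scale.
have := is_deriveN (is_derive1_comp (f := cos) (g := fun y => a * y) (is_derive_cos (a * x)) h).
by rewrite mulNr opprK mulrC.
Qed.

Lemma integral_FTC (f F : R -> R) (b : R) : 0 < b -> continuous f ->
  (forall x : R, is_derive x (1 : R) F (f x)) ->
  \int[leb]_(x in `[0, b]) f x = F b - F 0.
Proof.
move=> b0 cf dF; rewrite /Rintegral.
have cF : continuous F.
  by move=> x; apply/differentiable_continuous/derivable1_diffP; have [] := dF x.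
rewrite (@continuous_FTC2 R f F 0 b)//.
- exact: continuous_subspaceT.
- split.
  + by move=> x _; have [] := dF x.
  + by apply: cvg_at_right_filter; exact: cF.
  + by apply: cvg_at_left_filter; exact: cF.
- by move=> x _; rewrite derive1E; have [_ ->] := dF x.
Qed.

Lemma continuous_cos_scale (a : R) : continuous (fun x => cos (a * x)).
Proof.
move=> x; apply: (@continuous_comp _ _ _ (fun y => a * y) cos).
  by apply: continuousM => //; exact: cst_continuous.
exact: continuous_cos.
Qed.

Lemma continuous_sin_scale (a : R) : continuous (fun x => sin (a * x)).
Proof.
move=> x; apply: (@continuous_comp _ _ _ (fun y => a * y) sin).
  by apply: continuousM => //; exact: cst_continuous.
exact: continuous_sin.
Qed.

Lemma leb_2pi : leb I = (2 * pi)%:E.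
Proof.
rewrite lebesgue_measure_itv/= lte_fin mulr_gt0 ?pi_gt0//.
by rewrite oppr0 adde0.
Qed.

Lemma cintg_expi (a : R) : cintg leb I (fun x => expi (a * x)).
Proof.
by split; apply: continuous_compact_integrable => //;
  do ?[exact: segment_compact]; apply: continuous_subspaceT;
  [exact: continuous_cos_scale|exact: continuous_sin_scale].
Qed.

Lemma cint_expi (z : int) :
  cint leb I (fun x => expi (z%:~R * x)) = (if z == 0 then (2 * pi)%:C else 0).
Proof.
have pi20 : 0 < 2 * pi :> R by rewrite mulr_gt0// pi_gt0.
case: eqP => [->|/eqP z0].
  rewrite (@eq_cint _ _ _ _ _ _ (fun=> 1)); last by move=> x _; rewrite mul0r expi0.
  rewrite /cint /= !Rintegral_cst//; apply: complexP => /=; last by rewrite mul0r.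
  by rewrite mul1r; have := leb_2pi => ->.
have zR0 : z%:~R != 0 :> R by rewrite intr_eq0.
have E := expi_2pi_int z; have [cE sE] : cos (z%:~R * (2 * pi)) = 1 :> R /\ sin (z%:~R * (2 * pi)) = 0 :> R.
  by case: E.
have czc : continuous (fun x : R => z%:~R * cos (z%:~R * x)).
  by move=> x; apply: continuousM; [exact: cst_continuous|exact: continuous_cos_scale].
have czs : continuous (fun x : R => z%:~R * sin (z%:~R * x)).
  by move=> x; apply: continuousM; [exact: cst_continuous|exact: continuous_sin_scale].
(* After multiplication by z, the integrands are the derivatives of sin(z x) and -cos(z x), which
   take equal values at 0 and 2 pi. *)
apply: complexP => /=; apply: (mulfI zR0); rewrite mulr0.
  rewrite -RintegralZl//; last exact: (cintg_expi _).1.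
  have -> := integral_FTC pi20 czc (is_derive_sin_scale _).
  by rewrite sE mulr0 sin0 subrr.
rewrite -RintegralZl//; last exact: (cintg_expi _).2.
have -> := integral_FTC pi20 czs (is_derive_cos_scale _).
by rewrite cE mulr0 cos0 subrr.
Qed.

End fourier_integrals.

Lemma zsum_delta (V : nmodType) (F : int -> V) (t : int) (N : nat) : (absz t <= N)%N ->
  zsum N N (fun s => if s == t then F s else 0) = F t.
Proof.
move=> tN; have kN : (absz (t + N%:Z)%R < (N + N).+1)%N by lia.
rewrite /zsum (bigD1 (Ordinal kN))//= big1 => [|k kk].
  by rewrite (_ : _ == t) ?addr0; [congr F|]; lia.
case: eqP => // E; exfalso; move/eqP: kk; apply; apply/val_inj => /=; lia.
Qed.

(** * Inversion at a point of absolute convergence *)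

Section inversion.
Context {R : realType}.
Local Notation C := R[i].
Local Notation TR := (measurableTypeR R : measurableType _).
Local Notation mu := (leb01 R : {measure set TR -> \bar R}).
Local Notation sq := (leb01sq R).
Local Notation leb := (@lebesgue_measure R).
Local Notation I := (`[0%R, (2 * pi)%R]%classic : set (measurableTypeR R)).
Variable r : int -> R -> R -> R.
Hypothesis rL2 : forall t, (fun x => r t x.1 x.2) \in Lfun sq 2%:E.

Let c : R := (2 * pi)^-1.

Let c_gt0 : 0 < c.
Proof. by rewrite /c invr_gt0 mulr_gt0// pi_gt0. Qed.

Definition summable_at u v :=
  (\sum_(0 <= j <oo) (Normc.normc (spectral_bound r j u v))%:E < +oo)%E.

Definition near_psums (g : R -> R -> R -> C) :=
  forall omega N m n u v, (N <= m)%N -> (N <= n)%N ->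
    ((Normc.normc (g omega u v - spectral_psum r omega m n u v))%:E <=
     \sum_(N <= j <oo) (Normc.normc (spectral_bound r j u v))%:E)%E.

Lemma psum_expi u v N (t : int) alpha :
  spectral_psum r alpha N N u v * expi (t%:~R * alpha) =
  \sum_(k < (N + N).+1) (c * r (k%:Z - N%:Z) u v)%:C *
     expi ((t - (k%:Z - N%:Z))%:~R * alpha).
Proof.
rewrite /spectral_psum /zsum mulr_sumr mulr_suml; apply: eq_bigr => k _.
set s := k%:Z - N%:Z.
have -> : (t - s)%:~R * alpha = - (alpha * s%:~R) + t%:~R * alpha.
  by rewrite intrB mulrBl [alpha * _]mulrC addrC.
rewrite expiD rmorphM /ckernel -!mulrA; congr (_ * _).
by rewrite mulrCA; congr (_ * _).
Qed.

(** Orthogonality of the characters leaves the term s = t, which the condition |t| <= N keeps inside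
    the sum; the factor 2 pi cancels [c]. *)
Lemma cint_psum_expi u v N (t : int) : (absz t <= N)%N ->
  cint leb I (fun alpha => spectral_psum r alpha N N u v * expi (t%:~R * alpha)) =
  ckernel (r t) u v.
Proof.
move=> tN; under [X in cint _ _ X]eq_fun do rewrite psum_expi.
rewrite cint_sum//; last by move=> k; apply: cintgZ => //; exact: cintg_expi.
transitivity (zsum N N (fun s => if s == t then ckernel (r s) u v else 0)); last first.
  exact: (zsum_delta (fun s => ckernel (r s) u v) tN).
rewrite /zsum; apply: eq_bigr => k _; set s := k%:Z - N%:Z.
rewrite cintZ//; last exact: cintg_expi.
rewrite cint_expi.
rewrite subr_eq0 eq_sym; case: ifPn => _; last by rewrite mulr0.
rewrite -rmorphM/= /ckernel /c mulrAC mulVf ?mul1r//.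
by rewrite gt_eqF// mulr_gt0// pi_gt0.
Qed.

Lemma cintg_psum_expi u v N (t : int) :
  cintg leb I (fun alpha => spectral_psum r alpha N N u v * expi (t%:~R * alpha)).
Proof.
under [X in cintg _ _ X]eq_fun do rewrite psum_expi.
by apply: cintg_sum => // k; apply: cintgZ => //; exact: cintg_expi.
Qed.

(** At a point of absolute convergence the partial sums tend to [g] uniformly in alpha over an
    interval of finite length, and from rank |t| on their integrals do not change. *)
Lemma inversion_at (g : R -> R -> R -> C) u v :
  near_psums g -> summable_at u v -> cmeas (fun alpha : TR => g alpha u v) ->
  (forall t : int, cintg leb I (fun alpha => g alpha u v * expi (t%:~R * alpha))) /\
  forall t : int, cint leb I (fun alpha => g alpha u v * expi (t%:~R * alpha)) =
    ckernel (r t) u v.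
Proof.
move=> gP uv mg.
pose b j := (Normc.normc (spectral_bound r j u v))%:E.
have b0 j : (0 <= b j)%E by rewrite lee_fin normc_ge0.
have mge t : cmeas (fun alpha : TR => g alpha u v * expi (t%:~R * alpha)).
  have mc : measurable_fun [set: TR] (fun x => cos (t%:~R * x)).
    by apply: continuous_measurable_fun; exact: continuous_cos_scale.
  have ms : measurable_fun [set: TR] (fun x => sin (t%:~R * x)).
    by apply: continuous_measurable_fun; exact: continuous_sin_scale.
  exact: cmeasM.
have Ioo : (leb I < +oo)%E by rewrite leb_2pi ltry.
have icst k : leb.-integrable I (fun=> k%:E).
  apply: (@continuous_compact_integrable _ (fun=> k)); first exact: segment_compact.
  by apply: continuous_subspaceT; exact: cst_continuous.
have bnd t : cintg leb I (fun alpha => g alpha u v * expi (t%:~R * alpha)).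
  have [mr mi] := mge t.
  apply: integrable_cintg => //; try exact: measurable_funTS.
  (* The bound of [near_psums] with N = m = n = 0: the whole series, plus the modulus of the sum of
     rank 0, whose only term is that of time 0. *)
  pose K := fine (\sum_(0 <= j <oo) b j) + c * `|r 0 u v|.
  apply: (@le_integrable _ _ _ _ _ _ _ (fun=> K%:E)) => //.
  - apply/measurable_EFinP; apply: measurable_funTS; exact: cmeas_normc.
  - move=> alpha _; rewrite !abse_EFin lee_fin ger0_norm ?normc_ge0//.
    apply: le_trans (ler_norm _).
    rewrite Normc.normcM normc_expi mulr1.
    rewrite -[g alpha u v](subrK (spectral_psum r alpha 0 0 u v)).
    apply: le_trans (le_normcD _ _) _; apply: lerD.
      rewrite -lee_fin fineK; first exact: gP.
      by rewrite ge0_fin_numE//; apply: nneseries_ge0.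
    rewrite /spectral_psum /zsum big_ord1 !Normc.normcM !normc_real normc_expi mul1r.
    by rewrite ger0_norm ?(ltW c_gt0).
split => // t; apply/eqP; rewrite -subr_eq0; apply/eqP/normc_le0_eq.
rewrite -lee_fin; apply: lee_eps => e e0; rewrite add0e.
have pi20 : 0 < 2 * pi :> R by rewrite mulr_gt0// pi_gt0.
(* The uniform error is integrated over an interval of length 2 pi. *)
have [M MP] := series_tail_small b0 uv (divr_gt0 e0 pi20).
pose N := maxn M (absz t).
rewrite -(@cint_psum_expi u v N t) ?leq_maxr// -cintB//; last exact: cintg_psum_expi.
rewrite lee_fin; apply: le_trans (normc_cint _ _) _ => //.
  by apply: cintgB => //; exact: cintg_psum_expi.
apply: (@le_trans _ _ (\int[leb]_(x in I) (e / (2 * pi)))).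
  apply: le_Rintegral => //.
  - by apply: cintg_normc => //; apply: cintgB => //; exact: cintg_psum_expi.
  - exact: icst.
  - move=> alpha _; rewrite -mulrBl Normc.normcM normc_expi mulr1 -lee_fin.
    by apply: le_trans (MP M (leqnn M)); apply: gP; exact: leq_maxl.
rewrite Rintegral_cst//.
rewrite [X in _ * X](_ : _ = 2 * pi); first by rewrite divfK// gt_eqF.
exact: (congr1 fine (@leb_2pi R)).
Qed.

End inversion.

Section ae_integrals.
Context {d : measure_display} {T : measurableType d} {R : realType}.
Variable mu : {measure set T -> \bar R}.

Lemma ge0_integral_eq0_ae (f : T -> \bar R) : measurable_fun setT f ->
  (forall x, 0 <= f x)%E -> (\int[mu]_x f x = 0)%E -> {ae mu, forall x, f x = 0%E}.
Proof.
move=> mf f0 If.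
have : (\int[mu]_x `|f x| = 0)%E by under eq_integral do rewrite gee0_abs//.
move=> /(ae_eq_integral_abs mu measurableT mf) H.
by apply: (aeS H) => x /(_ I).
Qed.

Lemma ae_eq_cint_in D (f g : T -> R[i]) : measurable D -> cmeas f -> cmeas g ->
  {ae mu, forall x, f x = g x} -> cint mu D f = cint mu D g.
Proof.
move=> mD [fr fi] [gr gi] fg; rewrite /cint /Rintegral; congr Complex; congr fine;
  apply: ae_eq_integral => //; do ?[apply: measurable_funTS; exact/measurable_EFinP];
  by apply: (aeS fg) => x fgx _; rewrite fgx.
Qed.

Lemma ae_integrable_normc D (f g : T -> R[i]) : measurable D -> cmeas f -> cmeas g ->
  {ae mu, forall x, f x = g x} ->
  mu.-integrable D (fun x => (Normc.normc (g x))%:E) ->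
  mu.-integrable D (fun x => (Normc.normc (f x))%:E).
Proof.
move=> mD mf mg fg /integrableP[mng gi]; apply/integrableP.
have mh (h : T -> R[i]) : cmeas h -> measurable_fun D (fun x => (Normc.normc (h x))%:E).
  by move=> mh; apply/measurable_EFinP; apply: measurable_funTS; exact: cmeas_normc.
split; first exact: mh.
rewrite (ae_eq_integral (fun x => `|(Normc.normc (g x))%:E|%E))//.
- by apply: measurableT_comp => //; exact: mh.
- by apply: measurableT_comp => //; exact: mh.
- by apply: (aeS fg) => x -> _.
Qed.

End ae_integrals.

Section inversion_theorem.
Context {R : realType}.
Local Notation C := R[i].
Local Notation TR := (measurableTypeR R : measurableType _).
Local Notation mu := (leb01 R : {measure set TR -> \bar R}).
Local Notation sq := (leb01sq R).
Local Notation leb := (@lebesgue_measure R).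
Local Notation I := (`[0%R, (2 * pi)%R]%classic : set (measurableTypeR R)).
Variable r : int -> R -> R -> R.
Hypothesis rL2 : forall t, (fun x => r t x.1 x.2) \in Lfun sq 2%:E.

Let c : R := (2 * pi)^-1.

Let c_gt0 : 0 < c.
Proof. by rewrite /c invr_gt0 mulr_gt0// pi_gt0. Qed.

Lemma knorm_bound_lty (p : \bar R) : p = 2%:E \/ p = +oo%E ->
  (\esum_(t in [set: int]) knorm p (ckernel (r t)) < +oo)%E ->
  (\sum_(0 <= j <oo) knorm p (spectral_bound r j) < +oo)%E.
Proof.
move=> Hp rp.
apply: (@le_lt_trans _ _ (\sum_(0 <= j <oo) ((2 * c)%:E *
    (knorm p (ckernel (r (Posz j))) + knorm p (ckernel (r (Negz j))))))%E).
  by apply: lee_nneseries => j _; [move=> _; exact: knorm_ge0|exact: knorm_spectral_bound].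
rewrite nneseriesZl => [|j _]; last by rewrite adde_ge0 ?knorm_ge0.
have E := esum_int (fun t => knorm_ge0 p (ckernel (r t))).
rewrite -E; by rewrite lte_mul_pinfty// lee_fin mulr_ge0// ltW.
Qed.

Lemma summable_at_y u v :
  (\esum_(t in [set: int]) knorm +oo (ckernel (r t)) < +oo)%E ->
  0 <= u <= 1 -> 0 <= v <= 1 -> summable_at r u v.
Proof.
move=> ry hu hv; apply: le_lt_trans (knorm_bound_lty (or_intror erefl) ry).
apply: lee_nneseries => j _; last exact: knormy_ge.
by move=> _; rewrite lee_fin normc_ge0.
Qed.

(** On a space of mass 1 the L^1 norm is at most the L^2 norm, so the series of moduli has finite
    integral, hence is finite almost everywhere. *)
Lemma summable_at_ae :
  (\esum_(t in [set: int]) knorm 2%:E (ckernel (r t)) < +oo)%E ->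
  {ae sq, forall x, summable_at r x.1 x.2}.
Proof.
move=> r2.
have mb j := spectral_bound_kmeas rL2 j.
pose b j (x : TR * TR) := (Normc.normc (spectral_bound r j x.1 x.2))%:E.
have mbE j : measurable_fun setT (b j).
  by apply/measurable_EFinP; apply: cmeas_normc; exact: mb.
have b0 j x : (0 <= b j x)%E by rewrite lee_fin normc_ge0.
have mB : measurable_fun setT (fun x => \sum_(0 <= j <oo) b j x)%E.
  by apply: ge0_emeasurable_sum => // j x _ _; exact: b0.
have B0 x : (0 <= \sum_(0 <= j <oo) b j x)%E by apply: nneseries_ge0 => *; exact: b0.
have IB : sq.-integrable setT (fun x => \sum_(0 <= j <oo) b j x)%E.
  apply/integrableP; split => //.
  under eq_integral do rewrite gee0_abs//.
  rewrite integral_nneseries//.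
  apply: le_lt_trans (knorm_bound_lty (or_introl erefl) r2).
  apply: lee_nneseries => j _; first by move=> _; apply: integral_ge0 => x _; exact: b0.
  have := @cauchy_schwarz _ _ _ sq (fun x => spectral_bound r j x.1 x.2) (fun=> 1)
    (mb j) (cmeas_cst _).
  under eq_integral do rewrite mulr1.
  move=> /le_trans; apply.
  rewrite (_ : cN sq (fun=> 1) = 1%E) ?mule1//.
  rewrite /cN (_ : _ \o _ = cst 1%E); last by apply/funext => x; rewrite /= Normc.normc1.
  by rewrite Lnorm_cst1 leb01sq_setT poweR1r.
have := integrable_ae measurableT IB => H; apply: (aeS H) => x /(_ Logic.I).
by rewrite ge0_fin_numE.
Qed.

Lemma cmeas_section (f : R -> R -> R -> C) u v : jointly_measurable f ->
  cmeas (fun alpha : TR => f alpha u v).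
Proof.
move=> mf.
apply: (cmeas_comp (phi := fun alpha => (alpha, (u, v))) (f := fun x => f x.1 x.2.1 x.2.2)) mf.
exact: pair2_measurable.
Qed.

(** The exceptional set of points depends on omega. Tonelli for |f - g| on the product of
    frequencies and points exchanges the quantifiers, as both iterated integrals vanish. *)
Lemma ae_section_eq (f g : R -> R -> R -> C) :
  jointly_measurable f -> jointly_measurable g ->
  (forall omega, knorm 2%:E (fun u v => f omega u v - g omega u v) = 0%E) ->
  {ae sq, forall x, {ae leb, forall alpha : TR, f alpha x.1 x.2 = g alpha x.1 x.2}}.
Proof.
move=> mf mg fg.
pose D (z : TR * (TR * TR)) :=
  (Normc.normc (f z.1 z.2.1 z.2.2 - g z.1 z.2.1 z.2.2))%:E.
have mfg : cmeas (fun z : TR * (TR * TR) => f z.1 z.2.1 z.2.2 - g z.1 z.2.1 z.2.2).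
  exact: cmeasB mf mg.
have mD : measurable_fun setT D by apply/measurable_EFinP; exact: cmeas_normc.
have D0 z : (0 <= D z)%E by rewrite lee_fin normc_ge0.
have T12 := @fubini_tonelli _ _ _ _ _ leb (finprod (leb01 R) (leb01 R)) D mD D0.
have F0 : (\int[leb]_alpha \int[sq]_x D (alpha, x) = 0)%E.
  apply: integral0_eq => alpha _.
  have mDa : cmeas (fun x : TR * TR => f alpha x.1 x.2 - g alpha x.1 x.2).
    exact: (cmeas_pair_snd alpha mfg).
  have Z := cN_eq0_ae mDa (fg alpha).
  rewrite (ae_eq_integral (cst 0%E)) ?integral0//.
  - by apply/measurable_EFinP; exact: (cmeas_normc mDa).
  - by apply: (aeS Z) => x Zx _; rewrite /D Zx Normc.normc0.
have G0 : (\int[sq]_x \int[leb]_alpha D (alpha, x) = 0)%E.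
  by rewrite -F0; exact: esym T12.
have mG : measurable_fun setT (fun x : TR * TR => \int[leb]_alpha D (alpha, x))%E.
  exact: (@measurable_integral_fst _ _ _ _ _ leb D mD).
have Gge x : (0 <= \int[leb]_alpha D (alpha, x))%E by apply: integral_ge0.
have Z := ge0_integral_eq0_ae mG Gge G0.
apply: (aeS Z) => x Zx.
have mDx : measurable_fun setT (fun alpha : TR => D (alpha, x)).
  exact: (measurableT_comp mD (pair2_measurable x)).
have Zx' := ge0_integral_eq0_ae mDx (fun alpha => D0 (alpha, x)) Zx.
apply: (aeS Zx') => alpha [/Normc.eq0_normc/eqP].
by rewrite subr_eq0 => /eqP.
Qed.

Lemma cmeas_expi (t : int) : cmeas (fun alpha : TR => expi (t%:~R * alpha) : C).
Proof.
have mc : measurable_fun [set: TR] (fun x => cos (t%:~R * x)).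
  by apply: continuous_measurable_fun; exact: continuous_cos_scale.
have ms : measurable_fun [set: TR] (fun x => sin (t%:~R * x)).
  by apply: continuous_measurable_fun; exact: continuous_sin_scale.
by split.
Qed.

(** Moves the integration domain into the integrand, since measurability of partial integrals is
    stated over the whole space. *)
Lemma cint_indic (F : TR -> C) :
  cint leb I F = cint leb setT (fun alpha => (\1_I alpha)%:C * F alpha).
Proof.
rewrite /cint /=; congr Complex; rewrite Rintegral_mkcond; apply: eq_Rintegral => x _;
  by rewrite patchE indicE cReE /=; case: ifPn => _; rewrite ?mul1r ?mul0r ?subr0 ?addr0.
Qed.

Lemma cmeas_cint_section (f : R -> R -> R -> C) (t : int) : jointly_measurable f ->
  kmeas (fun u v => cint leb I (fun alpha => f alpha u v * expi (t%:~R * alpha))).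
Proof.
move=> mf; under eq_fun do under eq_fun do rewrite cint_indic.
have m1 : cmeas (fun alpha : TR => (\1_I alpha)%:C : C).
  by apply: cmeas_real; exact: measurable_indic.
pose F (z : TR * (TR * TR)) : C := (\1_I z.1)%:C * (f z.1 z.2.1 z.2.2 * expi (t%:~R * z.1)).
have [mr mi] : cmeas F.
  apply: cmeasM; first exact: (cmeas_comp measurable_fst m1).
  apply: cmeasM; first exact: mf.
  exact: (cmeas_comp measurable_fst (cmeas_expi t)).
move/measurable_EFinP in mr; move/measurable_EFinP in mi.
split; apply: measurableT_comp => //.
  exact: (@measurable_integral_fst _ _ _ _ _ leb _ mr).
exact: (@measurable_integral_fst _ _ _ _ _ leb _ mi).
Qed.

(** The constructed [g] satisfies the formula at every point of absolute convergence, and uniqueness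
    of the limit at each frequency transports it to [f]. *)
Lemma inversion_formula_holds (p : \bar R) (f : R -> R -> R -> C) :
  p = 2%:E \/ p = +oo%E ->
  (\esum_(t in [set: int]) knorm p (ckernel (r t)) < +oo)%E ->
  (forall omega, spectral_density_kernel p r omega (f omega)) ->
  jointly_measurable f -> inversion_formula p r f.
Proof.
move=> Hp rp fD mf.
have [g [mg gD gP]] := spectral_density_exists rL2 Hp rp.
have fg omega := spectral_density_unique rL2 Hp (fD omega) (gD omega).
have r2 : (\esum_(t in [set: int]) knorm 2%:E (ckernel (r t)) < +oo)%E.
  by case: Hp rp => -> //; exact: summable_knorm_le2y.
have fg2 omega : knorm 2%:E (fun u v => f omega u v - g omega u v) = 0%E.
  move: (fg omega); case: Hp => -> // fgy.
  apply/eqP; rewrite eq_le knorm_ge0 andbT -fgy; apply: knorm_le2y.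
  by apply: kmeasB; apply: kL2_meas; [exact: (fD omega).1|exact: (gD omega).1].
have H1 := summable_at_ae r2; have H2 := ae_section_eq mf mg fg2.
have nint u v : (forall t, cintg leb I (fun alpha => g alpha u v * expi (t%:~R * alpha))) ->
    leb.-integrable I (fun alpha => (Normc.normc (g alpha u v))%:E).
  have mI : measurable I by exact: measurable_itv.
  move=> /(_ 0) H; have := cintg_normc mI H; apply: eq_integrable => // alpha _.
  by rewrite (_ : 0%:~R * alpha = 0) ?mul0r// expi0 mulr1.
split.
  apply: (aeS2 H1 H2) => x x1 x2.
  have [gi _] := inversion_at gP x1 (cmeas_section x.1 x.2 mg).
  apply: (ae_integrable_normc _ _ _ x2) => //; try exact: cmeas_section.
  exact: nint.
(* For p = 2, almost every point is one of absolute convergence at which f and g agree for almost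
   every alpha. *)
move=> t; move: rp fg; case: Hp => -> rp' fg.
  rewrite knorm2E -(cN0 sq); apply: cN_ae.
  - exact: (cmeasB (cmeas_cint_section t mf) (kL2_meas (ckernel_kL2 rL2 t))).
  - exact: cmeas_cst.
  apply: (aeS2 H1 H2) => x x1 x2.
  have [_ gE] := inversion_at gP x1 (cmeas_section x.1 x.2 mg).
  rewrite -(gE t); apply/eqP; rewrite subr_eq0; apply/eqP.
  apply: ae_eq_cint_in => //.
  - by apply: cmeasM; [exact: cmeas_section|exact: cmeas_expi].
  - by apply: cmeasM; [exact: cmeas_section|exact: cmeas_expi].
  - by apply: (aeS x2) => alpha ->.
(* For p = oo, a null norm of f - g means equality at every point of the square and every frequency,
   so the formula holds pointwise. *)
apply/eqP; rewrite eq_le knorm_ge0 andbT; apply: knormy_le => u v hu hv.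
have uv := summable_at_y rp' hu hv.
have [_ gE] := inversion_at gP uv (cmeas_section u v mg).
rewrite (_ : cint _ _ _ = ckernel (r t) u v) ?subrr ?Normc.normc0//.
rewrite -(gE t); apply: eq_cint => alpha _; congr (_ * _).
apply/eqP; rewrite -subr_eq0; apply/eqP/normc_le0_eq.
by have := knormy_ge (fun u v => f alpha u v - g alpha u v) hu hv; rewrite fg lee_fin.
Qed.

End inversion_theorem.

(** * Second moments of the process *)

Lemma cN_real {d : measure_display} {T : measurableType d} {R : realType}
    (mu : {measure set T -> \bar R}) (g : T -> R) :
  cN mu (fun x => (g x)%:C) = 'N[mu]_2%:E[EFin \o g]%E.
Proof.
rewrite -Lnorm_abse /cN; congr Lnorm; apply/funext => x.
by rewrite /comp normc_real.
Qed.

Section same_law.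
Context {d : measure_display} {T : measurableType d} {R : realType}.
Variable P : {measure set T -> \bar R}.

Lemma same_law_ge0 (Z1 Z2 : T -> R) (f : R -> \bar R) :
  measurable_fun setT Z1 -> measurable_fun setT Z2 ->
  (forall B : set R, measurable B -> P (Z1 @^-1` B) = P (Z2 @^-1` B)) ->
  measurable_fun setT f -> (forall y, 0 <= f y)%E ->
  (\int[P]_x f (Z1 x) = \int[P]_x f (Z2 x))%E.
Proof.
move=> m1 m2 law mf f0.
have H (Z : T -> R) : measurable_fun setT Z ->
    (\int[P]_x f (Z x) = \int[pushforward P Z]_y f y)%E.
  by move=> mZ; rewrite (ge0_integral_pushforward mZ)// => y _; exact: f0.
rewrite H// H//; apply: eq_measure_integral => //= A mA _.
exact: law.
Qed.

(** Positive and negative parts are transferred separately, which covers every measurable function,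
    integrable or not. *)
Lemma same_law_integral (Z1 Z2 : T -> R) :
  measurable_fun setT Z1 -> measurable_fun setT Z2 ->
  (forall B : set R, measurable B -> P (Z1 @^-1` B) = P (Z2 @^-1` B)) ->
  \int[P]_x Z1 x = \int[P]_x Z2 x.
Proof.
move=> m1 m2 law; rewrite /Rintegral integralE [in RHS]integralE.
have mE : measurable_fun setT (@EFin R) by exact: EFin_measurable.
have Hp := same_law_ge0 m1 m2 law (measurable_funepos mE) (funepos_ge0 _).
have Hn := same_law_ge0 m1 m2 law (measurable_funeneg mE) (funeneg_ge0 _).
have Ep (Z : T -> R) : ((fun x => (Z x)%:E)^\+ = (@EFin R)^\+ \o Z)%E.
  exact: (funepos_comp (@EFin R) Z).
have En (Z : T -> R) : ((fun x => (Z x)%:E)^\- = (@EFin R)^\- \o Z)%E.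
  exact: (funeneg_comp (@EFin R) Z).
by rewrite !Ep !En; congr (fine (_ - _)).
Qed.

End same_law.

(** * Measurable functionals on L^2 *)

Section L2_functionals.
Context {R : realType}.
Local Notation C := R[i].
Local Notation TR := (measurableTypeR R : measurableType _).
Local Notation mu := (leb01 R : {measure set TR -> \bar R}).
Implicit Types x y : L2 R.

Lemma L2fun_meas x : measurable_fun [set: TR] (L2fun x).
Proof.
have mx : measurable_fun setT (L2fun x : measurableTypeR R -> measurableTypeR R).
  by [].
exact: mx.
Qed.

Lemma L2fun_Lfun x : L2fun x \in Lfun mu 2%:E.
Proof.
rewrite inE; apply/andP; split; rewrite inE; first exact: L2fun_meas.
exact: (@Lebesgue_finite _ _ _ _ _ _ (x : LspaceType2 (leb01 R))).
Qed.

Lemma L2fun_cLfun2 x : cLfun2 mu (fun s => (L2fun x s)%:C).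
Proof. exact: cLfun2_real (L2fun_Lfun x). Qed.

Lemma L2normE x : L2norm x = cN mu (fun s => (L2fun x s)%:C).
Proof. by rewrite cN_real. Qed.

Lemma L2distE x y : L2dist x y = cN mu (fun s => (L2fun x s)%:C - (L2fun y s)%:C).
Proof.
rewrite (_ : (fun s => _) = (fun s => (L2fun x s - L2fun y s)%:C)) ?cN_real//.
by apply/funext => s; rewrite rmorphB.
Qed.

Lemma L2dist_fin x y : L2dist x y \is a fin_num.
Proof.
by rewrite L2distE; apply: cLfun2_fin; apply: cLfun2B; exact: L2fun_cLfun2.
Qed.

(** The preimage of an open ray under a Lipschitz functional is open for [L2dist], hence one of the
    generators of [L2borel], and such rays generate the Borel sets of R. *)
Lemma lipschitz_measurable (psi : L2 R -> R) (K : R) : 0 <= K ->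
  (forall x y, ((`|psi x - psi y|)%:E <= L2dist x y * K%:E)%E) ->
  measurable_fun [set: @L2borel R] psi.
Proof.
move=> K0 lip; apply: (@measurability _ _ (@L2borel R) _ setT psi _ (RGenOInfty.measurableE R)).
move=> _ [_ [c ->] <-]; rewrite setTI; apply: sub_sigma_algebra.
move=> x /=; rewrite in_itv/= andbT => cx.
have K10 : 0 < K + 1 by rewrite ltr_wpDl.
(* The [+ 1] keeps the radius positive when K = 0. *)
exists ((psi x - c) / (K + 1)); first by rewrite divr_gt0// subr_gt0.
move=> y; rewrite in_itv/= andbT => dyx.
have := lip y x; have /fineK <- := L2dist_fin y x.
move: dyx; have /fineK <- := L2dist_fin y x.
rewrite lte_fin -EFinM lee_fin => dlt ple.
have d0 : 0 <= fine (L2dist y x) by rewrite fine_ge0// L2distE cN_ge0.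
rewrite -subr_gt0.
have : psi x - psi y < psi x - c; last by lra.
apply: le_lt_trans (ler_norm _) _; rewrite distrC; apply: le_lt_trans ple _.
apply: (@le_lt_trans _ _ (fine (L2dist y x) * (K + 1))).
  by rewrite ler_wpM2l// lerDl.
by rewrite -ltr_pdivlMr.
Qed.

Lemma L2norm_measurable : measurable_fun [set: @L2borel R] (fun x => fine (L2norm x)).
Proof.
apply: (@lipschitz_measurable _ 1) => // x y; rewrite mule1.
have xL := L2fun_cLfun2 x; have yL := L2fun_cLfun2 y.
have mx := ((cLfun2P _ _).1 xL).1; have my := ((cLfun2P _ _).1 yL).1.
have H a b : cLfun2 mu a -> cLfun2 mu b ->
    ((fine (cN mu a) - fine (cN mu b))%:E <= cN mu (fun s => a s - b s)%R)%E.
  move=> aL bL; have ma := ((cLfun2P _ _).1 aL).1; have mb := ((cLfun2P _ _).1 bL).1.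
  have dL := cLfun2B aL bL.
  rewrite -(fineK (cLfun2_fin dL)) lee_fin lerBlDr -lee_fin EFinD !fineK ?cLfun2_fin//.
  rewrite (_ : cN mu a = cN mu (fun s => (a s - b s) + b s)); last first.
    by apply: eq_cN => s; rewrite subrK.
  by apply: cND => //; exact: cmeasB.
rewrite !L2normE L2distE; case: ger0P => _; first exact: H.
by rewrite opprB cNBC; exact: H.
Qed.

Definition L2pair (u : R -> C) x : C := cint mu setT (fun s => (L2fun x s)%:C * u s).

(** Cauchy-Schwarz makes both parts of the functional Lipschitz, with constant the norm of [u]. *)
Lemma L2pair_cmeas u : cLfun2 mu u -> cmeas (L2pair u : @L2borel R -> C).
Proof.
move=> uL; have uK := fineK (cLfun2_fin uL).
have K0 : 0 <= fine (cN mu u) by rewrite fine_ge0// cN_ge0.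
have H x y : ((Normc.normc (L2pair u x - L2pair u y))%:E <=
    L2dist x y * (fine (cN mu u))%:E)%E.
  have xL := L2fun_cLfun2 x; have yL := L2fun_cLfun2 y.
  rewrite uK L2distE; apply: le_trans (normc_cintM2 (cLfun2B xL yL) uL).
  rewrite lee_fin /L2pair -cintB//; try exact: cintgM2.
  by under [X in _ <= Normc.normc (cint _ _ X)]eq_fun do rewrite mulrBl.
split; apply: (lipschitz_measurable K0) => x y; apply: le_trans (H x y);
  rewrite lee_fin -?ReN -?ImN -?ReD -?ImD; [exact: ler_Re_normc|exact: ler_Im_normc].
Qed.

End L2_functionals.

(** * Covariance of the centred process *)

Section covariance.
Context {R : realType} {d : measure_display} {Om : measurableType d}
  {P : probability Om R}.
Local Notation C := R[i].
Local Notation TR := (measurableTypeR R : measurableType _).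
Local Notation mu := (leb01 R : {measure set TR -> \bar R}).
Local Notation sq := (leb01sq R).
Local Notation PP := (P : {measure set Om -> \bar R}).
Variable X : int -> {RV P >-> @L2borel R}.
Hypothesis X_stationary : strictly_stationary X.
Hypothesis X_L2 : (\int[P]_w (L2norm (X 0%Z w) ^+ 2) < +oo)%E.
Variable Y : int -> Om -> R -> R.
Hypothesis XY : forall t, measurable_version (X t) (Y t).

Let X_meas t : measurable_fun [set: Om] (X t : Om -> @L2borel R).
Proof. exact: measurable_funPT. Qed.

Lemma stationary_law1 (psi : L2 R -> R) (t : int) :
  measurable_fun [set: @L2borel R] psi ->
  forall B : set R, measurable B ->
    P ((psi \o X t) @^-1` B) = P ((psi \o X 0) @^-1` B).
Proof.
move=> mpsi B mB.
pose A : set (1.-tuple (@L2borel R)) := [set z | B (psi (tnth z ord0))].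
have mA : measurable A.
  have := measurableT_comp mpsi (@measurable_tnth _ (@L2borel R) 1 ord0).
  by move=> /(_ measurableT B mB); rewrite setTI.
have := X_stationary [tuple 0%R] t mA.
rewrite /A /=; under eq_set do rewrite tnth_mktuple.
under [in X in _ = X -> _]eq_set do rewrite tnth_mktuple.
by rewrite (tnth_nth 0) /= add0r.
Qed.

(** Stationarity for the pair of times (t, 0), shifted by s. Measurability is required on 2-tuples
    because the joint law lives on that product sigma-algebra. *)
Lemma stationary_law2 (psi : L2 R -> L2 R -> R) (t s : int) :
  measurable_fun [set: 2.-tuple (@L2borel R)]
    (fun z => psi (tnth z ord0) (tnth z ord_max)) ->
  forall B : set R, measurable B ->
    P ((fun w => psi (X (t + s) w) (X s w)) @^-1` B) =
    P ((fun w => psi (X t w) (X 0 w)) @^-1` B).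
Proof.
move=> mpsi B mB.
pose A : set (2.-tuple (@L2borel R)) := [set z | B (psi (tnth z ord0) (tnth z ord_max))].
have mA : measurable A by move: (mpsi measurableT B mB); rewrite setTI.
have := X_stationary [tuple t; 0%R] s mA.
rewrite /A /=; under eq_set do rewrite !tnth_mktuple.
under [in X in _ = X -> _]eq_set do rewrite !tnth_mktuple.
by rewrite !(tnth_nth 0) /= add0r.
Qed.

Let Z t w a := Y t w a - mean_fun (P := P) Y a.

Let Ymeas t : measurable_fun [set: Om * TR] (fun x => Y t x.1 x.2).
Proof. exact: (XY t).1. Qed.

Let cmeas_Yw t w : cmeas (fun a : TR => (Y t w a)%:C : C).
Proof. by apply: cmeas_real; exact: (measurableT_comp (Ymeas t) (pair1_measurable w)). Qed.

Let cmeas_Xw t w : cmeas (fun a : TR => (L2fun (X t w) a)%:C : C).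
Proof. by apply: cmeas_real; exact: L2fun_meas. Qed.

Let Yw t w : {ae mu, forall a, Y t w a = L2fun (X t w) a}.
Proof. by apply: (aeS ((XY t).2 w)) => a /(_ I). Qed.

Let Yw_norm t w : cN mu (fun a => (Y t w a)%:C) = L2norm (X t w).
Proof.
by rewrite L2normE; apply: (cN_ae (cmeas_Yw t w) (cmeas_Xw t w)); apply: (aeS (Yw t w)) => a ->.
Qed.

Lemma L2norm_second_moment t : (\int[P]_w (L2norm (X t w) ^+ 2) < +oo)%E.
Proof.
apply: le_lt_trans X_L2.
have H s : (\int[P]_w (L2norm (X s w) ^+ 2) =
    \int[P]_w (((fun x => fine (L2norm x)) \o X s) w ^+ 2)%:E)%E.
  apply: eq_integral => w _ /=.
  by rewrite EFin_expe fineK// L2normE; apply: cLfun2_fin; exact: L2fun_cLfun2.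
rewrite !H (same_law_ge0 (Z1 := (fun x => fine (L2norm x)) \o X t)
  (Z2 := (fun x => fine (L2norm x)) \o X 0) (f := fun y => (y ^+ 2)%:E))//.
- by apply: measurableT_comp; [exact: L2norm_measurable|exact: X_meas].
- by apply: measurableT_comp; [exact: L2norm_measurable|exact: X_meas].
- by apply: stationary_law1; exact: L2norm_measurable.
- by apply/measurable_EFinP; exact: measurable_funX.
- by move=> y; rewrite lee_fin sqr_ge0.
Qed.

(** By Tonelli the squared norm over Om x [0, 1] is the second moment of the norm of X_t, finite for
    all t by stationarity. *)
Lemma version_cLfun2 t : cLfun2 (P \x leb01 R)%E (fun x : Om * TR => (Y t x.1 x.2)%:C : C).
Proof.
apply/cLfun2P; split; first by apply: cmeas_real; exact: Ymeas.
rewrite cN_sqrt; apply: poweR_lty.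
rewrite fubini_tonelli1//; last 2 first.
- apply/measurable_EFinP; apply: measurable_funX; apply: cmeas_normc.
  by apply: cmeas_real; exact: Ymeas.
- by move=> x; rewrite lee_fin sqr_ge0.
apply: le_lt_trans (L2norm_second_moment t); rewrite le_eqVlt; apply/orP; left; apply/eqP.
apply: eq_integral => w _; rewrite /fubini_F/=.
by rewrite -Yw_norm cN_sqr.
Qed.

Lemma mean_fun_meas : measurable_fun [set: TR] (mean_fun (P := P) Y).
Proof.
rewrite /mean_fun; apply: measurableT_comp => //.
have mE : measurable_fun setT (fun x : Om * TR => (Y 0 x.1 x.2)%:E).
  by apply/measurable_EFinP; exact: Ymeas.
have := measurable_integral_fst P mE.
by rewrite unlock.
Qed.

(** Jensen's inequality, as Cauchy-Schwarz against the constant 1 on a probability space; where the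
    second moment is infinite there is nothing to prove. *)
Lemma mean_fun_sqr a :
  ((mean_fun (P := P) Y a ^+ 2)%:E <= \int[P]_w (Y 0 w a ^+ 2)%:E)%E.
Proof.
have mYa : measurable_fun setT (fun w => Y 0 w a).
  exact: (measurableT_comp (Ymeas 0) (pair2_measurable a)).
have cYa : cmeas (fun w => (Y 0 w a)%:C : C) by exact: cmeas_real.
have E2 : (\int[P]_w (Y 0 w a ^+ 2)%:E =
    cN PP (fun w => (Y 0 w a)%:C) * cN PP (fun w => (Y 0 w a)%:C))%E.
  rewrite cN_sqr; apply: eq_integral => w _.
  by rewrite normc_real real_normK ?num_real.
have [foo|] := ltP (cN PP (fun w => (Y 0 w a)%:C)) +oo%E; last first.
  by rewrite leye_eq => /eqP Eoo; rewrite E2 Eoo mulyy leey.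
have YL : cLfun2 PP (fun w => (Y 0 w a)%:C) by apply/cLfun2P.
have := normc_cintM2 YL (cLfun2_cst1 P).
have -> : cN PP (fun=> 1) = 1%E.
  rewrite /cN (_ : _ \o _ = cst 1%E); last by apply/funext => x; rewrite /= Normc.normc1.
  by rewrite Lnorm_cst1 [X in (X `^ _)%E](probability_setT P) poweR1r.
have -> : cint PP setT (fun w => (Y 0 w a)%:C * 1) = (mean_fun (P := P) Y a)%:C.
  rewrite /mean_fun unlock; apply: complexP => /=.
    by congr fine; apply: eq_integral => w _; rewrite mulr1 mul0r subr0.
  by rewrite /Rintegral integral0_eq// => w _; rewrite mulr0 mul0r addr0.
rewrite mule1 normc_real E2 => H.
rewrite -(real_normK (num_real _)) expr2 EFinM.
by apply: lee_pmul.
Qed.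

Lemma mean_fun_cLfun2 : cLfun2 mu (fun a => (mean_fun (P := P) Y a)%:C).
Proof.
have [_ Yoo] := (cLfun2P _ _).1 (version_cLfun2 0).
apply/cLfun2P; split; first by apply: cmeas_real; exact: mean_fun_meas.
apply: le_lt_trans Yoo; apply: mule_self_le; [exact: cN_ge0|exact: cN_ge0|].
rewrite !cN_sqr fubini_tonelli2//; last 2 first.
- apply/measurable_EFinP; apply: measurable_funX; apply: cmeas_normc.
  by apply: cmeas_real; exact: Ymeas.
- by move=> x; rewrite lee_fin sqr_ge0.
apply: ge0_le_integral => //.
- by move=> a _; rewrite lee_fin sqr_ge0.
- apply/measurable_EFinP; apply: measurable_funX; apply: cmeas_normc.
  by apply: cmeas_real; exact: mean_fun_meas.
- apply: (measurable_integral_fst P (f := fun x => (Normc.normc (Y 0 x.1 x.2)%:C ^+ 2)%:E)).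
  apply/measurable_EFinP; apply: measurable_funX; apply: cmeas_normc.
  by apply: cmeas_real; exact: Ymeas.
- move=> a _; rewrite normc_real real_normK ?num_real//.
  apply: le_trans (mean_fun_sqr a) _; rewrite le_eqVlt; apply/orP; left; apply/eqP.
  apply: eq_integral => w _ /=.
  by rewrite normc_real real_normK ?num_real.
Qed.

Lemma centered_cLfun2 t : cLfun2 (P \x leb01 R)%E (fun x : Om * TR => (Z t x.1 x.2)%:C : C).
Proof.
rewrite (_ : (fun x => _) = (fun x : Om * TR => (Y t x.1 x.2)%:C - 1 * (mean_fun (P := P) Y x.2)%:C)).
  apply: cLfun2B; first exact: version_cLfun2.
  exact: (cLfun2_tensor (cLfun2_cst1 P) mean_fun_cLfun2).
by apply/funext => x; rewrite mul1r -rmorphB.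
Qed.

(** The centred process is paired with [u] without conjugation; [zeta_conj] moves the conjugate of a
    test function outside. *)
Definition zeta t (u : R -> C) w : C := cint mu setT (fun a => (Z t w a)%:C * u a).

Lemma zeta_cLfun2 t u : cLfun2 mu u -> cLfun2 PP (zeta t u).
Proof. exact: (cLfun2_cint_mul (centered_cLfun2 t)). Qed.

Let Yw_cLfun2 t w : cLfun2 mu (fun a => (Y t w a)%:C).
Proof.
apply/cLfun2P; split; first exact: cmeas_Yw.
by rewrite Yw_norm L2normE; have [] := (cLfun2P _ _).1 (L2fun_cLfun2 (X t w)).
Qed.

(** Passes from the version [Y] to the class [X t w], on which stationarity bears; the mean
    contributes a constant free of t and w. *)
Lemma zetaE t u w : cLfun2 mu u ->
  zeta t u w = L2pair u (X t w) - cint mu setT (fun a => (mean_fun (P := P) Y a)%:C * u a).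
Proof.
move=> uL; have [mu_ _] := (cLfun2P _ _).1 uL.
rewrite /zeta /Z; transitivity (cint mu setT (fun a => (Y t w a)%:C * u a -
    (mean_fun (P := P) Y a)%:C * u a)).
  by apply: eq_cint => a _; rewrite rmorphB mulrBl.
rewrite cintB//; [|exact: cintgM2 (Yw_cLfun2 t w) uL|exact: cintgM2 mean_fun_cLfun2 uL].
congr (_ - _); apply: ae_eq_cint; [exact: cmeasM (cmeas_Yw t w) mu_|exact: cmeasM (cmeas_Xw t w) mu_|].
by apply: (aeS (Yw t w)) => a ->.
Qed.

Lemma zeta_conj t u w : cLfun2 mu u -> zeta t (fun a => (u a)^*) w = (zeta t u w)^*.
Proof.
move=> uL.
have ZL : cLfun2 mu (fun a => (Z t w a)%:C).
  rewrite (_ : (fun a => _) = (fun a => (Y t w a)%:C - (mean_fun (P := P) Y a)%:C)).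
    exact: cLfun2B (Yw_cLfun2 t w) mean_fun_cLfun2.
  by apply/funext => a; rewrite -rmorphB.
rewrite /zeta -cint_conj//; last exact: cintgM2.
by apply: eq_cint => a _; rewrite rmorphM; congr (_ * _); apply: complexP; rewrite ?cReE //= oppr0.
Qed.

(** By [zetaE] both products are one measurable function [psi] of a pair of values of [X], and the
    two pairs have the same law. *)
Lemma zeta_stationary t s u v : cLfun2 mu u -> cLfun2 mu v ->
  cint PP setT (fun w => zeta (t + s) u w * zeta s v w) =
  cint PP setT (fun w => zeta t u w * zeta 0 v w).
Proof.
move=> uL vL.
pose psi x y := (L2pair u x - cint mu setT (fun a => (mean_fun (P := P) Y a)%:C * u a)) *
  (L2pair v y - cint mu setT (fun a => (mean_fun (P := P) Y a)%:C * v a)).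
have E t1 t2 w : zeta t1 u w * zeta t2 v w = psi (X t1 w) (X t2 w).
  by rewrite !zetaE.
under [X in cint _ _ X]eq_fun do rewrite E.
under [X in _ = cint _ _ X]eq_fun do rewrite E.
have mpsi : cmeas (fun z : 2.-tuple (@L2borel R) => psi (tnth z ord0) (tnth z ord_max)).
  by apply: cmeasM; apply: cmeasB; do ?[exact: cmeas_cst];
    apply: cmeas_comp; do ?[exact: measurable_tnth]; exact: L2pair_cmeas.
have mX t1 t2 : cmeas (fun w => psi (X t1 w) (X t2 w)).
  by apply: cmeasM; apply: cmeasB; do ?[exact: cmeas_cst];
    apply: cmeas_comp; do ?[exact: X_meas]; exact: L2pair_cmeas.
apply: complexP => /=; apply: same_law_integral.
- exact: (mX _ _).1.
- exact: (mX _ _).1.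
- exact: (stationary_law2 (psi := fun x y => complex.Re (psi x y)) t s mpsi.1).
- exact: (mX _ _).2.
- exact: (mX _ _).2.
- exact: (stationary_law2 (psi := fun x y => complex.Im (psi x y)) t s mpsi.2).
Qed.

Lemma autocov_cint t a b :
  (autocov (P := P) Y t a b)%:C = cint PP setT (fun w => (Z t w a)%:C * (Z 0 w b)%:C).
Proof.
apply: complexP => /=.
  rewrite /autocov unlock; congr fine; apply: eq_integral => w _.
  by rewrite /= mul0r subr0.
by rewrite /Rintegral integral0_eq// => w _; rewrite mulr0 mul0r addr0.
Qed.

Lemma qform_covariance (r : int -> R -> R -> R) t s h g :
  (forall t, (fun x => r t x.1 x.2) \in Lfun sq 2%:E) ->
  (forall t, ae_eq sq setT (fun x => r t x.1 x.2) (fun x => autocov (P := P) Y t x.1 x.2)) ->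
  cLfun2 mu h -> cLfun2 mu g ->
  qform (ckernel (r t)) h g =
    cint PP setT (fun w => (zeta (t + s) g w)^* * zeta s h w).
Proof.
move=> rL rY hL gL; have cgL := cLfun2_conj gL.
transitivity (cint PP setT (fun w => zeta (t + s) (fun a => (g a)^*) w * zeta s h w)); last first.
  by apply: eq_cint => w _; rewrite zeta_conj.
(* [autocov] is taken at the times t and 0, so the base time s is moved to 0. *)
rewrite zeta_stationary//.
rewrite (cint_cov_product (centered_cLfun2 t) (centered_cLfun2 0) cgL hL).
have := cint_cov_product (centered_cLfun2 t) (centered_cLfun2 0) cgL hL.
have Gi := cintg_cov_product (centered_cLfun2 t) (centered_cLfun2 0) cgL hL.
(* Constant test functions give the measurability of the covariance as a function on the square. *)
have G1 := cintg_cov_product (centered_cLfun2 t) (centered_cLfun2 0)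
  (cLfun2_cst1 (leb01 R)) (cLfun2_cst1 (leb01 R)).
move=> _; have [mh _] := (cLfun2P _ _).1 hL; have [mg _] := (cLfun2P _ _).1 cgL.
have mt : cmeas (fun x : TR * TR => (g x.1)^* * h x.2).
  by apply: cmeasM; [exact: cmeas_comp measurable_fst mg|exact: cmeas_comp measurable_snd mh].
apply: ae_eq_cint.
- by apply: cmeasM => //; exact: kL2_meas (ckernel_kL2 rL t).
- apply: cmeasM => //.
  have mG1 := cmeas_cint_fst P (cintg_cmeas G1).
  move: mG1; congr cmeas; apply/funext => x; apply: eq_cint => w _.
  by rewrite !mulr1.
apply: (aeS (rY t)) => x /(_ I) rx.
by rewrite /ckernel rx autocov_cint.
Qed.

End covariance.

(** * Self-adjointness and positivity *)

Lemma conjcM (R : realType) (z w : R[i]) : (z * w : R[i])^* = z^* * w^*.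
Proof. exact: rmorphM. Qed.

Lemma conjcB (R : realType) (z w : R[i]) : (z - w : R[i])^* = z^* - w^*.
Proof. exact: rmorphB. Qed.

Lemma conjc_expi_mul (R : realType) (x : R) (z : R[i]) :
  (expi x * z : R[i])^* = expi (- x) * z^*.
Proof.
transitivity ((expi x : R[i])^* * z^*); first exact: conjcM.
by congr (_ * _); exact: expi_conj.
Qed.

Lemma zsum_opp (V : nmodType) (N : nat) (F : int -> V) :
  zsum N N (fun t => F (- t)) = zsum N N F.
Proof.
rewrite /zsum (reindex_inj rev_ord_inj)/=; apply: eq_bigr => k _; congr F.
by have := ltn_ord k; lia.
Qed.

Lemma conjc_scale_zsum (R : realType) (a : R) N (F : int -> R[i]) :
  (a%:C * zsum N N F : R[i])^* = a%:C * zsum N N (fun t => (F (- t))^*).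
Proof.
have E : (zsum N N F : R[i])^* = zsum N N (fun t => (F t)^*).
  by rewrite /zsum; exact: raddf_sum.
transitivity (a%:C * (zsum N N F : R[i])^*); last first.
  congr (_ * _); transitivity (zsum N N (fun t => (F t)^*)); first exact: E.
  by rewrite -(zsum_opp N).
by rewrite conjcM; congr (_ * _); exact: conjc_real.
Qed.

(** For fixed j the lag i - j runs from -j to N-1-j: the Fejer sum is a sum of lopsided partial
    sums, whose two bounds add up to N-1. *)
Lemma cesaro_zsum (V : nmodType) (N : nat) (a : int -> V) :
  \sum_(j < N) \sum_(i < N) a (i%:Z - j%:Z) = \sum_(j < N) zsum j (N.-1 - j) a.
Proof.
apply: eq_bigr => j _; have jN := ltn_ord j.
have E : N = (j + (N.-1 - j)).+1 by lia.
by rewrite /zsum -!(big_mkord xpredT (fun k => a (k%:Z - j%:Z))) -E.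
Qed.

Section positivity.
Context {R : realType} {d : measure_display} {Om : measurableType d}.
Local Notation C := R[i].
Local Notation TR := (measurableTypeR R : measurableType _).
Local Notation mu := (leb01 R : {measure set TR -> \bar R}).
Local Notation sq := (leb01sq R).
Variable P : {measure set Om -> \bar R}.
Variable r : int -> R -> R -> R.
Hypothesis rL2 : forall t, (fun x => r t x.1 x.2) \in Lfun sq 2%:E.
Variable zeta : int -> (R -> C) -> Om -> C.
Hypothesis zetaL2 : forall t h, cLfun2 mu h -> cLfun2 P (zeta t h).
Hypothesis zeta_cov : forall t s h g, cLfun2 mu h -> cLfun2 mu g ->
  qform (ckernel (r t)) h g = cint P setT (fun w => (zeta (t + s) g w)^* * zeta s h w).

Let c : R := (2 * pi)^-1.

Let c_gt0 : 0 < c.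
Proof. by rewrite /c invr_gt0 mulr_gt0// pi_gt0. Qed.

(** With base time 0 on one side and t on the other, both covariances involve the times 0 and t, and
    conjugation exchanges the two factors. *)
Lemma qform_conj t h g : cLfun2 mu h -> cLfun2 mu g ->
  (qform (ckernel (r t)) g h)^* = qform (ckernel (r (- t))) h g.
Proof.
move=> hL gL; rewrite (zeta_cov t 0)// (zeta_cov (- t) t)// addr0 addNr.
rewrite -cint_conj//; last by apply: cintgM2; [apply: cLfun2_conj|]; exact: zetaL2.
by apply: eq_cint => w _; rewrite conjcM mulrC; congr (_ * _); exact: conjcK.
Qed.

Lemma qform_psum omega m n h g : cLfun2 mu h -> cLfun2 mu g ->
  qform (spectral_psum r omega m n) h g =
  c%:C * zsum m n (fun t => expi (- (omega * t%:~R)) * qform (ckernel (r t)) h g).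
Proof.
move=> hL gL.
have FL (k : 'I_(m + n).+1) := spectral_term_kL2 rL2 omega (k%:Z - m%:Z).
rewrite (qformZ _ (kL2_sum _ FL) hL gL) (qform_sum _ FL hL gL).
congr (_ * _); apply: eq_bigr => k _; apply: qformZ => //.
exact: ckernel_kL2.
Qed.

Lemma qform_psum_conj omega N h g : cLfun2 mu h -> cLfun2 mu g ->
  (qform (spectral_psum r omega N N) g h)^* = qform (spectral_psum r omega N N) h g.
Proof.
move=> hL gL; rewrite !qform_psum// conjc_scale_zsum.
congr (_ * _); apply: eq_zsum => t.
transitivity ((expi (- (omega * (- t)%:~R)) : C)^* * (qform (ckernel (r (- t))) g h)^*).
  exact: conjcM.
congr (_ * _); last by rewrite -[t in RHS]opprK; exact: qform_conj.
transitivity (expi (- - (omega * (- t)%:~R)) : C); first exact: expi_conj.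
by rewrite intrN mulrN opprK.
Qed.

Lemma qform_near omega (f : R -> R -> C) h g : cLfun2 mu h -> cLfun2 mu g ->
  spectral_density_kernel 2%:E r omega f ->
  forall e : R, 0 < e -> exists M, forall m n, (M <= m)%N -> (M <= n)%N ->
    Normc.normc (qform f h g - qform (spectral_psum r omega m n) h g) <= e.
Proof.
move=> hL gL [fL /(cvge0_pairP (fun=> knorm_ge0 _ _)) fcvg] e e0.
pose K := fine (cN mu g * cN mu h)%E.
have KE : K%:E = (cN mu g * cN mu h)%E.
  by rewrite /K fineK// fin_numM// cLfun2_fin.
have K0 : 0 <= K by rewrite -lee_fin KE mule_ge0// cN_ge0.
have K10 : 0 < K + 1 by rewrite ltr_wpDl.
have [M MP] := fcvg _ (divr_gt0 e0 K10).
exists M => m n Mm Mn; rewrite -lee_fin.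
have psL := spectral_psum_kL2 rL2 omega m n.
rewrite -qformB//; apply: le_trans (qform_le (kL2B fL psL) hL gL) _.
rewrite -KE; apply: (@le_trans _ _ ((e / (K + 1))%:E * K%:E)%E).
  by apply: lee_wpmul2r; [rewrite lee_fin|exact: MP].
rewrite -EFinM lee_fin -mulrA ler_piMr ?(ltW e0)// mulrC ler_pdivrMr// mul1r.
by rewrite lerDl.
Qed.

Lemma qform_spectral_conj omega (f : R -> R -> C) h g : cLfun2 mu h -> cLfun2 mu g ->
  spectral_density_kernel 2%:E r omega f -> (qform f g h)^* = qform f h g.
Proof.
move=> hL gL fD; apply/eqP; rewrite -subr_eq0; apply/eqP/normc_le0_eq.
rewrite -lee_fin; apply: lee_eps => e e0; rewrite add0e lee_fin.
have e20 : 0 < e / 2 by rewrite divr_gt0.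
have [M MP] := qform_near gL hL fD e20; have [N NP] := qform_near hL gL fD e20.
pose K := maxn M N; set p := spectral_psum r omega K K.
rewrite (_ : _ - _ = (qform f g h - qform p g h)^* - (qform f h g - qform p h g)).
  apply: le_trans (le_normcD _ _) _; rewrite normcN normc_conjc [e]splitr.
  by apply: lerD; [apply: MP|apply: NP]; rewrite ?leq_maxl ?leq_maxr.
rewrite opprB.
transitivity ((qform f g h)^* - qform p h g + (qform p h g - qform f h g)).
  by rewrite addrA subrK.
congr (_ + _); rewrite -(qform_psum_conj omega K hL gL); exact/esym/conjcB.
Qed.

Lemma spectral_self_adjoint omega (f : R -> R -> C) :
  spectral_density_kernel 2%:E r omega f -> self_adjoint (int_op f).
Proof.
move=> fD; have [fL _] := fD; split => [h hL|h g hL gL]; first exact: cLfun2_int_op.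
rewrite cinner_int_op// -(qform_spectral_conj hL gL fD) -cinner_int_op//.
rewrite /cinner -cint_conj//; last first.
  by apply: cintgM2; [exact: cLfun2_int_op|exact: cLfun2_conj].
by apply: eq_cint => s _; rewrite conjcM mulrC; congr (_ * _); exact: conjcK.
Qed.

Lemma fejer_ge0 omega N h : cLfun2 mu h ->
  0 <= complex.Re (\sum_(j < N) \sum_(i < N) (expi (- (omega * (i%:Z - j%:Z)%:~R)) *
    qform (ckernel (r (i%:Z - j%:Z))) h h)).
Proof.
move=> hL.
pose V (i : 'I_N) w := expi (omega * i%:R) * zeta i%:Z h w.
have VL i : cLfun2 P (V i) by apply: cLfun2Z; exact: zetaL2.
have SL := cLfun2_sum (index_enum 'I_N) VL.
have E (i j : 'I_N) : expi (- (omega * (i%:Z - j%:Z)%:~R)) *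
    qform (ckernel (r (i%:Z - j%:Z))) h h = cint P setT (fun w => (V i w)^* * V j w).
  (* With base time j, the lag i - j pairs the times i and j, as in the expansion of the squared
     modulus. *)
  rewrite (zeta_cov _ j%:Z)// subrK -cintZ//; last first.
    by apply: cintgM2; [apply: cLfun2_conj|]; exact: zetaL2.
  apply: eq_cint => w _.
  rewrite (_ : - (omega * (i%:Z - j%:Z)%:~R) = - (omega * i%:R) + omega * j%:R); last first.
    by rewrite intrB mulrBr opprB addrC.
  rewrite expiD mulrACA; congr (_ * _).
  exact/esym/conjc_expi_mul.
under eq_bigr do under eq_bigr do rewrite E.
have VVi (i j : 'I_N) : cintg P setT (fun w => (V i w)^* * V j w).
  by apply: cintgM2 => //; exact: cLfun2_conj.
under eq_bigr do rewrite -cint_sum//.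
rewrite -cint_sum//; last by move=> j; apply: cintg_sum.
rewrite (@eq_cint _ _ _ _ _ _ (fun w => (\sum_(i < N) V i w)^* * \sum_(i < N) V i w)).
  rewrite /cint /=; apply: Rintegral_ge0 => w _.
  by rewrite !cReE mulNr opprK -!expr2 addr_ge0 ?sqr_ge0.
move=> w _; rewrite mulr_sumr; apply: eq_bigr => j _.
by rewrite raddf_sum mulr_suml.
Qed.

Lemma qform_psum_bounded omega h :
  (\esum_(t in [set: int]) knorm 2%:E (ckernel (r t)) < +oo)%E -> cLfun2 mu h ->
  exists B : R, forall m n, Normc.normc (qform (spectral_psum r omega m n) h h) <= B.
Proof.
move=> r2 hL.
set S := (\sum_(0 <= j <oo) (knorm 2%:E (ckernel (r (Posz j))) + knorm 2%:E (ckernel (r (Negz j)))))%E.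
have SE : S = \esum_(t in [set: int]) knorm 2%:E (ckernel (r t)).
  by rewrite esum_int// => t; exact: knorm_ge0.
have S0 : (0 <= S)%E by rewrite SE; apply: esum_ge0 => t _; exact: knorm_ge0.
have Sfin : S \is a fin_num by rewrite ge0_fin_numE// SE.
exists (fine (c%:E * S * (cN mu h * cN mu h))%E) => m n.
rewrite -lee_fin fineK; last by rewrite !fin_numM// cLfun2_fin.
apply: le_trans (qform_le (spectral_psum_kL2 rL2 omega m n) hL hL) _.
apply: lee_wpmul2r; first by rewrite mule_ge0 ?cN_ge0.
exact: (knorm_spectral_psum rL2 (or_introl erefl)).
Qed.

Lemma sum_lt_cst (N M : nat) (D : R) : 0 <= D ->
  \sum_(j < N) (if (j < M)%N then D else 0) <= M%:R * D.
Proof.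
move=> D0; rewrite -(big_mkord xpredT (fun j => if (j < M)%N then D else 0)).
have [NM|MN] := leqP N M.
  rewrite (@le_trans _ _ (\sum_(0 <= j < N) D))//.
    by apply: ler_sum => j _; case: ifP.
  by rewrite sumr_const_nat subn0 -[D *+ N]mulr_natl ler_wpM2r// ler_nat.
rewrite (@big_cat_nat _ _ _ M)//=; last exact: ltnW.
rewrite [X in _ + X]big_nat_cond [X in _ + X]big1 => [|j /andP[/andP[Mj _] _]]; last first.
  by rewrite ltnNge Mj.
rewrite addr0 (@le_trans _ _ (\sum_(0 <= j < M) D))//.
  by apply: ler_sum => j _; case: ifP.
by rewrite sumr_const_nat subn0 mulr_natl.
Qed.

(* Fejer's argument: the Cesaro means of the partial sums of the spectral series
   are second moments, hence nonnegative, and they converge to the same limit. *)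
Lemma spectral_nonneg_definite omega (f : R -> R -> C) :
  (\esum_(t in [set: int]) knorm 2%:E (ckernel (r t)) < +oo)%E ->
  spectral_density_kernel 2%:E r omega f -> nonneg_definite (int_op f).
Proof.
move=> r2 fD h hL; have [fL _] := fD.
rewrite cinner_int_op//; set L := qform f h h.
have Lreal : complex.Im L = 0.
  have := qform_spectral_conj hL hL fD; rewrite -/L => /(congr1 (@complex.Im R)).
  by rewrite cReE => /eqP; rewrite -subr_eq0 -opprD oppr_eq0 -mulr2n mulrn_eq0 => /eqP.
have ge0C (z : C) : complex.Im z = 0 -> 0 <= complex.Re z -> 0 <= z.
  by move=> z0 z1; rewrite lecE z0 z1 eqxx.
apply: ge0C => //; rewrite leNgt; apply/negP => L0.
(* With this tolerance, the sums with both bounds at least M have real part at most Re L / 2, which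
   is negative. *)
have e0 : 0 < - complex.Re L / 2 by rewrite divr_gt0// oppr_gt0.
have [M MP] := qform_near hL hL fD e0.
have [B BP] := qform_psum_bounded omega r2 hL.
pose S m n := complex.Re (qform (spectral_psum r omega m n) h h).
have B0 : 0 <= B by apply: le_trans (BP 0 0); exact: normc_ge0.
pose D := B - complex.Re L.
have D0 : 0 <= D by rewrite subr_ge0 (le_trans (ltW L0)).
have SB m n : S m n <= B.
  by apply: le_trans (BP m n); apply: le_trans (ler_norm _) (ler_Re_normc _).
(* When m or n is below M, adding [D] makes the right-hand side at least the uniform bound [B]. *)
have Sle m n : S m n <= complex.Re L / 2 + (if (m < M)%N then D else 0) +
    (if (n < M)%N then D else 0).
  have := SB m n; rewrite /D; case: (ltnP m M) => mM; case: (ltnP n M) => nM; try lra.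
  move=> _; have := MP m n mM nM; rewrite normcB.
  move=> /(le_trans (ler_Re_normc _)) /(le_trans (ler_norm _)).
  by rewrite ReD ReN -/(S m n) -/L; lra.
have T0 N : 0 <= \sum_(j < N) S j (N.-1 - j)%N.
  have := fejer_ge0 omega N hL.
  rewrite (cesaro_zsum N (fun t => expi (- (omega * t%:~R)) * qform (ckernel (r t)) h h)).
  rewrite -(pmulr_rge0 _ c_gt0) Re_sum mulr_sumr => H; apply: le_trans H _.
  apply: ler_sum => j _; rewrite /S qform_psum// ReM /= mul0r subr0.
  exact: lexx.
(* Only the j with j < M or N-1-j < M are exceptional, at most 2 M of them, while the negative term
   grows with N. *)
have T1 N : \sum_(j < N) S j (N.-1 - j)%N <= N%:R * (complex.Re L / 2) + M%:R * D + M%:R * D.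
  apply: le_trans (ler_sum _ (fun (j : 'I_N) _ => Sle j (N.-1 - j)%N)) _.
  rewrite !big_split/=; apply: lerD.
    apply: lerD; last exact: sum_lt_cst.
    by rewrite sumr_const card_ord mulr_natl.
  rewrite (reindex_inj rev_ord_inj)/=; apply: le_trans (sum_lt_cst N M D0).
  apply: ler_sum => j _; rewrite (_ : (N.-1 - (N - j.+1))%N = j)//.
  by have := ltn_ord j; lia.
have [N NP] : exists N : nat, M%:R * D + M%:R * D < N%:R * (- complex.Re L / 2).
  exists (Num.trunc ((M%:R * D + M%:R * D) / (- complex.Re L / 2))).+1.
  by rewrite -ltr_pdivrMr// truncnS_gt.
have := le_trans (T0 N) (T1 N); rewrite leNgt => /negP; apply.
by move: NP; rewrite mulNr mulrN; lra.
Qed.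

End positivity.

(** * Nuclear norms *)

(** Tolerances are divided by [K + 1] rather than by a norm [K] that may vanish. *)
Lemma ler_div1_mul (R : realFieldType) (a K : R) : 0 <= a -> 0 <= K ->
  a / (K + 1) * K <= a.
Proof.
move=> a0 K0; rewrite -mulrA ler_piMr// mulrC ler_pdivrMr ?ltr_wpDl// mul1r.
by rewrite lerDl.
Qed.

(** * Kernels determined by their forms *)

Section vanishing_on_rectangles.
Context {d1 d2 : measure_display} {T1 : measurableType d1} {T2 : measurableType d2}
  {R : realType}.
Variable nu : {measure set (T1 * T2) -> \bar R}.

(** Dynkin's lemma: rectangles are stable under intersection and generate the product sigma-algebra,
    and the sets on which the integrable [f] has zero integral form a Dynkin system, the whole space
    being a rectangle. *)
Lemma integral_setX_eq0 (f : T1 * T2 -> \bar R) : nu.-integrable setT f ->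
  (forall A B, measurable A -> measurable B -> (\int[nu]_(x in A `*` B) f x = 0)%E) ->
  {ae nu, forall x, f x = 0%E}.
Proof.
move=> fi fAB.
have fD D : measurable D -> nu.-integrable D f.
  by move=> mD; exact: (integrableS measurableT).
have f0 E : measurable E -> (\int[nu]_(x in E) f x = 0)%E.
  pose G : set_system (T1 * T2) := [set A `*` B | A in measurable & B in measurable].
  have GE : @measurable _ (T1 * T2)%type = <<s G >> by exact: measurable_prod_measurableType.
  rewrite GE; move: E.
  apply: (@dynkin_induction _ _ G (fun E => (\int[nu]_(x in E) f x = 0)%E)) => //.
  - move=> _ _ [A1 mA1 [B1 mB1 <-]] [A2 mA2 [B2 mB2 <-]].
    exists (A1 `&` A2); first exact: measurableI.
    by exists (B1 `&` B2); [exact: measurableI|rewrite setXI].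
  - by rewrite -setXTT; exact: fAB.
  - by move=> _ [A mA [B mB <-]]; exact: fAB.
  - move=> S mS S0; have := fAB setT setT measurableT measurableT.
    rewrite setXTT -(setvU S) integral_setU//; last 3 first.
    + exact: measurableC.
    + by apply: measurable_funTS; exact: (measurable_int _ fi).
    + by rewrite /disj_set setICl.
    by rewrite S0 adde0.
  - move=> F mF tF F0; rewrite integral_bigcup//; last exact/fD/bigcup_measurable.
    by rewrite eseries0// => i _ _; exact: F0.
have := integral_ae_eq measurableT (g := cst 0%E) fi (measurable_cst _).
move=> H; have Z : ae_eq nu setT f (cst 0%E).
  by apply: H => E _ mE; rewrite f0// integral0.
by apply: (aeS Z) => x /(_ I).
Qed.

End vanishing_on_rectangles.

Section nuclear_kernels.
Context {R : realType}.
Local Notation C := R[i].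
Local Notation TR := (measurableTypeR R : measurableType _).
Local Notation mu := (leb01 R : {measure set TR -> \bar R}).
Local Notation sq := (leb01sq R).
Implicit Types (k l : R -> R -> C) (h g u v : R -> C).

Lemma cLfun2_indic (A : set TR) : measurable A -> cLfun2 mu (fun x => (\1_A x)%:C).
Proof.
move=> mA; have mi : cmeas (fun x : TR => (\1_A x)%:C : C).
  by apply: cmeas_real; exact: measurable_indic.
apply/cLfun2P; split => //.
have [_ c1] := (cLfun2P _ _).1 (cLfun2_cst1 (leb01 R)).
apply: le_lt_trans c1; apply: cN_le => //.
by move=> x; rewrite normc_real Normc.normc1 indicE ger0_norm// lern1 leq_b1.
Qed.

(** Testing on indicators gives the integrals of [k] over all rectangles. *)
Lemma qform_eq0_ae k : kL2 k ->
  (forall h g, cLfun2 mu h -> cLfun2 mu g -> qform k h g = 0) ->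
  {ae sq, forall x, k x.1 x.2 = 0}.
Proof.
move=> kL k0.
have ki : cintg sq setT (fun x => k x.1 x.2).
  have := qform_cintg kL (cLfun2_cst1 (leb01 R)) (cLfun2_cst1 (leb01 R)).
  congr cintg; apply/funext => x.
  transitivity (k x.1 x.2 * (1 * 1)); last by rewrite !mulr1.
  by congr (_ * (_ * _)); exact: conjc1.
have indicX (A B : set TR) (x : TR * TR) :
    \1_(A `*` B) x = \1_A x.1 * \1_B x.2 :> R.
  by rewrite !indicE in_setX; case: (_ \in A); case: (_ \in B); rewrite /= ?mulr1 ?mulr0.
have E A B : measurable A -> measurable B ->
    \int[sq]_(x in A `*` B) complex.Re (k x.1 x.2) = 0 /\
    \int[sq]_(x in A `*` B) complex.Im (k x.1 x.2) = 0.
  move=> mA mB; have := k0 _ _ (cLfun2_indic mB) (cLfun2_indic mA).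
  rewrite /qform /cint => -[HR HI]; split.
    rewrite -HR Rintegral_mkcond; apply: eq_Rintegral => x _.
    rewrite patchE -[x \in _]/(x \in _) !cReE /=.
    have := indicX A B x; rewrite !indicE; case: ifPn => _ /= => <- .
      by rewrite !(mulr0, mul0r, oppr0, subr0, addr0, mulr1).
    by rewrite !(mulr0, mul0r, oppr0, subr0, addr0, mulr1).
  rewrite -HI Rintegral_mkcond; apply: eq_Rintegral => x _.
  rewrite patchE !cReE /=.
  have := indicX A B x; rewrite !indicE; case: ifPn => _ /= => <- .
    by rewrite !(mulr0, mul0r, oppr0, subr0, addr0, add0r, mulr1).
  by rewrite !(mulr0, mul0r, oppr0, subr0, addr0, add0r, mulr1).
have [kr kim] := ki.
have kr0 : {ae sq, forall x, ((complex.Re (k x.1 x.2))%:E = 0)%E}.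
  apply: (integral_setX_eq0 kr) => A B mA mB.
  rewrite -[LHS]fineK; first by rewrite -/(Rintegral _ _ _) (E _ _ mA mB).1.
  by apply: integrable_fin_num; [exact: measurableX|apply: (integrableS measurableT) => //; exact: measurableX].
have ki0 : {ae sq, forall x, ((complex.Im (k x.1 x.2))%:E = 0)%E}.
  apply: (integral_setX_eq0 kim) => A B mA mB.
  rewrite -[LHS]fineK; first by rewrite -/(Rintegral _ _ _) (E _ _ mA mB).2.
  by apply: integrable_fin_num; [exact: measurableX|apply: (integrableS measurableT) => //; exact: measurableX].
by apply: (aeS2 kr0 ki0) => x [] xr [] xi; exact: complexP.
Qed.

Lemma qform_tensor u v h g : cLfun2 mu u -> cLfun2 mu v -> cLfun2 mu h -> cLfun2 mu g ->
  qform (fun s t => u s * (v t)^*) h g = cinner h v * cinner u g.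
Proof.
move=> uL vL hL gL.
have ug := cintgM2 uL (cLfun2_conj gL); have hv := cintgM2 hL (cLfun2_conj vL).
rewrite mulrC /cinner -(@cint_tensor _ _ _ _ _ (leb01 R) (leb01 R) _ _ ug hv).
by apply: eq_cint => x _; rewrite [LHS]mulrACA; congr (_ * _); exact: mulrC.
Qed.

Lemma cinner_le h g : cLfun2 mu h -> cLfun2 mu g ->
  ((Normc.normc (cinner h g))%:E <= cN mu h * cN mu g)%E.
Proof. by move=> hL gL; have := normc_cintM2 hL (cLfun2_conj gL); rewrite cN_conj. Qed.

(** If the right-hand side is finite, the series of u_n(s) conj(v_n(t)) converges absolutely in L^2
    of the square to a kernel [S] of norm at most that sum. The forms of [k] and of [S] are limits
    of the same partial sums, so the two kernels agree almost everywhere. *)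
Lemma nuclear_representation_knorm k (u v : nat -> R -> C) : kL2 k ->
  nuclear_representation (int_op k) u v ->
  (knorm 2%:E k <= \sum_(0 <= n <oo) (cnorm2 (u n) * cnorm2 (v n)))%E.
Proof.
move=> kL [uvL uvcvg].
have uL n := (uvL n).1; have vL n := (uvL n).2.
pose w n : R -> R -> C := fun s t => u n s * (v n t)^*.
have wL n : kL2 (w n) by apply: kL2_tensor => //; exact: cLfun2_conj.
have wN n : knorm 2%:E (w n) = (cnorm2 (u n) * cnorm2 (v n))%E.
  have [mun _] := (cLfun2P _ _).1 (uL n).
  have [mvn _] := (cLfun2P _ _).1 (cLfun2_conj (vL n)).
  by rewrite /w (knorm_tensor mun mvn) cN_conj.
set s := (\sum_(0 <= n <oo) _)%E.
have [soo|] := ltP s +oo%E; last by rewrite leye_eq => /eqP ->; exact: leey.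
have c0 n : (0 <= cnorm2 (u n) * cnorm2 (v n))%E by rewrite mule_ge0// cN_ge0.
have [F mF FP] := csum_exists (fun n => kL2_meas (wL n)).
pose S a b := F (a, b).
have SE x : S x.1 x.2 = F x by rewrite /S -surjective_pairing.
have mS : kmeas S.
  by move: mF; congr cmeas; apply/funext => x; rewrite SE.
pose p n a b := \sum_(i < n) w i a b.
have pL n : kL2 (p n) by apply: kL2_sum => i; exact: wL.
have Sp n : (knorm 2%:E (fun a b => S a b - p n a b)%R <=
    \sum_(n <= i <oo) (cnorm2 (u i) * cnorm2 (v i)))%E.
  rewrite -(eq_eseriesr (fun i _ => wN i)).
  apply: (knorm_series (or_introl erefl)).
  - by apply: kmeasB => //; exact: kL2_meas.
  - by move=> i; exact: kL2_meas.
  - by move=> a b; have := FP (a, b) n.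
have SN : (knorm 2%:E S <= s)%E.
  have := Sp 0%N; rewrite (_ : (fun a b => _) = S)//.
  by apply/funext => a; apply/funext => b; rewrite /p big_ord0 subr0.
have SL : kL2 S by apply/cLfun2P; split => //; exact: le_lt_trans SN soo.
suff kS : {ae sq, forall x, k x.1 x.2 = S x.1 x.2}.
  apply: le_trans SN; rewrite le_eqVlt; apply/orP; left; apply/eqP.
  by apply: cN_ae => //; exact: kL2_meas.
have dL := kL2B kL SL.
have d0 : {ae sq, forall x, (fun a b => k a b - S a b) x.1 x.2 = 0}.
  apply: (qform_eq0_ae dL) => h g hL gL.
  rewrite qformB//; apply: normc_le0_eq; rewrite -lee_fin; apply: lee_eps => e e0.
  rewrite add0e.
  have pE n : qform (p n) h g = \sum_(i < n) cinner h (v i) * cinner (u i) g.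
    rewrite qform_sum//; apply: eq_bigr => i _; rewrite qform_tensor//.
  have e20 : 0 < e / 2 by rewrite divr_gt0.
  pose G := fine (cN mu g); pose H := fine (cN mu h).
  have GE : G%:E = cN mu g by rewrite fineK// cLfun2_fin.
  have HE : H%:E = cN mu h by rewrite fineK// cLfun2_fin.
  have G0 : 0 <= G by rewrite fine_ge0// cN_ge0.
  have H0 : 0 <= H by rewrite fine_ge0// cN_ge0.
  have G10 : 0 < G + 1 by rewrite ltr_wpDl.
  have GH10 : 0 < G * H + 1 by rewrite ltr_wpDl// mulr_ge0.
  have /(cvge0_seqP (fun=> cN_ge0 _ _))/(_ _ (divr_gt0 e20 G10))[N1 N1P] := uvcvg h hL.
  have [N2 N2P] := series_tail_small c0 soo (divr_gt0 e20 GH10).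
  pose n := maxn N1 N2.
  (* Here the convergence is that of the representation applied to h. *)
  have B1 : Normc.normc (qform k h g - qform (p n) h g) <= e / 2.
    have uhL : cLfun2 mu (fun x => \sum_(i < n) cinner h (v i) * u i x).
      by apply: cLfun2_sum => i; exact: cLfun2Z.
    have AL := cLfun2_int_op kL hL.
    have E1 : qform k h g - qform (p n) h g =
        cinner (fun x => int_op k h x - \sum_(i < n) cinner h (v i) * u i x) g.
      rewrite -cinner_int_op// pE; apply: esym.
      transitivity (cint mu setT (fun x => int_op k h x * (g x)^* -
          \sum_(i < n) cinner h (v i) * (u i x * (g x)^*))).
        apply: eq_cint => x _; rewrite mulrBl mulr_suml; congr (_ - _).
        by apply: eq_bigr => i _; rewrite mulrA.
      have ugi i : cintg mu setT (fun x => u i x * (g x)^*).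
        by apply: cintgM2 => //; exact: cLfun2_conj.
      rewrite cintB//; last 2 first.
      - by apply: cintgM2 => //; exact: cLfun2_conj.
      - by apply: cintg_sum => // i; exact: cintgZ.
      congr (_ - _); rewrite cint_sum//; last by move=> i; exact: cintgZ.
      by apply: eq_bigr => i _; rewrite cintZ.
    rewrite E1 -lee_fin; apply: le_trans (cinner_le (cLfun2B AL uhL) gL) _.
    rewrite -GE; apply: (@le_trans _ _ ((e / 2 / (G + 1))%:E * G%:E)%E).
      by apply: lee_wpmul2r; [rewrite lee_fin|apply: N1P; exact: leq_maxl].
    by rewrite -EFinM lee_fin; exact: ler_div1_mul (ltW e20) G0.
  (* Here it is the L^2 convergence of the kernels. *)
  have B2 : Normc.normc (qform S h g - qform (p n) h g) <= e / 2.
    rewrite -lee_fin -qformB//; apply: le_trans (qform_le (kL2B SL (pL n)) hL gL) _.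
    rewrite -GE -HE; apply: (@le_trans _ _ ((e / 2 / (G * H + 1))%:E * (G * H)%:E)%E).
      rewrite EFinM; apply: lee_wpmul2r; first by rewrite -EFinM lee_fin mulr_ge0.
      by apply: le_trans (Sp n) _; apply: N2P; exact: leq_maxr.
    by rewrite -EFinM lee_fin; exact: ler_div1_mul (ltW e20) (mulr_ge0 G0 H0).
  rewrite lee_fin [e]splitr.
  rewrite (_ : _ - _ = (qform k h g - qform (p n) h g) - (qform S h g - qform (p n) h g)).
    by apply: le_trans (le_normcD _ _) _; rewrite normcN; exact: lerD.
  by rewrite opprB addrA subrK.
by apply: (aeS d0) => x /eqP; rewrite subr_eq0 => /eqP.
Qed.

Lemma knorm_le_nuclear k : kL2 k -> (knorm 2%:E k <= nuclear_norm (int_op k))%E.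
Proof.
move=> kL; apply: le_ereal_inf_tmp => _ [u [v [rep ->]]].
exact: nuclear_representation_knorm.
Qed.

End nuclear_kernels.

Lemma int_nat_enumeration : exists (phi : nat -> int * nat) (psi : int * nat -> nat),
  cancel phi psi /\ cancel psi phi.
Proof.
have ninf : ~ finite_set [set: int * nat].
  move=> /(finite_image snd) fin; apply: infinite_nat; move: fin.
  congr finite_set; apply/seteqP; split => // n _; by exists (0, n).
have /card_set_bijP[psi [_ psi_inj psi_surj]] : ([set: int * nat] #= [set: nat])%card.
  by apply: eq_card_nat => //; exact: countableP.
have /choice[phi phiP] : forall i, exists p, psi p = i.
  by move=> i; have [p _ pi] := psi_surj i I; exists p.
exists phi, psi; split => // p.
by apply: psi_inj; rewrite ?inE// phiP.
Qed.

(** * Countable subadditivity of the nuclear norm *)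

Section nuclear_sums.
Context {R : realType}.
Local Notation C := R[i].
Local Notation TR := (measurableTypeR R : measurableType _).
Local Notation mu := (leb01 R : {measure set TR -> \bar R}).
Variables (A : (R -> C) -> R -> C) (B : int -> (R -> C) -> R -> C).
Variables u v : int -> nat -> R -> C.
Hypothesis Brep : forall t, nuclear_representation (B t) (u t) (v t).
Hypothesis BL : forall t h, cLfun2 mu h -> cLfun2 mu (B t h).
Hypothesis AL : forall h, cLfun2 mu h -> cLfun2 mu (A h).
Hypothesis Acvg : forall h, cLfun2 mu h -> forall e : R, 0 < e -> exists M, forall n,
  (M <= n)%N -> (cN mu (fun x => A h x - zsum n n (fun t => B t h x))%R <= e%:E)%E.

Let c (p : int * nat) : \bar R := (cnorm2 (u p.1 p.2) * cnorm2 (v p.1 p.2))%E.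

Let c0 p : (0 <= c p)%E.
Proof. by rewrite mule_ge0// cN_ge0. Qed.

Let s t := (\sum_(0 <= n <oo) c (t, n))%E.

Let s0 t : (0 <= s t)%E.
Proof. by apply: nneseries_ge0 => *; exact: c0. Qed.

(** The terms are nonnegative, so the sum over all pairs may be taken along the enumeration or time
    by time. *)
Let total_enum (phi : nat -> int * nat) psi : cancel phi psi -> cancel psi phi ->
  (\sum_(0 <= i <oo) c (phi i) = \sum_(0 <= j <oo) (s (Posz j) + s (Negz j)))%E.
Proof.
move=> phiK psiK; rewrite -esum_int// nneseries_esumT//.
rewrite -(@reindex_esum R _ _ [set: nat] [set: int * nat] phi c); last first.
  split => //; first by move=> i j _ _ /(congr1 psi); rewrite !phiK.
  by move=> p _; exists (psi p).
have -> : \esum_(t in [set: int]) s t = \esum_(t in [set: int]) \esum_(n in [set: nat]) c (t, n).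
  by apply: eq_esum => t _; rewrite /s nneseries_esumT.
rewrite (@esum_esum _ _ _ _ (fun=> setT) (fun t n => c (t, n)))//.
rewrite (_ : _ `*`` _ = setT); last by apply/seteqP; split.
by apply: eq_esum => -[].
Qed.

Let W h p x : C := cinner h (v p.1 p.2) * u p.1 p.2 x.

Let WL h p : cLfun2 mu h -> cLfun2 mu (W h p).
Proof. by move=> hL; apply: cLfun2Z; exact: ((Brep p.1).1 p.2).1. Qed.

Let WN h p : cLfun2 mu h -> (cN mu (W h p) <= cN mu h * c p)%E.
Proof.
move=> hL; have [uL vL] := (Brep p.1).1 p.2.
rewrite cNZ; last by have [] := (cLfun2P _ _).1 uL.
rewrite /c [(cnorm2 _ * _)%E]muleC muleA; apply: lee_wpmul2r; first exact: cN_ge0.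
exact: cinner_le.
Qed.

(** Merging the representations of all [B t] along an enumeration of int x nat gives a
    representation of [A], whose cost is the double sum. Its convergence at h, given for symmetric
    sums of the B t h, is obtained by comparing long partial sums with a finite box of pairs. *)
Lemma nuclear_norm_sum :
  (nuclear_norm A <= \sum_(0 <= j <oo)
     (\sum_(0 <= n <oo) (cnorm2 (u (Posz j) n) * cnorm2 (v (Posz j) n)) +
      \sum_(0 <= n <oo) (cnorm2 (u (Negz j) n) * cnorm2 (v (Negz j) n))))%E.
Proof.
rewrite -[leRHS]/(\sum_(0 <= j <oo) (s (Posz j) + s (Negz j)))%E.
have [|] := ltP (\sum_(0 <= j <oo) (s (Posz j) + s (Negz j)))%E +oo%E; last first.
  by rewrite leye_eq => /eqP ->; exact: leey.
have [phi [psi [phiK psiK]]] := int_nat_enumeration.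
rewrite -(total_enum phiK psiK) => soo.
apply: ereal_inf_lbound; exists (fun i => u (phi i).1 (phi i).2), (fun i => v (phi i).1 (phi i).2).
split => //; split; first by move=> i; exact: (Brep (phi i).1).1.
move=> h hL; apply/cvge0_seqP => [n|e e0]; first exact: cN_ge0.
have e30 : 0 < e / 3 by rewrite divr_gt0.
pose H := fine (cN mu h).
have HE : H%:E = cN mu h by rewrite fineK// cLfun2_fin.
have H0 : 0 <= H by rewrite fine_ge0// cN_ge0.
have H10 : 0 < H + 1 by rewrite ltr_wpDl.
have [n1 n1P] := series_tail_small (fun i => c0 (phi i)) soo (divr_gt0 e30 H10).
have [T0 T0P] := Acvg hL e30.
(* The box |t| <= T, n < N contains the first [n1] indices of the enumeration. *)
pose T := (T0 + \sum_(i < n1) `|(phi i).1|)%N.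
(* The box meets 2 T + 1 operators, which share the tolerance. *)
have eT0 : 0 < e / 3 / ((T + T).+1)%:R by rewrite divr_gt0.
have /choice[Nf NfP] : forall t, exists M, forall n, (M <= n)%N ->
    (cN mu (fun x => B t h x - \sum_(i < n) W h (t, i : nat) x)%R <= (e / 3 / ((T + T).+1)%:R)%:E)%E.
  move=> t; have /(cvge0_seqP (fun=> cN_ge0 _ _))/(_ _ eT0)[M MP] := (Brep t).2 h hL.
  by exists M => n /MP.
(* Sums stand for maxima: N bounds the ranks of all operators in the box and exceeds the second
   coordinates of the first n1 pairs. *)
pose N := (\sum_(k < (T + T).+1) Nf (k%:Z - T%:Z)%R + \sum_(i < n1) (phi i).2.+1)%N.
pose box := [seq (k%:Z - T%:Z, n) | k <- iota 0 (T + T).+1, n <- iota 0 N].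
have box_uniq : uniq box.
  apply: allpairs_uniq; [exact: iota_uniq|exact: iota_uniq|].
  move=> [k n] [k' n'] _ _ /= [kk ->]; congr (_, _).
  by have := kk; lia.
have leq_sum1 (m : nat) (F : nat -> nat) (i : nat) : (i < m)%N -> (F i <= \sum_(j < m) F j)%N.
  by move=> im; rewrite (bigD1 (Ordinal im))//= leq_addr.
have box_in i : (i < n1)%N -> phi i \in box.
  move=> i1; have a1 := leq_sum1 n1 (fun i => `|(phi i).1|%N) i i1.
  have a2 := leq_sum1 n1 (fun i => (phi i).2.+1) i i1.
  apply/allpairsP; exists (`|((phi i).1 + T%:Z)%R|%N, (phi i).2); split.
  - by rewrite mem_iota /= /T; lia.
  - by rewrite mem_iota /= /N; lia.
  - rewrite [LHS]surjective_pairing; congr (_, _).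
    by rewrite /= /T; lia.
(* From N0 on, all pairs of the box have been enumerated, and n1 is passed. *)
pose N0 := (n1 + \sum_(p <- box) (psi p).+1)%N.
have N0P p : p \in box -> (psi p < N0)%N.
  move=> pb; rewrite /N0 (big_rem p)//=; lia.
exists N0 => n N0n.
have perm : perm_eq [seq phi i | i <- iota 0 n & phi i \in box] box.
  apply: uniq_perm => //.
    rewrite map_inj_uniq ?filter_uniq ?iota_uniq//; exact: (can_inj phiK).
  move=> p; apply/mapP/idP => [ [i ib ->] | pb]; first by move: ib; rewrite mem_filter => /andP[].
  exists (psi p); last by rewrite psiK.
  by rewrite mem_filter psiK pb mem_iota /=; exact: leq_trans (N0P _ pb) N0n.
have split_sum x : \sum_(i < n) W h (phi i) x =
    zsum T T (fun t => \sum_(j < N) W h (t, j : nat) x) +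
    \sum_(0 <= i < n | phi i \notin box) W h (phi i) x.
  rewrite -(big_mkord xpredT (fun i => W h (phi i) x)) (bigID (fun i => phi i \in box))/=.
  congr (_ + _).
  rewrite -big_filter -(big_map phi xpredT (fun p => W h p x)).
  rewrite /index_iota subn0 (perm_big _ perm)/box big_allpairs_dep /=.
  rewrite /zsum -(big_mkord xpredT (fun k => \sum_(j < N) W h (k%:Z - T%:Z, j : nat) x)).
  rewrite /index_iota subn0; apply: eq_bigr => k _.
  by rewrite -(big_mkord xpredT (fun j => W h (k%:Z - T%:Z, j : nat) x)) /index_iota subn0.
(* The error is A minus the operators of the box, plus those operators minus their first N terms,
   minus the enumerated terms outside the box. *)
pose D1 x := A h x - zsum T T (fun t => B t h x).
pose D2 x := zsum T T (fun t => B t h x - \sum_(j < N) W h (t, j : nat) x).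
pose D3 x := \sum_(0 <= i < n | phi i \notin box) W h (phi i) x.
have D1L : cLfun2 mu D1.
  by apply: cLfun2B; [exact: AL|apply: cLfun2_sum => k; exact: BL].
have BWL t : cLfun2 mu (fun x => B t h x - \sum_(j < N) W h (t, j : nat) x).
  by apply: cLfun2B; [exact: BL|apply: cLfun2_sum => j; exact: WL].
have D2L : cLfun2 mu D2 by apply: cLfun2_sum => k; exact: BWL.
have D3E : D3 = (fun x => \sum_(i <- [seq i <- index_iota 0 n | phi i \notin box]) W h (phi i) x).
  by apply/funext => x; rewrite /D3 big_filter.
have D3L : cLfun2 mu D3 by rewrite D3E; apply: cLfun2_sum => i; exact: WL.
have cm f : cLfun2 mu f -> cmeas f by move=> /cLfun2P[].
rewrite -[cnorm2 _]/(cN mu _) (_ : (fun x => _) = (fun x => (D1 x + D2 x) - D3 x)); last first.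
  apply/funext => x; rewrite -[X in A h x - X]/(\sum_(i < n) W h (phi i) x) split_sum.
  rewrite /D1 /D2 -zsumB opprD addrA; congr (_ - _).
  by rewrite addrA subrK.
apply: le_trans (cNB _ (cmeasD (cm _ D1L) (cm _ D2L)) (cm _ D3L)) _.
apply: le_trans (leeD (cND _ (cm _ D1L) (cm _ D2L)) (lexx _)) _.
apply: (@le_trans _ _ ((e / 3)%:E + (e / 3)%:E + (e / 3)%:E)%E); last first.
  by rewrite -!EFinD lee_fin; lra.
apply: leeD; first apply: leeD.
- by apply: T0P; rewrite /T leq_addr.
- apply: le_trans (cN_sum _ _ _) _; first by move=> k; exact: cm.
  apply: (@le_trans _ _ (\sum_(k < (T + T).+1) (e / 3 / ((T + T).+1)%:R)%:E)%E).
    apply: lee_sum => k _; apply: NfP.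
    by have := leq_sum1 (T + T).+1 (fun k => Nf (k%:Z - T%:Z)%R) k (ltn_ord k); rewrite /N; lia.
  by rewrite sumEFin lee_fin sumr_const card_ord -[leLHS]mulr_natr divfK.
- rewrite D3E; apply: le_trans (cN_sum _ _ _) _; first by move=> i; apply: cm; exact: WL.
  rewrite big_filter.
  apply: (@le_trans _ _ (\sum_(0 <= i < n | phi i \notin box) (cN mu h * c (phi i)))%E).
    by apply: lee_sum => i _; exact: WN.
  (* Pairs outside the box have index at least n1, so their terms lie in a small tail of a
     convergent series. *)
  apply: (@le_trans _ _ (\sum_(n1 <= i < n) (cN mu h * c (phi i)))%E).
    have n1n : (n1 <= n)%N by apply: leq_trans N0n; rewrite /N0 leq_addr.
    rewrite (@big_cat_nat _ _ _ n1 0 n)//= [X in (X + _)%E]big1_seq; last first.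
      move=> i /andP[/negP nb]; rewrite mem_index_iota => /andP[_ i1].
      by exfalso; apply: nb; exact: box_in.
    rewrite add0e [leRHS](bigID (fun i => phi i \notin box))/= leeDl//.
    by apply: sume_ge0 => i _; rewrite mule_ge0// cN_ge0.
  rewrite -HE -ge0_sume_distrr; last by move=> i _; exact: c0.
  apply: (@le_trans _ _ (H%:E * (e / 3 / (H + 1))%:E)%E).
    apply: lee_wpmul2l; first by rewrite lee_fin.
    apply: le_trans (n1P n1 (leqnn _)); apply: nneseries_lim_ge => i _ _; exact: c0.
  by rewrite -EFinM lee_fin mulrC; exact: ler_div1_mul (ltW e30) H0.
Qed.

End nuclear_sums.

Lemma zsum_outside (V : zmodType) (m n N : nat) (F : int -> V) :
  (m <= N)%N -> (n <= N)%N ->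
  zsum N N (fun t => if (- m%:Z <= t <= n%:Z)%R then 0 else F t) =
  zsum N N F - zsum m n F.
Proof.
move=> mN nN; rewrite !zsumE opprD addrACA; congr (_ + _).
  rewrite -(big_mkord xpredT (fun j => F (Negz j))) (@big_cat_nat _ _ _ m 0 N)//=.
  rewrite -(big_mkord xpredT (fun j => F (Negz j))) addrAC subrr add0r.
  rewrite -(big_mkord xpredT (fun j => if (- m%:Z <= Negz j <= n%:Z)%R then 0 else F (Negz j))).
  rewrite (@big_cat_nat _ _ _ m 0 N)//= [X in X + _]big1_seq ?add0r; last first.
    by move=> j /andP[_]; rewrite mem_index_iota => jm; rewrite ifT//; lia.
  by apply: eq_big_nat => j jm; rewrite ifF//; lia.
rewrite -(big_mkord xpredT (fun j => F (Posz j))) (@big_cat_nat _ _ _ n.+1 0 N.+1)//=.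
rewrite -(big_mkord xpredT (fun j => F (Posz j))) addrAC subrr add0r.
rewrite -(big_mkord xpredT (fun j => if (- m%:Z <= Posz j <= n%:Z)%R then 0 else F (Posz j))).
rewrite (@big_cat_nat _ _ _ n.+1 0 N.+1)//= [X in X + _]big1_seq ?add0r; last first.
  by move=> j /andP[_]; rewrite mem_index_iota => jm; rewrite ifT//; lia.
by apply: eq_big_nat => j jm; rewrite ifF//; lia.
Qed.

Section nuclear_norm_theory.
Context {R : realType}.
Local Notation C := R[i].
Local Notation TR := (measurableTypeR R : measurableType _).
Local Notation mu := (leb01 R : {measure set TR -> \bar R}).
Implicit Types (A : (R -> C) -> R -> C) (h : R -> C).

Lemma nuclear_norm_ge0 A : (0 <= nuclear_norm A)%E.
Proof.
apply: le_ereal_inf_tmp => _ [u [v [_ ->]]].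
by apply: nneseries_ge0 => n _ _; rewrite mule_ge0// cN_ge0.
Qed.

Lemma nuclear_norm_approx A e : (nuclear_norm A < +oo)%E -> 0 < e ->
  exists uv : (nat -> R -> C) * (nat -> R -> C), nuclear_representation A uv.1 uv.2 /\
    (\sum_(0 <= n <oo) (cnorm2 (uv.1 n) * cnorm2 (uv.2 n)) <= nuclear_norm A + e%:E)%E.
Proof.
move=> Aoo e0; have /(lb_ereal_inf_adherent e0) : nuclear_norm A \is a fin_num.
  by rewrite ge0_fin_numE// nuclear_norm_ge0.
by move=> [_ [u [v [uv ->]]] /ltW le]; exists (u, v).
Qed.

Lemma nuclear_representationZ A u v (z : C) :
  (forall h, cLfun2 mu h -> cLfun2 mu (A h)) -> nuclear_representation A u v ->
  nuclear_representation (fun h x => z * A h x) (fun n x => z * u n x) v.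
Proof.
move=> AL [uvL uvcvg]; split=> [n|h hL].
  by have [uL vL] := uvL n; split => //; exact: cLfun2Z.
have E n : cnorm2 (fun x => z * A h x - \sum_(i < n) cinner h (v i) * (z * u i x)) =
    ((Normc.normc z)%:E * cnorm2 (fun x => A h x - \sum_(i < n) cinner h (v i) * u i x)%R)%E.
  rewrite -[RHS]cNZ.
    apply: eq_cN => x; rewrite mulrBr mulr_sumr; congr (_ - _).
    by apply: eq_bigr => i _; rewrite mulrCA.
  have /cLfun2P[] // : cLfun2 mu (fun x => A h x - \sum_(i < n) cinner h (v i) * u i x).
  apply: cLfun2B; first exact: AL.
  by apply: cLfun2_sum => i; apply: cLfun2Z; exact: (uvL i).1.
rewrite (_ : (fun n => _) = (fun n => ((Normc.normc z)%:E *
    cnorm2 (fun x => A h x - \sum_(i < n) cinner h (v i) * u i x)%R)%E)); last first.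
  by apply/funext.
by rewrite -(mule0 (Normc.normc z)%:E); apply: cvgeZl => //; exact: uvcvg.
Qed.

Variables (B : int -> (R -> C) -> R -> C).
Hypothesis BL : forall t h, cLfun2 mu h -> cLfun2 mu (B t h).
Hypothesis Boo : forall t, (nuclear_norm (B t) < +oo)%E.

(** Serves twice: with M = 0 and the spectral coefficients for the norm of the limit, and with
    coefficients vanishing on a rectangle for the norm of a remainder. Nearly optimal
    representations of the [B t], scaled by [z t], are merged by [nuclear_norm_sum]. *)
Lemma nuclear_norm_series_le A (z : int -> C) (c : R) (M : nat) :
  (forall t, Normc.normc (z t) <= c) ->
  (forall j, (j < M)%N -> z (Posz j) = 0 /\ z (Negz j) = 0) ->
  (forall h, cLfun2 mu h -> cLfun2 mu (A h)) ->
  (forall h, cLfun2 mu h -> forall e : R, 0 < e -> exists N0, forall n, (N0 <= n)%N ->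
    (cN mu (fun x => A h x - zsum n n (fun t => z t * B t h x))%R <= e%:E)%E) ->
  (nuclear_norm A <= c%:E *
     \sum_(M <= j <oo) (nuclear_norm (B (Posz j)) + nuclear_norm (B (Negz j))))%E.
Proof.
move=> zc zM AL Acvg.
have c0 : 0 <= c by apply: le_trans (zc 0); exact: normc_ge0.
apply: lee_eps => e e0; pose e' := e / (c + 1).
have e'0 : 0 < e' by rewrite divr_gt0// ltr_wpDl.
(* The excesses add up to e': index j receives e' / 2^(j+1), half for each of its two times; and c
   e' <= e. *)
pose ep (t : int) : R := match t with Posz j | Negz j => e' / (2 ^ j.+1)%:R / 2 end.
have ep0 t : 0 < ep t by case: t => j; apply: divr_gt0 => //; apply: divr_gt0 => //; rewrite ltr0n expn_gt0.
have /choice[uv uvP] t := nuclear_norm_approx (Boo t) (ep0 t).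
pose s t := (\sum_(0 <= n <oo) (cnorm2 ((uv t).1 n) * cnorm2 ((uv t).2 n)))%E.
pose zs t := (\sum_(0 <= n <oo) (cnorm2 (fun x => (z t * (uv t).1 n x)%R) * cnorm2 ((uv t).2 n)))%E.
have zsE t : zs t = ((Normc.normc (z t))%:E * s t)%E.
  rewrite -nneseriesZl; last by move=> n _; rewrite mule_ge0// cN_ge0.
  apply: eq_eseriesr => n _; rewrite muleA; congr (_ * _)%E; rewrite [LHS]cNZ//.
  by have /cLfun2P[] := ((uvP t).1.1 n).1.
have s0 t : (0 <= s t)%E by apply: nneseries_ge0 => n _ _; rewrite mule_ge0// cN_ge0.
have zs0 t : (0 <= zs t)%E by rewrite zsE mule_ge0// lee_fin normc_ge0.
have zs_le t : (zs t <= c%:E * (nuclear_norm (B t) + (ep t)%:E))%E.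
  rewrite zsE; apply: lee_pmul => //; first by rewrite lee_fin normc_ge0.
    by rewrite lee_fin.
  exact: (uvP t).2.
apply: (@le_trans _ _ (\sum_(0 <= j <oo) (zs (Posz j) + zs (Negz j)))%E).
  apply: (@nuclear_norm_sum _ A (fun t h x => z t * B t h x)
    (fun t n x => z t * (uv t).1 n x) (fun t => (uv t).2)) => //.
    by move=> t; apply: nuclear_representationZ => //; [exact: BL|exact: (uvP t).1].
  by move=> t h hL; apply: cLfun2Z; exact: BL.
rewrite (nneseries_splitn M) => [|k]; last by rewrite adde_ge0.
rewrite big1_seq ?add0e; last first.
  move=> j /andP[_]; rewrite mem_index_iota => /zM[z1 z2].
  by rewrite !zsE z1 z2 Normc.normc0 !mul0e adde0.
pose a j := (nuclear_norm (B (Posz j)) + nuclear_norm (B (Negz j)))%E.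
have a0 j : (0 <= a j)%E by rewrite adde_ge0// nuclear_norm_ge0.
apply: (@le_trans _ _ (c%:E * \sum_(M <= j <oo) (a j + (e' / (2 ^ j.+1)%:R)%:E))%E).
  rewrite -nneseriesZl; last first.
    by move=> j _; rewrite adde_ge0// lee_fin ltW// divr_gt0// ltr0n expn_gt0.
  apply: lee_nneseries => [j _ _|j _]; first by rewrite adde_ge0.
  apply: le_trans (leeD (zs_le _) (zs_le _)) _.
  rewrite -ge0_muleDr; last 2 first.
    by rewrite adde_ge0 ?nuclear_norm_ge0// lee_fin ltW.
    by rewrite adde_ge0 ?nuclear_norm_ge0// lee_fin ltW.
  apply: lee_wpmul2l; first by rewrite lee_fin.
  rewrite addeACA; apply: leeD => //.
  by rewrite -EFinD lee_fin /ep -splitr.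
have H := epsilon_trick (fun j => (M <= j)%N) a0 (ltW e'0).
have cond (f : nat -> \bar R) :
    (\sum_(M <= j <oo) f j = \sum_(0 <= j <oo | (M <= j)%N) f j)%E.
  by rewrite eseries_cond.
rewrite !cond; apply: (@le_trans _ _ (c%:E * (\sum_(0 <= j <oo | (M <= j)%N) a j + e'%:E))%E).
  by apply: lee_wpmul2l; [rewrite lee_fin|exact: H].
rewrite ge0_muleDr; [|by apply: nneseries_ge0|by rewrite lee_fin ltW].
by apply: leeD => //; rewrite -EFinM lee_fin mulrC; exact: ler_div1_mul (ltW e0) c0.
Qed.

End nuclear_norm_theory.

(** * Spectral density operators *)

Section spectral_operators.
Context {R : realType}.
Local Notation C := R[i].
Local Notation TR := (measurableTypeR R : measurableType _).
Local Notation mu := (leb01 R : {measure set TR -> \bar R}).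
Local Notation sq := (leb01sq R).
Variable r : int -> R -> R -> R.
Hypothesis rL2 : forall t, (fun x => r t x.1 x.2) \in Lfun sq 2%:E.
Local Notation Rop t := (int_op (ckernel (r t))).
Implicit Types (omega : R) (f : R -> R -> C) (h : R -> C).

Let spectral_coef omega (t : int) : C := ((2 * pi)^-1)%:C * expi (- (omega * t%:~R)).

Let inv2pi_ge0 : 0 <= (2 * pi)^-1 :> R.
Proof. by rewrite invr_ge0 mulr_ge0// pi_ge0. Qed.

Let normc_spectral_coef omega t : Normc.normc (spectral_coef omega t) = (2 * pi)^-1.
Proof. by rewrite Normc.normcM normc_expi mulr1 normc_real ger0_norm. Qed.

Let Rop_cLfun2 t h : cLfun2 mu h -> cLfun2 mu (Rop t h).
Proof. exact: (cLfun2_int_op (ckernel_kL2 rL2 t)). Qed.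

Lemma spectral_op_psumE omega m n h x : spectral_op_psum r omega m n h x =
  zsum m n (fun t => spectral_coef omega t * Rop t h x).
Proof.
by rewrite /spectral_op_psum /zsum mulr_sumr; apply: eq_bigr => k _; rewrite mulrA.
Qed.

Lemma spectral_op_psum_cLfun2 omega m n h : cLfun2 mu h ->
  cLfun2 mu (spectral_op_psum r omega m n h).
Proof.
move=> hL; rewrite /spectral_op_psum /zsum; apply: cLfun2Z.
by apply: cLfun2_sum => k; apply: cLfun2Z; exact: Rop_cLfun2.
Qed.

Lemma int_op_spectral_psum omega m n h : cLfun2 mu h ->
  {ae mu, forall x, int_op (spectral_psum r omega m n) h x = spectral_op_psum r omega m n h x}.
Proof.
move=> hL; have tL := spectral_term_kL2 rL2 omega.
have sL : kL2 (fun a b => zsum m n (fun t => spectral_term r omega t a b)).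
  by apply: kL2_sum => k; exact: tL.
have H1 := int_opZ_ae ((2 * pi)^-1)%:C sL hL.
have H2 := int_op_sum_ae (index_enum 'I_(m + n).+1)
  (F := fun k => spectral_term r omega (k%:Z - m%:Z)) (fun k => tL _) hL.
(* One null set for all times: there are countably many exceptional sets. *)
have H3 : {ae mu, forall x, forall t, int_op (spectral_term r omega t) h x =
    expi (- (omega * t%:~R)) * Rop t h x}.
  have /choice[N NP] : forall t, exists N : set TR, mu.-negligible N /\ forall x, ~ N x ->
      int_op (spectral_term r omega t) h x = expi (- (omega * t%:~R)) * Rop t h x.
    move=> t; have Z := int_opZ_ae (expi (- (omega * t%:~R))) (ckernel_kL2 rL2 t) hL.
    by eexists; split; [exact: Z|move=> x /contrapT].
  (* Even indices code the times j >= 0, odd ones the times -(j+1). *)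
  have : mu.-negligible (\bigcup_k N (if odd k then Negz k./2 else Posz k./2)).
    by apply: negligible_bigcup => k; exact: (NP _).1.
  apply: negligibleS => x /= /existsNP[t tx].
  exists (match t with Posz j => j.*2 | Negz j => j.*2.+1 end) => //.
  case: t tx => j tx /=; rewrite ?odd_double /= ?doubleK ?uphalf_double;
    by apply: contrapT => /(NP _).2.
apply: (aeS3 H1 H2 H3) => x E1 E2 E3.
rewrite /spectral_op_psum -[LHS]/(int_op (fun a b => ((2 * pi)^-1)%:C *
  zsum m n (fun t => spectral_term r omega t a b)) h x) E1; congr (_ * _).
by rewrite [LHS]E2; apply: eq_bigr => k _; exact: E3.
Qed.

(** The Hilbert-Schmidt bound turns L^2 convergence of kernels into strong convergence of
    operators. *)
Lemma spectral_density_op_near omega f : spectral_density_kernel 2%:E r omega f ->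
  forall h, cLfun2 mu h -> forall e : R, 0 < e -> exists N, forall m n,
    (N <= m)%N -> (N <= n)%N ->
    (cN mu (fun x => int_op f h x - spectral_op_psum r omega m n h x)%R <= e%:E)%E.
Proof.
move=> fD h hL e e0; have [fL /cvge0_pairP fcvg] := fD.
pose H := fine (cN mu h).
have HE : H%:E = cN mu h by rewrite fineK// cLfun2_fin.
have H0 : 0 <= H by rewrite fine_ge0// cN_ge0.
have [|N NP] := fcvg _ _ (divr_gt0 e0 (ltr_wpDl H0 ltr01)); first by move=> *; exact: knorm_ge0.
exists N => m n Nm Nn; have pL := spectral_psum_kL2 rL2 omega m n.
have E : {ae mu, forall x, int_op f h x - spectral_op_psum r omega m n h x =
    int_op (fun a b => f a b - spectral_psum r omega m n a b) h x}.
  apply: (aeS2 (int_opB_ae fL pL hL) (int_op_spectral_psum omega m n hL)) => x E1 E2.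
  by rewrite E1 E2.
have dL := kL2B fL pL.
have [md _] := (cLfun2P _ _).1 (cLfun2_int_op dL hL).
have /cLfun2P[mD _] : cLfun2 mu (fun x => int_op f h x - spectral_op_psum r omega m n h x).
  by apply: cLfun2B; [exact: cLfun2_int_op|exact: spectral_op_psum_cLfun2].
rewrite (cN_ae mD md E).
apply: le_trans (cN_int_op dL hL) _.
rewrite -HE; apply: le_trans (lee_wpmul2r _ (NP m n Nm Nn)) _; first by rewrite lee_fin.
by rewrite -EFinM lee_fin; exact: ler_div1_mul (ltW e0) H0.
Qed.

Hypothesis nuc : (\esum_(t in [set: int]) nuclear_norm (Rop t) < +oo)%E.

Let nuc0 t : (0 <= nuclear_norm (Rop t))%E.
Proof. exact: nuclear_norm_ge0. Qed.

Let pair_sum_oo :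
  (\sum_(0 <= j <oo) (nuclear_norm (Rop (Posz j)) + nuclear_norm (Rop (Negz j))) < +oo)%E.
Proof. by rewrite -(esum_int (a := fun t => nuclear_norm (Rop t))). Qed.

Let Rop_oo t : (nuclear_norm (Rop t) < +oo)%E.
Proof.
apply: le_lt_trans nuc; apply: esum_ge; exists [set t]; last by rewrite fsbig_set1.
by split; [exact: finite_set1|].
Qed.

Lemma nuclear_summable_knorm : (\esum_(t in [set: int]) knorm 2%:E (ckernel (r t)) < +oo)%E.
Proof.
apply: le_lt_trans nuc; apply: le_esum => t _.
exact: knorm_le_nuclear (ckernel_kL2 rL2 t).
Qed.

Lemma nuclear_norm_spectral_density omega f : spectral_density_kernel 2%:E r omega f ->
  (nuclear_norm (int_op f) <= ((2 * pi)^-1)%:E *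
    \esum_(t in [set: int]) nuclear_norm (Rop t))%E.
Proof.
move=> fD; rewrite (esum_int (a := fun t => nuclear_norm (Rop t)))//.
apply: (nuclear_norm_series_le Rop_cLfun2 Rop_oo (z := spectral_coef omega) (M := 0%N)) => //.
- by move=> t; rewrite normc_spectral_coef.
- by move=> h hL; apply: cLfun2_int_op => //; exact: fD.1.
- move=> h hL e e0; have [N NP] := spectral_density_op_near fD hL e0.
  exists N => n Nn; apply: le_trans (NP n n Nn Nn); rewrite le_eqVlt; apply/orP; left.
  by apply/eqP/eq_cN => x; rewrite spectral_op_psumE.
Qed.

Lemma nuclear_norm_spectral_density_fin omega f : spectral_density_kernel 2%:E r omega f ->
  (nuclear_norm (int_op f) < +oo)%E.
Proof.
move=> fD; apply: le_lt_trans (nuclear_norm_spectral_density fD) _.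
by rewrite lte_mul_pinfty// lee_fin.
Qed.

Lemma nuclear_norm_spectral_psum omega f : spectral_density_kernel 2%:E r omega f ->
  nuclear_norm (fun h tau => int_op f h tau - spectral_op_psum r omega mn.1 mn.2 h tau)
    @[mn --> (\oo, \oo)] --> 0%E.
Proof.
move=> fD; apply/cvge0_pairP => [mn|e e0]; first exact: nuclear_norm_ge0.
have [M MP] := series_tail_small (fun j => adde_ge0 (nuc0 (Posz j)) (nuc0 (Negz j)))
  pair_sum_oo (divr_gt0 e0 (ltr_wpDl inv2pi_ge0 ltr01)).
exists M => m n Mm Mn /=.
(* Coefficients of the remainder. As m, n >= M, both times of every index j < M lie between -m and
   n, so the bounding series starts at M. *)
pose z t : C := if (- m%:Z <= t <= n%:Z)%R then 0 else spectral_coef omega t.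
apply: (@le_trans _ _ (((2 * pi)^-1)%:E * \sum_(M <= j <oo)
    (nuclear_norm (Rop (Posz j)) + nuclear_norm (Rop (Negz j))))%E); last first.
  apply: le_trans (lee_wpmul2l _ (MP M (leqnn _))) _; first by rewrite lee_fin.
  by rewrite -EFinM lee_fin mulrC; exact: ler_div1_mul (ltW e0) inv2pi_ge0.
apply: (nuclear_norm_series_le Rop_cLfun2 Rop_oo (z := z)).
- by move=> t; rewrite /z; case: ifP => _; rewrite ?normc_spectral_coef// Normc.normc0.
- by move=> j jM; rewrite /z !ifT//; lia.
- move=> h hL; apply: cLfun2B; last exact: spectral_op_psum_cLfun2.
  by apply: cLfun2_int_op => //; exact: fD.1.
- move=> h hL d d0; have [N NP] := spectral_density_op_near fD hL d0.
  (* A rank beyond m and n makes [-k, k] contain [-m, n], as [zsum_outside] requires. *)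
  exists (N + m + n)%N => k Nk; have [Nk' mk nk] : [/\ N <= k, m <= k & n <= k]%N by split; lia.
  apply: le_trans (NP k k Nk' Nk'); rewrite le_eqVlt; apply/orP; left.
  apply/eqP/eq_cN => x; rewrite !spectral_op_psumE.
  rewrite (_ : zsum k k _ = zsum k k (fun t => if (- m%:Z <= t <= n%:Z)%R then 0 else
      spectral_coef omega t * Rop t h x)).
    by rewrite zsum_outside// opprB addrA subrK.
  by apply: eq_zsum => t; rewrite /z; case: ifP => // _; rewrite mul0r.
Qed.

End spectral_operators.

Local Close Scope complex_scope.

Theorem proposition2p1 (R : realType) (d : measure_display)
    (Om : measurableType d) (P : probability Om R)
    (X : int -> {RV P >-> @L2borel R}) (r : int -> R -> R -> R)
    (X_stationary : strictly_stationary X)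
    (X_L2 : (\int[P]_w (L2norm (X 0%Z w) ^+ 2) < +oo)%E)
    (r_autocov : autocov_kernels X r) :
  (forall p : \bar R, p = 2%:E \/ p = +oo%E ->
    (\esum_(t in [set: int]) knorm p (ckernel (r t)) < +oo)%E ->
    (exists2 f : R -> R -> R -> R[i], jointly_measurable f &
      forall omega, spectral_density_kernel p r omega (f omega)) /\
    (forall f : R -> R -> R -> R[i],
      (forall omega, spectral_density_kernel p r omega (f omega)) ->
      [/\ exists M : R, forall omega, (knorm p (f omega) <= M%:E)%E,
          forall e : R, 0 < e -> exists2 delta : R, 0 < delta &
            forall omega1 omega2 : R, `|omega1 - omega2| < delta ->
              (knorm p (fun tau sigma =>
                (f omega1 tau sigma - f omega2 tau sigma)%R) < e%:E)%E,
          forall omega, self_adjoint (int_op (f omega)) /\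
            nonneg_definite (int_op (f omega)) &
          jointly_measurable f -> inversion_formula p r f]))
  /\
  ((\esum_(t in [set: int]) nuclear_norm (int_op (ckernel (r t))) < +oo)%E ->
    forall omega : R,
    (exists f : R -> R -> R[i], spectral_density_kernel 2%:E r omega f) /\
    (forall f : R -> R -> R[i], spectral_density_kernel 2%:E r omega f ->
      [/\ nuclear_norm (fun h tau =>
            int_op f h tau - spectral_op_psum r omega mn.1 mn.2 h tau)
            @[mn --> (\oo, \oo)] --> 0%E,
          (nuclear_norm (int_op f) < +oo)%E &
          (nuclear_norm (int_op f) <= ((2 * pi)^-1)%R%:E *
            \esum_(t in [set: int]) nuclear_norm (int_op (ckernel (r t))))%E])).
Proof.
have [rL2 [Y XY rY]] := r_autocov.
split=> [p Hp rp|nuc omega]; last first.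
  have r2 := nuclear_summable_knorm rL2 nuc.
  split.
    by have [f [_ fD _]] := spectral_density_exists rL2 (or_introl erefl) r2; exists (f omega).
  move=> f fD; split.
  - exact: nuclear_norm_spectral_psum rL2 nuc _ _ fD.
  - exact: nuclear_norm_spectral_density_fin rL2 nuc _ _ fD.
  - exact: nuclear_norm_spectral_density rL2 nuc _ _ fD.
have r2 : (\esum_(t in [set: int]) knorm 2%:E (ckernel (r t)) < +oo)%E.
  by case: Hp rp => -> // ; exact: summable_knorm_le2y.
split.
  by have [f [mf fD _]] := spectral_density_exists rL2 Hp rp; exists f.
move=> f fD; split.
- exact: spectral_density_bounded rL2 _ Hp rp _ fD.
- by move=> e; exact: (spectral_density_unif_continuous rL2 Hp rp fD).
(* Self-adjointness and positivity rest on L^2 convergence, which supremum convergence implies. *)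
- move=> omega; have fD2 : spectral_density_kernel 2%:E r omega (f omega).
    have := fD omega; case: Hp => -> // ; exact: spectral_density_kernel_y2.
  pose zL := zeta_cLfun2 X_stationary X_L2 XY.
  have zcov t s h g := @qform_covariance _ _ _ _ _ X_stationary X_L2 _ XY r t s h g rL2 rY.
  split; first exact: (spectral_self_adjoint rL2 zL zcov fD2).
  by move=> h hL; exact: (spectral_nonneg_definite rL2 zL zcov r2 fD2 hL).
- by move=> mf; exact: inversion_formula_holds.
Qed.
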